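(* Assume that $F:\Omega\times X\to\mathbb{R}^m$ is continuous, of class $C^1$ with respect to the second variable, that $F(\Omega\times X_1)$ is bounded in $\mathbb{R}^m$ for every bounded set $X_1\subset X$, that $$F(\omega,\psi)-F(\omega,\phi)\geq B\,(\psi(0)-\phi(0))\quad\text{whenever }\phi\leq_B\psi \text{ and }\omega\in\Omega,$$ that $$F(\omega,\lambda\psi)\ge\lambda F(\omega,\psi)\quad\text{whenever }\psi\ge_B0,\ \lambda\in[0,1]\text{ and }\omega\in\Omega,$$ and that there exists a pair $(\omega_0,\phi_0)\in\Omega\times\operatorname{Int}\widetilde K_B$ with bounded semitrajectory $\{(\omega_0\cdot t,y_t(\omega_0,\phi_0))\mid t\ge0\}$ and such that $y_t(\omega_0,\phi_0)\ge_B\psi_0$ for some $\psi_0\gg_B0$ and each $t\ge0$. Consider the set $$E=\bigcup_{\omega\in\Omega,\ \phi\gg_B0}\mathcal{O}(\omega,\phi)$$ and, for $j\ge1$, $C_j=\{\varphi\in X_L\mid j^{-1}\phi_0\le_B\varphi\le_B j\,\phi_0\}$. Then: (i) The set $E\subset\Omega\times\operatorname{Int}\widetilde K_B\subset\Omega\times X_L$ is invariant and locally compact. (ii) $\tau:\mathbb{R}^+\times E\to E$ is continuous for the topology of $\Omega\times X_L$ on $E$. (iii) For each $j\ge1$, $$\lim_{t\to\infty}\operatorname{dist}(y_t(\omega,C_j),E(\omega\cdot t))=0\quad\text{and}\quad\lim_{t\to\infty}\operatorname{dist}(y_t(\omega\cdot(-t),C_j),E(\omega))=0$$ uniformly for $\omega\in\Omega$,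 where $E(\omega)=\{\varphi\mid(\omega,\varphi)\in E\}$ denotes the $\omega$-section of $E$.
   Context: $\Omega$ is a compact metric space with a continuous minimal flow $\mathbb{R}\times\Omega\to\Omega$, $(t,\omega)\mapsto\omega\cdot t$. Fix $r>0$, $m\ge 1$. $X=C([-r,0],\mathbb{R}^m)$ with the sup-norm $\|\varphi\|_\infty=\sup_{s\in[-r,0]}\|\varphi(s)\|$, where $\|\cdot\|$ is the maximum norm on $\mathbb{R}^m$. For a continuous $y:[-r,\infty)\to\mathbb{R}^m$ and $t\ge0$, $y_t\in X$ is $y_t(s)=y(t+s)$, $s\in[-r,0]$. For $y\in\mathbb{R}^m$, $y\ge0$ (resp. $y\gg0$) means all components are nonnegative (resp. positive); for $\phi\in X$, $\phi\ge0$ (resp. $\phi\gg0$) means $\phi(s)\ge0$ (resp. $\phi(s)\gg0$) for all $s\in[-r,0]$. $B=[b_{ij}]$ is a fixed real $m\times m$ quasipositive matrix ($b_{ij}\ge0$ for $i\ne j$). The exponential ordering is given by the cone $K_B=\{\phi\in X\mid \phi\ge0,\ \phi(t)\ge e^{B(t-s)}\phi(s)\text{ for } -r\le s\le t\le0\}$: $\phi\le_B\psi$ iff $\psi-\phi\in K_B$. $X_L\subset X$ is the Banach space of Lipschitz functions with norm $\|\phi\|_L=\|\phi\|_\infty+\sup\{\|\phi(t)-\phi(s)\|/|t-s| : s\ne t\in[-r,0]\}$; $\widetilde K_B=K_B\cap X_L$, whose interior in $X_L$ is $\operatorname{Int}\widetilde K_B=\{\phi\in X_L\mid \phi\gg0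 \text{ and, for some }\varepsilon>0,\ \phi'-B\phi\ge(\varepsilon,\dots,\varepsilon)\text{ a.e. on }[-r,0]\}$. We write $\phi\gg_B0$ iff $\phi\in\operatorname{Int}\widetilde K_B$. For $\omega\in\Omega$, $\varphi\in X$, $y(t,\omega,\varphi)$ denotes the unique solution of $y'(t)=F(\omega\cdot t,y_t)$, $t\ge0$, with $y(s,\omega,\varphi)=\varphi(s)$ for $s\in[-r,0]$, and $y_t(\omega,\varphi)(s)=y(t+s,\omega,\varphi)$; for a set $C$, $y_t(\omega,C)=\{y_t(\omega,\varphi)\mid\varphi\in C\}$. The induced skew-product semiflow is $\tau_t(\omega,\varphi)=\tau(t,\omega,\varphi)=(\omega\cdot t,y_t(\omega,\varphi))$ (under the hypotheses of the claim it is globally defined on $\Omega\times K_B$). Invariant means $\tau_t(E)=E$ for all $t\ge0$. $\mathcal{O}(\omega,\phi)$ is the omega-limit set in $\Omega\times X_L$: the set of limits in $\Omega\times X_L$ of sequences $(\omega\cdot t_n,y_{t_n}(\omega,\phi))$ with $t_n\uparrow\infty$. The Hausdorff semidistance between subsets of $X_L$ is $\operatorname{dist}(Y_1,Y_2)=\sup_{y_1\in Y_1}\inf_{y_2\in Y_2}\|y_1-y_2\|_L$. *)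

(* Defs.v *)
From HB Require Import structures.
From mathcomp Require Import all_boot all_order all_algebra.
From mathcomp Require Import all_classical all_reals all_analysis.

Set Implicit Arguments.
Unset Strict Implicit.
Unset Printing Implicit Defensive.

Import Order.TTheory GRing.Theory Num.Theory.
Import numFieldNormedType.Exports.

Local Open Scope classical_set_scope.
Local Open Scope ring_scope.

Section Flow.
Context {R : realType} {Omega : metricType R}.
Implicit Type sigma : R -> Omega -> Omega.

Definition continuous_flow sigma : Prop :=
  [/\ continuous (fun p : R * Omega => sigma p.1 p.2),
      forall w, sigma 0 w = w &
      forall s t w, sigma (s + t) w = sigma t (sigma s w)].

Definition minimal_flow sigma : Prop :=
  forall S : set Omega, closed S -> S !=set0 ->
    (forall t, sigma t @` S = S) -> S = setT.

End Flow.

Section Vectors.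
Context {R : realType} {m : nat}.

Definition vle (x y : 'cV[R]_m) : Prop := forall i, x i 0 <= y i 0.

Definition quasipositive (B : 'M[R]_m) : Prop :=
  forall i j, i != j -> 0 <= B i j.

Definition expmx (A : 'M[R]_m) : 'M[R]_m :=
  limn (series (fun k => (k`!%:R)^-1 *: A ^+ k)).

Lemma continuous_linear_combination (T : topologicalType) (a : R)
    (f g : T -> 'cV[R]_m) :
  continuous f -> continuous g -> continuous (fun x => a *: f x + g x).
Proof.
move=> cf cg x; apply: cvgD; last exact: cg.
by apply: cvgZ; [exact: cvg_cst | exact: cf].
Qed.

End Vectors.

Notation delay_itv r := (set_type `[- r%:num, 0]%classic).

Section PhaseSpaces.
Context {R : realType} (m : nat) (r : {posnum R}).
Local Notation I := (delay_itv r).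

Lemma delay_itv0_subproof : (0 : R) \in (`[- r%:num, 0]%classic : set R).
Proof. by rewrite inE /= in_itv /= lexx oppr_le0 andbT. Qed.

Definition delay_itv0 : I := exist _ 0 delay_itv0_subproof.

Lemma delay_itv_bounds (s : I) : - r%:num <= val s <= 0.
Proof. by case: s => s /= /set_mem/=; rewrite in_itv. Qed.

Lemma delay_itv_compact : compact [set: I].
Proof.
have cA : compact (`[- r%:num, 0]%classic : set R) by exact: segment_compact.
pose f : R -> I := fun x => insubd delay_itv0 x.
have cf : {within (`[- r%:num, 0]%classic : set R), continuous f}.
  apply/subspace_sigL_continuousP.
  rewrite (_ : sigL _ f = idfun); first by move=> x; exact: cvg_id.
  by apply/funext => s; apply: val_inj; congr val; exact: (valKd delay_itv0 s).
rewrite (_ : setT = f @` (`[- r%:num, 0]%classic)); last first.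
  apply/seteqP; split=> // s _; exists (val s : R); last exact: valKd.
  by rewrite /= in_itv; exact: delay_itv_bounds.
exact: continuous_compact.
Qed.

Definition continuous_pred : {pred I -> 'cV[R]_m} :=
  [pred f : I -> 'cV[R]_m | `[< continuous f >]].

Record CX := MkCX {
  CXfun :> I -> 'cV[R]_m ;
  _ : CXfun \in continuous_pred }.

HB.instance Definition _ := [isSub for CXfun].
HB.instance Definition _ := [Choice of CX by <:].

Lemma continuous_pred_submod_closed : submod_closed continuous_pred.
Proof.
split; first by apply/asboolP => s; exact: (@cst_continuous _ _ (0 : 'cV[R]_m)).
move=> a f g /asboolP cf /asboolP cg; apply/asboolP.
by have := @continuous_linear_combination R m I a f g cf cg.
Qed.

HB.instance Definition _ := GRing.isSubmodClosed.Build _ _ continuous_pred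
  continuous_pred_submod_closed.
HB.instance Definition _ := [SubChoice_isSubLmodule of CX by <:].

Lemma CX_continuous (f : CX) : continuous f.
Proof. by case: f => f /= /asboolP. Qed.

Lemma CX_ext (f g : CX) : (forall s, f s = g s) -> f = g.
Proof. by move=> fg; apply: val_inj; apply/funext. Qed.

Definition CXnorm (f : CX) : R := sup [set `|f s| | s in [set: I]].

Lemma CXnorm_has_sup (f : CX) : has_sup [set `|f s| | s in [set: I]].
Proof.
split; first by exists `|f delay_itv0|, delay_itv0.
have /compact_bounded : compact ((f : I -> 'cV[R]_m) @` [set: I]).
  apply: continuous_compact delay_itv_compact.
  exact/continuous_subspaceT/CX_continuous.
case=> M [_ fM]; exists (M + 1) => _ [s _ <-].
by apply: (fM (M + 1)); [rewrite ltrDl | exists s].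
Qed.

Lemma CXnorm_ge (f : CX) s : `|f s| <= CXnorm f.
Proof. by apply: sup_upper_bound (CXnorm_has_sup f) _ _; exists s. Qed.

Lemma CXnorm_le (f : CX) M : (forall s, `|f s| <= M) -> CXnorm f <= M.
Proof.
move=> fM; apply: ge_sup => [|_ [s _ <-]//].
by case: (CXnorm_has_sup f).
Qed.

Lemma CXnormD (f g : CX) : CXnorm (f + g) <= CXnorm f + CXnorm g.
Proof.
apply: CXnorm_le => s; apply: le_trans (ler_normD _ _) _.
by apply: lerD; exact: CXnorm_ge.
Qed.

Lemma CXnormZ (l : R) (f : CX) : CXnorm (l *: f) = `|l| * CXnorm f.
Proof.
have le l' g : CXnorm (l' *: g) <= `|l'| * CXnorm g.
  apply: CXnorm_le => s; rewrite [leLHS]normrZ.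
  by apply: ler_wpM2l => //; exact: CXnorm_ge.
have [->|l0] := eqVneq l 0.
  apply/eqP; rewrite eq_le le/= normr0 mul0r.
  exact: le_trans (CXnorm_ge _ delay_itv0).
apply/eqP; rewrite eq_le le/= -ler_pdivlMl ?normr_gt0// -normfV.
by rewrite -{1}[f](scalerK l0); exact: le.
Qed.

Lemma CXnorm0_eq0 (f : CX) : CXnorm f = 0 -> f = 0.
Proof.
move=> f0; apply: CX_ext => s; apply/eqP; rewrite -normr_le0 -f0.
exact: CXnorm_ge.
Qed.

HB.instance Definition _ := Lmodule_isNormed.Build R CX
  CXnormD CXnormZ CXnorm0_eq0.

Definition lipschitz_pred : {pred CX} :=
  [pred f : CX | `[< exists M : R, forall s t : I,
    `|f t - f s| <= M * `|val t - val s| >]].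

Record XL := MkXL {
  XLfun :> CX ;
  _ : XLfun \in lipschitz_pred }.

HB.instance Definition _ := [isSub for XLfun].
HB.instance Definition _ := [Choice of XL by <:].

Lemma lipschitz_pred_submod_closed : submod_closed lipschitz_pred.
Proof.
split.
  by apply/asboolP; exists 0 => s t; rewrite mul0r subrr normr0.
move=> a f g /asboolP[M fM] /asboolP[N gN]; apply/asboolP.
exists (`|a| * M + N) => s t; rewrite mulrDl -mulrA.
rewrite (_ : _ - _ = a *: (f t - f s) + (g t - g s)); last first.
  by rewrite scalerBr addrACA opprD.
apply: le_trans (ler_normD _ _) _; apply: lerD => //.
by rewrite normrZ; apply: ler_wpM2l.
Qed.

HB.instance Definition _ := GRing.isSubmodClosed.Build _ _ lipschitz_pred
  lipschitz_pred_submod_closed.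
HB.instance Definition _ := [SubChoice_isSubLmodule of XL by <:].

(* Division by zero gives 0, so the diagonal terms do not affect the
   supremum. *)
Definition lip_const (f : XL) : R :=
  sup [set `|f st.2 - f st.1| / `|val st.2 - val st.1| | st in [set: I * I]].

Lemma lip_const_has_sup (f : XL) :
  has_sup [set `|f st.2 - f st.1| / `|val st.2 - val st.1|
           | st in [set: I * I]].
Proof.
split; first by eexists; exists (delay_itv0, delay_itv0).
case: f => f /= /asboolP[M fM]; exists `|M| => _ [[s t] _ <-] /=.
have [->|st] := eqVneq (val t) (val s).
  by rewrite subrr normr0 invr0 mulr0.
rewrite ler_pdivrMr ?normr_gt0 ?subr_eq0//.
apply: le_trans (fM _ _) _; apply: ler_wpM2r => //; exact: ler_norm.
Qed.

Lemma lip_const_ge (f : XL) s t :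
  `|f t - f s| / `|val t - val s| <= lip_const f.
Proof. by apply: sup_upper_bound (lip_const_has_sup f) _ _; exists (s, t). Qed.

Lemma lip_const_le (f : XL) M :
  (forall s t, `|f t - f s| / `|val t - val s| <= M) -> lip_const f <= M.
Proof.
move=> fM; apply: ge_sup => [|_ [[s t] _ <-]//].
by case: (lip_const_has_sup f).
Qed.

Lemma lip_const_ge0 (f : XL) : 0 <= lip_const f.
Proof. exact: le_trans (lip_const_ge _ delay_itv0 delay_itv0). Qed.

Lemma lip_constD (f g : XL) : lip_const (f + g) <= lip_const f + lip_const g.
Proof.
apply: lip_const_le => s t.
apply: (@le_trans _ _ (`|f t - f s| / `|val t - val s| +
                       `|g t - g s| / `|val t - val s|)); last first.
  by apply: lerD; exact: lip_const_ge.
rewrite -mulrDl; apply: ler_wpM2r => //.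
rewrite (_ : _ - _ = (f t - f s) + (g t - g s)); first exact: ler_normD.
by rewrite addrACA opprD.
Qed.

Lemma lip_constZ (l : R) (f : XL) : lip_const (l *: f) = `|l| * lip_const f.
Proof.
have le l' g : lip_const (l' *: g) <= `|l'| * lip_const g.
  apply: lip_const_le => s t.
  rewrite (_ : _ - _ = l' *: (g t - g s)); last by rewrite scalerBr.
  by rewrite normrZ -mulrA; apply: ler_wpM2l => //; exact: lip_const_ge.
have [->|l0] := eqVneq l 0.
  by apply/eqP; rewrite eq_le le/= normr0 mul0r lip_const_ge0.
apply/eqP; rewrite eq_le le/= -ler_pdivlMl ?normr_gt0// -normfV.
by rewrite -{1}[f](scalerK l0); exact: le.
Qed.

Definition XLnorm (f : XL) : R := `|val f| + lip_const f.

Lemma XLnormD (f g : XL) : XLnorm (f + g) <= XLnorm f + XLnorm g.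
Proof.
rewrite /XLnorm addrACA; apply: lerD; last exact: lip_constD.
exact: ler_normD.
Qed.

Lemma XLnormZ (l : R) (f : XL) : XLnorm (l *: f) = `|l| * XLnorm f.
Proof. by rewrite /XLnorm lip_constZ mulrDr; congr (_ + _); exact: normrZ. Qed.

Lemma XLnorm0_eq0 (f : XL) : XLnorm f = 0 -> f = 0.
Proof.
move=> /eqP; rewrite paddr_eq0 ?lip_const_ge0// normr_eq0 => /andP[/eqP f0 _].
exact: val_inj.
Qed.

HB.instance Definition _ := Lmodule_isNormed.Build R XL
  XLnormD XLnormZ XLnorm0_eq0.

End PhaseSpaces.

Section ExponentialOrdering.
Context {R : realType} {m : nat} {r : {posnum R}} (B : 'M[R]_m).
Local Notation X := (CX m r).
Local Notation I := (delay_itv r).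

Definition KB : set X := [set phi : X | (forall s, vle 0 (phi s)) /\
  forall s t : I, val s <= val t ->
    vle (expmx ((val t - val s) *: B) *m phi s) (phi t)].

Definition leB (phi psi : X) : Prop := KB (psi - phi).

Definition KBL : set (XL m r) := [set phi : XL m r | KB phi].

(* phi >>_B 0, the interior being taken for the Lipschitz norm *)
Definition gtB0 (phi : XL m r) : Prop := KBL° phi.

End ExponentialOrdering.

(* F is C^1 in its second variable: the partial Frechet derivative exists and
   (w, phi) |-> D_2 F(w, phi) is continuous for the operator norm. *)
Definition C1_second {R : realType} {Omega : topologicalType}
    {X Y : normedModType R} (F : Omega -> X -> Y) : Prop :=
  (forall w phi, differentiable (F w) phi) /\
 (forall (w : Omega) (phi : X) (e : R), 0 < e ->
     \forall w' \near w & psi \near phi, forall h : X,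
       `|'d (F w') psi h - 'd (F w) phi h| <= e * `|h|).

Section Semiflow.
Context {R : realType} {m : nat} {r : {posnum R}} {Omega : metricType R}.
Variables (sigma : R -> Omega -> Omega) (F : Omega -> CX m r -> 'cV[R]_m).
Local Notation V := 'cV[R]_m.
Local Notation X := (CX m r).
Local Notation I := (delay_itv r).

(* y_t; the default value 0 is taken only if y is not continuous on
   [t - r, t]. *)
Definition segment (y : R -> V) (t : R) : X :=
  insubd (0 : X) (fun s : I => y (t + val s)).

(* The values of y to the left of -r are irrelevant. *)
Definition is_solution (w : Omega) (phi : X) (y : R -> V) : Prop :=
  [/\ {within `[- r%:num, +oo[, continuous y},
      forall s : I, y (val s) = phi s,
      h^-1 *: (y h - y 0) @[h --> 0^'+] --> F (sigma 0 w) (segment y 0) &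
      forall t : R, 0 < t -> is_derive t 1 y (F (sigma t w) (segment y t))].

Definition solution (w : Omega) (phi : X) : R -> V :=
  xget (fun=> 0) [set y | is_solution w phi y].

Definition sol_segment (t : R) (w : Omega) (phi : X) : X :=
  segment (solution w phi) t.

(* y_t(w, phi) as an element of X_L; the default value 0 is taken only if
   y_t(w, phi) is not Lipschitz, which never happens for Lipschitz phi. *)
Definition sol_segmentL (t : R) (w : Omega) (phi : XL m r) : XL m r :=
  insubd (0 : XL m r) (sol_segment t w phi).

Definition skew_product (t : R) (p : Omega * XL m r) : Omega * XL m r :=
  (sigma t p.1, sol_segmentL t p.1 p.2).

Definition omega_limit (w : Omega) (phi : XL m r) : set (Omega * XL m r) :=
  [set p | exists t_ : nat -> R,
    [/\ forall n, 0 <= t_ n, nondecreasing_seq t_, t_ @ \oo --> +oo &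
        skew_product (t_ n) (w, phi) @[n --> \oo] --> p]].

Definition omega_limits (B : 'M[R]_m) : set (Omega * XL m r) :=
  [set p | exists w phi, gtB0 B phi /\ omega_limit w phi p].

End Semiflow.

Definition fiber {T U : Type} (E : set (T * U)) (w : T) : set U :=
  [set u | E (w, u)].

Definition order_box {R : realType} {m : nat} {r : {posnum R}}
    (B : 'M[R]_m) (phi0 : XL m r) (j : nat) : set (XL m r) :=
  [set phi : XL m r |
    leB B (j%:R^-1 *: phi0) phi /\ leB B phi (j%:R *: phi0)].

Definition semidist {R : realType} {V : normedModType R} (Y1 Y2 : set V) :
    \bar R :=
  ereal_sup [set ereal_inf [set `|y1 - y2|%:E | y2 in Y2] | y1 in Y1].

Definition cvg0_uniformly {R : realType} {T : Type} (d : R -> T -> \bar R) :=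
  forall e : R, 0 < e ->
    \forall t \near +oo, forall w : T, (`|d t w| < e%:E)%E.

(* Main.v *)
Require Import Defs.
From mathcomp Require Import all_boot all_order all_algebra.
From mathcomp Require Import all_classical all_reals all_analysis.
From mathcomp Require Import ring lra.

Set Implicit Arguments.
Unset Strict Implicit.
Unset Printing Implicit Defensive.

Import Order.TTheory GRing.Theory Num.Theory.
Import numFieldNormedType.Exports.

Local Open Scope classical_set_scope.
Local Open Scope ring_scope.

(* Monotonicity and sublinearity make the solutions non-expansive for the part
   metric of the cone [K_B], so that the initial data at finite part distance
   from the given persistent trajectory have global orbits which stay in a
   bounded part-metric ball.  Such orbits are equicontinuous together with their
   derivatives, hence limits of time translates along ultrafilters exist for
   the Lipschitz norm and are entire orbits in the same ball.

   On the entire orbits over a point [w], taking limits along times tending to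
   -oo which bring [w] back to [w] expands the part metric.  An expansion of a
   compact space is recurrent and therefore an isometry: the part distance of
   two entire orbits over [w] is constant in time.  Consequently limits along
   times tending to +oo are isometries as well, entire orbits are recurrent,
   and [E] is exactly the set of the points of the entire orbits which are
   bounded in the part metric.  The isometries also carry the orbits over [w]
   to orbits over nearby points, so the sections of [E] depend lower
   semicontinuously on the base point.  Local compactness, continuity and
   uniform attraction then follow from the compactness of the balls. *)

(** * Limits along ultrafilters and differentiation of vector functions *)

(** Sublinearity is not assumed to be strict, so the part metric is only non-expanding: a section of
    [E] may meet many orbits, and no contraction argument can single one out. Rigidity of expansions
    takes the place of contraction. Backward motion is available only along entire orbits, which are
    therefore handled as functions on the whole line.

    Two topologies have to be reconciled. Order bounds control the sup-norm only, while an interior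
    point is an order unit for the Lipschitz norm; closeness in the part metric is thus deduced from
    Lipschitz closeness. The equation supplies the missing regularity: [F] is bounded on part balls,
    and convergence of segments forces convergence of derivatives.

    One ultrafilter defines a limit for all orbits at once, without extracting subsequences. Limits
    thereby become self-maps of sets of entire orbits, which can be iterated, as the recurrence
    argument requires. The part distance is kept in multiplicative form, with constants [c >= 1];
    strict inequalities [c < c'] absorb the errors of approximation and are removed at the end
    because the cone is closed. *)

Section Ultrafilters.

Lemma fmap_ultra (T S : Type) (f : T -> S) (U : set_system T) :
  UltraFilter U -> UltraFilter (f @ U).
Proof.
move=> UU; split; first exact: fmap_proper_filter.
move=> G GP UG; apply/seteqP; split=> A GA; last exact: UG.
have [//|UnA] := in_ultra_setVsetC (f @^-1` A) UU.
have : G (A `&` ~` A) by apply: filterI => //; exact: UG.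
by rewrite setICr => /filter_not_empty.
Qed.

Lemma compact_ultra_cvg (T : Type) (S : topologicalType) (A : set S)
    (f : T -> S) (U : set_system T) :
  UltraFilter U -> compact A -> (\forall a \near U, A (f a)) ->
  exists2 l, A l & f @ U --> l.
Proof.
move=> UU; rewrite compact_ultra => cA UA.
have [l [Al fl]] := cA _ (fmap_ultra f UU) UA.
by exists l.
Qed.

Lemma ultra_bounded_cvg (R : realType) (T : Type) (f : T -> R) (K : R)
    (U : set_system T) :
  UltraFilter U -> (\forall a \near U, `|f a| <= K) -> cvg (f @ U).
Proof.
move=> UU fK.
have fI : \forall a \near U, `[- K, K]%classic (f a).
  by apply: filterS fK => a; rewrite /= in_itv /= ler_norml.
have [l _ fl] := compact_ultra_cvg UU (@segment_compact _ (- K) K) fI.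
by apply/cvg_ex; exists l.
Qed.

Lemma nat_ultrafilter : exists U : set_system nat,
  UltraFilter U /\ \oo `<=` U.
Proof. exact: ultraFilterLemma. Qed.

End Ultrafilters.

Section VectorCalculus.
Context {R : realType} {m : nat}.
Local Notation V := 'cV[R]_m.
Implicit Types (x : V) (y : R -> V).

Lemma coord_le_norm x i : `|x i 0| <= `|x|.
Proof.
rewrite [leRHS]/Num.Def.normr/= mx_normrE.
exact: (le_bigmax _ (fun i : 'I_m * 'I_1 => `|x i.1 i.2|) (i, 0)).
Qed.

Lemma cV_norm_le x K : 0 <= K -> (forall i, `|x i 0| <= K) -> `|x| <= K.
Proof.
move=> K0 xK; rewrite [leLHS]/Num.Def.normr/= mx_normrE.
by apply: bigmax_le => // -[i j] _ /=; rewrite ord1.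
Qed.

(** Multiplying the difference quotient by [h] removes the punctured neighbourhood, so reflections,
    shifts and limits of derivatives reduce to plain estimates near [0]. *)
Lemma is_derive_expansion (W : normedModType R) (f : R -> W) (t : R) (v : W) :
  is_derive t (1 : R) f v <-> forall e, 0 < e ->
    \forall h \near (0 : R), `|f (t + h) - f t - h *: v| <= e * `|h|.
Proof.
split=> [[df dv] e e0|H].
  move/cvgrPdist_le : df; rewrite -/(derive f t 1) dv => /(_ _ e0).
  rewrite /= near_withinE; apply: filterS => h H.
  have [->|h0] := eqVneq h 0.
    by rewrite addr0 subrr scale0r subrr !normr0 mulr0.
  have {H} := H h0; rewrite scaler1 => H.
  rewrite (_ : _ - _ = - (h *: (v - h^-1 *: (f (h + t) - f t)))).
    by rewrite normrN normrZ mulrC ler_wpM2r.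
  by rewrite scalerBr scalerA divff// scale1r opprB [t + h]addrC.
suff : (fun h => h^-1 *: ((f \o shift t) (h *: (1 : R)) - f t)) @ 0^' --> v.
  move=> H'; split; first by apply/cvg_ex; exists v.
  exact: cvg_lim H'.
apply/cvgrPdist_le => e e0; rewrite near_withinE.
move: (H _ e0); apply: filterS => h hf h0 /=.
rewrite scaler1 (_ : v - _ = - (h^-1 *: (f (t + h) - f t - h *: v))).
  rewrite normrN normrZ normfV mulrC ler_pdivrMr ?normr_gt0//.
by rewrite [in RHS]scalerBr scalerA mulVf// scale1r opprB [t + h]addrC.
Unshelve. all: by end_near.
Qed.

Lemma is_derive_mxP (p q : nat) (M : R -> 'M[R]_(p, q)) (t : R)
    (D : 'M[R]_(p, q)) :
  is_derive t (1 : R) M D <->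
  forall i j, is_derive t (1 : R) (fun s => M s i j) (D i j).
Proof.
split=> [[dM MD] i j|MD].
  split; first exact: (derivable_mxP _ _ _).1 dM i j.
  by rewrite -MD derive_mx// mxE.
have dM : derivable M t 1 by apply/derivable_mxP => i j; case: (MD i j).
split=> //; rewrite derive_mx//; apply/matrixP => i j.
by rewrite mxE; case: (MD i j).
Qed.

Lemma is_derive_coord y (t : R) v i :
  is_derive t (1 : R) y v -> is_derive t (1 : R) (fun s => y s i 0) (v i 0).
Proof. by move=> /is_derive_mxP. Qed.

Lemma continuous_coord y i : continuous y -> continuous (fun s => y s i 0).
Proof.
move=> cy s; apply: (@continuous_comp _ _ _ y (fun M : V => M i 0)).
  exact: cy.
exact: coord_continuous.
Qed.

(** The coordinates share no mean value point, but the maximum norm lets each use its own.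
    Subtracting the linear part of slope [v] makes this an estimate of a first-order remainder. *)
Lemma cV_mvt_le y (dy : R -> V) v (a b e : R) : a <= b -> continuous y ->
  (forall s, a < s < b -> is_derive s (1 : R) y (dy s)) ->
  (forall s, a < s < b -> `|dy s - v| <= e) -> 0 <= e ->
  `|y b - y a - (b - a) *: v| <= e * (b - a).
Proof.
move=> ab cy yd dv e0; apply: cV_norm_le => [|i].
  by rewrite mulr_ge0// subr_ge0.
have [->|neqab] := eqVneq a b.
  by rewrite !subrr scale0r subrr mxE normr0 mulr0.
have ltab : a < b by rewrite lt_neqAle neqab.
have [||c cab yE] := @MVT R (fun s => y s i 0) (fun s => dy s i 0) a b ltab.
- by move=> s; rewrite in_itv /= => sab; apply: is_derive_coord; exact: yd.
- exact/continuous_subspaceT/continuous_coord.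
rewrite !mxE yE mulrC -mulrBr normrM mulrC.
rewrite [`|b - a|]ger0_norm ?subr_ge0//; apply: ler_wpM2r.
  by rewrite subr_ge0.
apply: le_trans (dv c _); last by move: cab; rewrite in_itv.
by apply: le_trans (coord_le_norm _ i); rewrite !mxE.
Qed.

Lemma cV_lipschitz y (dy : R -> V) (a b K : R) : continuous y -> 0 <= K ->
  (forall s, a < s < b -> is_derive s (1 : R) y (dy s)) ->
  (forall s, a < s < b -> `|dy s| <= K) ->
  forall s t, a <= s <= b -> a <= t <= b -> `|y t - y s| <= K * `|t - s|.
Proof.
move=> cy K0 yd dK s t; wlog st : s t / s <= t => [H|] sab tab.
  have [st|/ltW ts] := leP s t; first exact: H.
  by rewrite distrC [`|t - s|]distrC; exact: H.
move: sab tab => /andP[as_ _] /andP[_ tb].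
have := @cV_mvt_le y dy 0 s t K st cy; rewrite scaler0 subr0.
rewrite [`|t - s|]ger0_norm ?subr_ge0//; apply=> // u /andP[su ut].
  by apply: yd; rewrite (le_lt_trans as_ su) (lt_le_trans ut tb).
by rewrite subr0; apply: dK; rewrite (le_lt_trans as_ su) (lt_le_trans ut tb).
Qed.

End VectorCalculus.

(** * Convergence that is locally uniform in time *)

Section JointConvergence.
Context {R : realType}.

Definition joint_cvg (T : Type) (W : normedModType R) (U : set_system T)
    (f : T -> R -> W) (t : R) (l : W) : Prop :=
  forall e, 0 < e -> \forall a \near U & s \near t, `|f a s - l| < e.

Lemma joint_cvg_pointwise (T : Type) (W : normedModType R)
    (U : set_system T) (FU : Filter U) (f : T -> R -> W) t l :
  joint_cvg U f t l -> (f ^~ t) @ U --> l.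
Proof.
move=> H; apply/cvgrPdist_lt => e /H[[A B] /= [UA tB] AB].
apply: filterS UA => a Aa; rewrite distrC.
by apply: (AB (a, t)); split => //=; exact: nbhs_singleton.
Qed.

Lemma joint_cvg_cvg (T : Type) (W : normedModType R) (U : set_system T)
    (FU : ProperFilter U) (f : T -> R -> W) (l : R -> W) t :
  (\forall s \near t, (f ^~ s) @ U --> l s) -> joint_cvg U f t (l t) ->
  l s @[s --> t] --> l t.
Proof.
move=> fl H; apply/cvgrPdist_le => e /H[[A B] /= [UA tB] AB].
apply: filterS2 fl tB => s fls Bs; rewrite distrC.
have lim : (fun a => `|f a s - l t|) @ U --> `|l s - l t|.
  by apply: cvg_norm; apply: cvgB => //; exact: cvg_cst.
apply: (@cvgr_to_le T U FU R (fun a => `|f a s - l t|) _ _ lim).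
by apply: filterS UA => a Aa; apply/ltW/(AB (a, s)).
Qed.

(** With [h] chosen before [a], the mean value inequality between [t] and [t + h] bounds the
    remainder of [f a] by [e * |h|], and the limit in [a] preserves this bound. *)
Lemma is_derive_limit (m : nat) (T : Type) (U : set_system T)
    (FU : ProperFilter U) (f df : T -> R -> 'cV[R]_m) (g : R -> 'cV[R]_m)
    (t : R) (v : 'cV[R]_m) :
  (\forall a \near U, continuous (f a)) ->
  (\forall s \near t, (f ^~ s) @ U --> g s) ->
  (\forall a \near U & s \near t, is_derive s (1 : R) (f a) (df a s)) ->
  joint_cvg U df t v -> is_derive t (1 : R) g v.
Proof.
move=> cf fg fd dfv; apply/is_derive_expansion => e e0.
have [[A B] /= [UA tB] AB] := fd.
have [[A' B'] /= [UA' tB'] AB'] := dfv e e0.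
have /nbhs_ballP[d /= d0 dB] : nbhs t (B `&` B' `&` (fun s => (f ^~ s) @ U --> g s)).
  by apply: filterI => //; exact: filterI.
have fgt : (f ^~ t) @ U --> g t by have [] := dB t (ballxx _ d0).
near=> h.
have hd : `|h| < d by near: h; exact: (@nbhs0_lt R R).
have inB s : `|s - t| <= `|h| -> (B `&` B' `&` (fun s => (f ^~ s) @ U --> g s)) s.
  by move=> sh; apply: dB; rewrite -ball_normE /= distrC; exact: le_lt_trans hd.
have fgh : (f ^~ (t + h)) @ U --> g (t + h).
  by have [] := inB (t + h); rewrite // addrC addKr.
have lim : (fun a => `|f a (t + h) - f a t - h *: v|) @ U -->
           `|g (t + h) - g t - h *: v|.
  apply: cvg_norm; apply: cvgB; last exact: cvg_cst.
  exact: cvgB.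
apply: (@cvgr_to_le T U FU R (fun a => `|f a (t + h) - f a t - h *: v|)
  _ _ lim).
near=> a.
have Aa : A a by near: a.
have A'a : A' a by near: a.
have cfa : continuous (f a) by near: a.
have [h0|/ltW h0] := leP 0 h.
  have hE : (t + h) - t = h by rewrite addrC addKr.
  rewrite (ger0_norm h0) -{2 3}hE.
  apply: (@cV_mvt_le _ _ _ (df a)) => //; first by rewrite lerDl.
  + move=> s /andP[s1 s2]; apply: (AB (a, s)); split => //=.
    have [] := inB s => //; last by case.
    by rewrite (ger0_norm h0) ler_norml; apply/andP; split; lra.
  + move=> s /andP[s1 s2]; apply/ltW/(AB' (a, s)); split => //=.
    have [] := inB s => //; last by case.
    by rewrite (ger0_norm h0) ler_norml; apply/andP; split; lra.
  exact: ltW.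
rewrite (_ : f a (t + h) - f a t - h *: v =
  - (f a t - f a (t + h) - (t - (t + h)) *: v)); last first.
  rewrite (_ : t - (t + h) = - h); last by rewrite opprD addrA subrr sub0r.
  by rewrite scaleNr opprK opprD opprB.
rewrite normrN (_ : `|h| = t - (t + h)); last first.
  by rewrite opprD addrA subrr sub0r ler0_norm.
apply: (@cV_mvt_le _ _ _ (df a)) => //; first by rewrite gerDl.
+ move=> s /andP[s1 s2]; apply: (AB (a, s)); split => //=.
  have [] := inB s => //; last by case.
  by rewrite (ler0_norm h0) ler_norml; apply/andP; split; lra.
+ move=> s /andP[s1 s2]; apply/ltW/(AB' (a, s)); split => //=.
  have [] := inB s => //; last by case.
  by rewrite (ler0_norm h0) ler_norml; apply/andP; split; lra.
exact: ltW.
Unshelve. all: by end_near.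
Qed.

(** [is_solution] demands a right derivative at [0], whereas solutions are constructed with
    derivatives at positive times; the limit of these derivatives at [0] supplies it. *)
Lemma right_derivative_limit (m : nat) (y dy : R -> 'cV[R]_m)
    (v : 'cV[R]_m) :
  continuous y -> (forall t : R, 0 < t -> is_derive t (1 : R) y (dy t)) ->
  dy t @[t --> 0^'+] --> v -> h^-1 *: (y h - y 0) @[h --> 0^'+] --> v.
Proof.
move=> cy yd dv; apply/cvgrPdist_le => e e0.
have /cvgrPdist_le/(_ _ e0) := dv.
rewrite near_withinE => /nbhs_ballP[d /= d0 dB].
near=> h.
have h0 : 0 < h by near: h; exact: nbhs_right_gt.
have hd : h < d by near: h; exact: nbhs_right_lt.
have -> : v - h^-1 *: (y h - y 0) = - (h^-1 *: (y h - y 0 - (h - 0) *: v)).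
  by rewrite subr0 [in RHS]scalerBr scalerA mulVf ?gt_eqF// scale1r opprB.
rewrite normrN normrZ normfV gtr0_norm// mulrC ler_pdivrMr//.
rewrite -{3}[h]subr0; apply: (@cV_mvt_le _ _ _ dy) => //.
- by move=> s /andP[s0 _]; exact: yd.
- move=> s /andP[s0 sh]; rewrite distrC; apply: dB => //.
  by rewrite -ball_normE /= sub0r normrN gtr0_norm//; exact: lt_trans hd.
- exact: ltW.
Unshelve. all: by end_near.
Qed.

End JointConvergence.

(** * The matrix exponential *)

Section MatrixExponential.
Context {R : realType}.

Lemma is_derive_sum_fun (I : finType) (f : I -> R -> R) (t : R) (df : I -> R) :
  (forall i, is_derive t (1 : R) (f i) (df i)) ->
  is_derive t (1 : R) (fun s => \sum_i f i s) (\sum_i df i).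
Proof.
move=> fd; rewrite (_ : (fun s => _) = \sum_i f i); last first.
  by apply/funext => s; rewrite fct_sumE.
elim/big_ind2 : _ => //; first exact: is_derive_cst.
by move=> g dg g' dg' ? ?; exact: is_deriveD.
Qed.

Lemma is_derive_mulmx (p q n : nat) (M : R -> 'M[R]_(p, q))
    (N : R -> 'M[R]_(q, n)) (t : R) dM dN :
  is_derive t (1 : R) M dM -> is_derive t (1 : R) N dN ->
  is_derive t (1 : R) (fun s => M s *m N s) (dM *m N t + M t *m dN).
Proof.
move=> /is_derive_mxP Md /is_derive_mxP Nd; apply/is_derive_mxP => i j.
rewrite (_ : (fun s => _) = fun s => \sum_k (M s i k * N s k j)); last first.
  by apply/funext => s; rewrite mxE.
have -> : (dM *m N t + M t *m dN) i j =
    \sum_k (M t i k *: dN k j + N t k j *: dM i k).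
  rewrite !mxE -big_split /=; apply: eq_bigr => k _.
  by rewrite addrC; congr (_ + _); rewrite mulrC.
apply: is_derive_sum_fun => k.
exact: (@is_deriveM _ _ (fun s => M s i k) (fun s => N s k j)).
Qed.

Lemma is_derive_reverse (W : normedModType R) (f : R -> W) (c t : R) df :
  is_derive (c - t) (1 : R) f df ->
  is_derive t (1 : R) (fun s => f (c - s)) (- df).
Proof.
move=> /is_derive_expansion fd; apply/is_derive_expansion => e e0.
have [d /= d0 dH] := (nbhs_ballP _ _).1 (fd _ e0).
apply/nbhs_ballP; exists d => //= h hd.
have := dH (- h); rewrite -ball_normE /= !sub0r !normrN => H.
rewrite opprD addrA scalerN opprK.
have := H _; rewrite scaleNr opprK; apply.
by move: hd; rewrite -ball_normE /= sub0r normrN.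
Qed.

Lemma is_derive_shift_fun (W : normedModType R) (f : R -> W) (c t : R) df :
  is_derive (c + t) (1 : R) f df ->
  is_derive t (1 : R) (fun s => f (c + s)) df.
Proof.
move=> /is_derive_expansion fd; apply/is_derive_expansion => e e0.
by apply: filterS (fd _ e0) => h; rewrite addrA.
Qed.

Lemma derive0_mx_cst (p q : nat) (M : R -> 'M[R]_(p, q)) :
  (forall t, is_derive t (1 : R) M 0) -> forall s t, M s = M t.
Proof.
move=> M0 s t; apply/matrixP => i j.
apply: (@is_derive_0_is_cst R (fun s => M s i j)) => u.
by have /is_derive_mxP/(_ i j) := M0 u; rewrite mxE.
Qed.

Lemma cvg_sum_fin (T : Type) (G : set_system T) (FG : Filter G) (I : finType)
    (f : I -> T -> R) (l : I -> R) :
  (forall i, f i @ G --> l i) ->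
  (fun a => \sum_i f i a) @ G --> \sum_i l i.
Proof.
move=> fl; rewrite (_ : (fun a => _) = \sum_i f i); last first.
  by apply/funext => s; rewrite fct_sumE.
elim/big_ind2 : _ => //; first exact: cvg_cst.
by move=> g dg g' dg' ? ?; exact: cvgD.
Qed.

Context {m : nat}.
Implicit Types A B : 'M[R]_m.

(** Entrywise, the exponential of [t *: A] is a scalar power series in [t] with these coefficients,
    so termwise differentiation of real power series applies. *)
Definition expmx_coeff A i j (k : nat) : R := (k`!%:R)^-1 * (A ^+ k) i j.

Lemma exprmx_le A i j k :
  `|(A ^+ k) i j| <= (m%:R * `|A| + 1) ^+ k.
Proof.
elim: k i j => [|k IH] i j.
  by rewrite !expr0 mxE; case: eqP => _; rewrite ?normr1 ?normr0.
rewrite exprS mxE; apply: le_trans (ler_norm_sum _ _ _) _.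
apply: (@le_trans _ _ (\sum_(l < m) `|A| * (m%:R * `|A| + 1) ^+ k)).
  apply: ler_sum => l _; rewrite normrM; apply: ler_pM => //.
  rewrite [leRHS]/Num.Def.normr/= mx_normrE.
  exact: (le_bigmax _ (fun i : 'I_m * 'I_m => `|A i.1 i.2|) (i, l)).
rewrite sumr_const card_ord -[_ *+ m]mulr_natl mulrA exprS ler_wpM2r//.
by rewrite lerDl.
Qed.

Lemma is_cvg_expmx_coeff A i j t : cvgn (pseries (expmx_coeff A i j) t).
Proof.
apply: normed_cvg.
apply: (@series_le_cvg _ _ (exp_coeff ((m%:R * `|A| + 1) * `|t|))) => //.
- by move=> n /=; exact: normr_ge0.
- move=> n; apply: exp_coeff_ge0.
  by rewrite mulr_ge0// addr_ge0// mulr_ge0.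
- move=> n; rewrite /exp_coeff /= /expmx_coeff exprMn !normrM normrX.
  rewrite normfV normr_nat [leRHS]mulrC -mulrA ler_wpM2l ?invr_ge0//.
  by rewrite ler_wpM2r ?exprn_ge0// exprmx_le.
- exact: is_cvg_series_exp_coeff.
Qed.

Lemma cvg_mx (T : Type) (G : set_system T) (FG : Filter G) (p q : nat)
    (f : T -> 'M[R]_(p, q)) (l : 'M[R]_(p, q)) :
  (forall i j, (fun a => f a i j) @ G --> l i j) -> f @ G --> l.
Proof.
move=> fl; apply/cvgrPdist_le => e e0; near=> a.
rewrite [leLHS]/Num.Def.normr/= mx_normrE (bigmax_le _ (ltW e0))//= => i _.
rewrite !mxE; move: i; near: a; apply: filter_forall => /= i.
exact: (cvgrPdist_le _ _).1 (fl i.1 i.2) e e0.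
Unshelve. all: by end_near.
Qed.

Lemma exprmxZ A t k : (t *: A) ^+ k = t ^+ k *: A ^+ k.
Proof.
elim: k => [|k IH]; first by rewrite !expr0 scale1r.
by rewrite !exprS IH -[LHS]scalemxAl -scalemxAr scalerA.
Qed.

Lemma expmx_entry A t i j :
  expmx (t *: A) i j = limn (pseries (expmx_coeff A i j) t).
Proof.
rewrite /expmx.
pose M : 'M[R]_m := \matrix_(i, j) (limn (pseries (expmx_coeff A i j) t)).
suff -> : limn (series (fun k => (k`!%:R)^-1 *: (t *: A) ^+ k)) = M.
  by rewrite mxE.
apply: cvg_lim; first exact: norm_hausdorff.
apply: cvg_mx => i' j'; rewrite mxE.
have -> : (fun n => series (fun k => (k`!%:R)^-1 *: (t *: A) ^+ k) n i' j') =
    pseries (expmx_coeff A i' j') t.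
  apply/funext => n; rewrite /pseries /series /= summxE; apply: eq_bigr => k _.
  by rewrite exprmxZ !mxE /expmx_coeff mulrCA mulrC.
exact: is_cvg_expmx_coeff.
Qed.

Lemma expmx_coeff_diffs A i j :
  pseries_diffs (expmx_coeff A i j) =
  fun k => (k`!%:R)^-1 * (A ^+ k.+1) i j.
Proof.
apply/funext => k; rewrite /pseries_diffs /expmx_coeff factS natrM invfM.
by rewrite !mulrA mulfV ?mul1r// pnatr_eq0.
Qed.

Lemma pseries_sum (I : finType) (c : I -> nat -> R) (a : I -> R) t :
  (forall l, cvgn (pseries (c l) t)) ->
  pseries (fun k => \sum_l a l * c l k) t @ \oo -->
    \sum_l a l * limn (pseries (c l) t).
Proof.
move=> cc.
have -> : pseries (fun k => \sum_l a l * c l k) t =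
    fun n => \sum_l a l * pseries (c l) t n.
  apply/funext => n; rewrite /pseries /series /=.
  under [RHS]eq_bigr do rewrite mulr_sumr.
  rewrite exchange_big /=; apply: eq_bigr => k _.
  by rewrite mulr_suml; apply: eq_bigr => l _; rewrite mulrA.
apply: cvg_sum_fin => l.
by apply: cvgM; [exact: cvg_cst|exact: cc].
Qed.

Lemma expmx_coeff_diffs_cvgl A i j t :
  pseries (pseries_diffs (expmx_coeff A i j)) t @ \oo -->
    (A *m expmx (t *: A)) i j.
Proof.
rewrite expmx_coeff_diffs mxE; under eq_bigr do rewrite expmx_entry.
rewrite (_ : (fun k => _) =
    (fun k => \sum_l A i l * expmx_coeff A l j k)); last first.
  apply/funext => k; rewrite exprS mxE mulr_sumr; apply: eq_bigr => l _.
  by rewrite /expmx_coeff mulrCA.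
by apply: pseries_sum => l; exact: is_cvg_expmx_coeff.
Qed.

Lemma expmx_coeff_diffs_cvgr A i j t :
  pseries (pseries_diffs (expmx_coeff A i j)) t @ \oo -->
    (expmx (t *: A) *m A) i j.
Proof.
rewrite expmx_coeff_diffs mxE; under eq_bigr do rewrite expmx_entry mulrC.
rewrite (_ : (fun k => _) =
    (fun k => \sum_l A l j * expmx_coeff A i l k)); last first.
  apply/funext => k; rewrite exprSr mxE mulr_sumr; apply: eq_bigr => l _.
  by rewrite /expmx_coeff mulrA mulrC.
by apply: pseries_sum => l; exact: is_cvg_expmx_coeff.
Qed.

(** Both sides sum the same differentiated series, with [A ^+ k.+1] split as [A * A ^+ k] or as
    [A ^+ k * A]. *)
Lemma expmx_comm A t : A *m expmx (t *: A) = expmx (t *: A) *m A.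
Proof.
apply/matrixP => i j.
exact: cvg_unique (@expmx_coeff_diffs_cvgl A i j t)
  (@expmx_coeff_diffs_cvgr A i j t).
Qed.

Lemma is_derive_expmx A (t : R) :
  is_derive t (1 : R) (fun s => expmx (s *: A)) (A *m expmx (t *: A)).
Proof.
apply/is_derive_mxP => i j.
rewrite (_ : (fun s => _) = fun s => limn (pseries (expmx_coeff A i j) s)).
  rewrite -(cvg_lim _ (@expmx_coeff_diffs_cvgl A i j t))//.
  apply: (@pseries_snd_diffs _ _ (`|t| + 1)).
  - exact: is_cvg_expmx_coeff.
  - by apply/cvg_ex; eexists; exact: expmx_coeff_diffs_cvgl.
  (* Termwise differentiation also asks for the twice differentiated series at the larger radius
     [|t| + 1]; its coefficients are those of the exponential multiplied by [A ^+ 2]. *)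
  - rewrite expmx_coeff_diffs (_ : pseries_diffs _ =
      fun k => \sum_l (A ^+ 2) i l * expmx_coeff A l j k).
      apply/cvg_ex; eexists; apply: pseries_sum => l.
      exact: is_cvg_expmx_coeff.
    apply/funext => k; rewrite /pseries_diffs factS natrM invfM.
    rewrite !mulrA mulfV ?mul1r ?pnatr_eq0// -add2n exprD mxE mulr_sumr.
    by apply: eq_bigr => l _; rewrite /expmx_coeff mulrCA.
  - by rewrite [ltRHS]ger0_norm ?addr_ge0// ltrDl.
by apply/funext => s; rewrite expmx_entry.
Qed.

Lemma expmx0 A : expmx (0 *: A) = 1%:M.
Proof.
apply/matrixP => i j; rewrite expmx_entry.
apply: cvg_lim => //; apply: cvg_near_cst.
exists 1%N => // n /= n1; rewrite /pseries /series /=.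
rewrite -(prednK n1) big_nat_recl// big1 ?addr0.
  by rewrite expr0 mulr1 /expmx_coeff fact0 invr1 mul1r expr0.
by move=> k _; rewrite expr0n mulr0.
Qed.

Lemma is_derive_expmxN A (t : R) :
  is_derive t (1 : R) (fun s => expmx (- s *: A)) (- (A *m expmx (- t *: A))).
Proof.
have := @is_derive_reverse _ (fun s => expmx (s *: A)) 0 t
  (A *m expmx (- t *: A)).
rewrite sub0r (_ : (fun s => expmx ((0 - s) *: A)) = fun s => expmx (- s *: A)).
  by apply; exact: is_derive_expmx.
by apply/funext => s; rewrite sub0r.
Qed.

(** The product has zero derivative because [A] commutes with its exponential. This identity yields
    the inverse, uniqueness for the linear equation and, from uniqueness, the group law. *)
Lemma expmxN_mull A (H : R -> 'M[R]_m) :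
  (forall t, is_derive t (1 : R) H (A *m H t)) ->
  forall t, expmx (- t *: A) *m H t = H 0.
Proof.
move=> dH t; pose K s := expmx (- s *: A) *m H s.
have K0 s : is_derive s (1 : R) K 0.
  have := is_derive_mulmx (is_derive_expmxN A s) (dH s).
  by rewrite mulNmx expmx_comm mulmxA addNr.
by have := derive0_mx_cst K0 t 0; rewrite /K oppr0 expmx0 mul1mx.
Qed.

Lemma expmxN_mul A t : expmx (- t *: A) *m expmx (t *: A) = 1%:M.
Proof. by rewrite (expmxN_mull (is_derive_expmx A)) expmx0. Qed.

Lemma expmx_mulN A t : expmx (t *: A) *m expmx (- t *: A) = 1%:M.
Proof. by rewrite -{1}[t]opprK expmxN_mul. Qed.

Lemma expmx_unique A (H : R -> 'M[R]_m) :
  (forall t, is_derive t (1 : R) H (A *m H t)) ->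
  forall t, H t = expmx (t *: A) *m H 0.
Proof.
by move=> dH t; rewrite -(expmxN_mull dH t) mulmxA expmx_mulN mul1mx.
Qed.

Lemma expmxD A s t : expmx ((s + t) *: A) = expmx (s *: A) *m expmx (t *: A).
Proof.
have := @expmx_unique A (fun s => expmx ((t + s) *: A)) _ s.
rewrite addr0 addrC; apply => u.
exact: (is_derive_shift_fun (is_derive_expmx A (t + u))).
Qed.

Lemma expmx_ge0 A t : (forall i j, 0 <= A i j) -> 0 <= t ->
  forall i j, 0 <= expmx (t *: A) i j.
Proof.
move=> A0 t0 i j; rewrite expmx_entry; apply: limr_ge.
  exact: is_cvg_expmx_coeff.
have Ak k i' j' : 0 <= (A ^+ k) i' j'.
  elim: k i' j' => [|k IH] i' j'; first by rewrite expr0 mxE; case: eqP.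
  by rewrite exprS mxE; apply: sumr_ge0 => l _; rewrite mulr_ge0.
near=> n; apply: sumr_ge0 => k _.
by rewrite mulr_ge0 ?exprn_ge0// mulr_ge0// invr_ge0.
Unshelve. all: by end_near.
Qed.

(* [B + kI] is entrywise nonnegative for [k] large, and
   [exp(tB) = exp(-kt) exp(t(B + kI))]. *)
Lemma expmx_quasipositive_ge0 B t : quasipositive B -> 0 <= t ->
  forall i j, 0 <= expmx (t *: B) i j.
Proof.
move=> qB t0 i j; pose k := \sum_l `|B l l|; pose A := B + k%:M.
have A0 i' j' : 0 <= A i' j'.
  rewrite !mxE; have [->|ij] := eqVneq i' j'; last first.
    by rewrite mulr0n addr0 qB.
  rewrite mulr1n -[leLHS](addNr `|B j' j'|) lerD//.
    by rewrite lerNl -normrN ler_norm.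
  by rewrite /k (bigD1 j')//= lerDl sumr_ge0.
have dH s : is_derive s (1 : R) (fun s => expR (- k * s) *: expmx (s *: A))
    (B *m (expR (- k * s) *: expmx (s *: A))).
  have dE : is_derive s (1 : R) (fun s => expR (- k * s)) (- k * expR (- k * s)).
    apply: is_derive_eq; by rewrite scaler1 mulrC.
  apply/is_derive_mxP => i' j'.
  rewrite (_ : (fun s => _) =
    fun s => expR (- k * s) * expmx (s *: A) i' j'); last first.
    by apply/funext => u; rewrite mxE.
  have /is_derive_mxP/(_ i' j') dA := is_derive_expmx A s.
  have := @is_deriveM _ _ (fun s => expR (- k * s))
    (fun s => expmx (s *: A) i' j') s 1 _ _ dE dA.
  congr is_derive; rewrite mulmxDl mul_scalar_mx -scalemxAr !mxE /GRing.scale /=.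
  ring.
have := expmx_unique dH t.
rewrite mulr0 expR0 scale1r expmx0 mulmx1 => <-.
by rewrite mxE mulr_ge0 ?expR_ge0 ?expmx_ge0.
Qed.

(* The derivative of [u |-> exp((t - u)B) v(u)] is
   [exp((t - u)B) (v'(u) - B v(u)) >= 0]. *)
Lemma exponential_comparison B (v dv : R -> 'cV[R]_m) (a b : R) :
  quasipositive B -> continuous v ->
  (forall s, a < s < b -> is_derive s (1 : R) v (dv s)) ->
  (forall s, a < s < b -> vle (B *m v s) (dv s)) ->
  forall s t, a <= s -> s <= t -> t <= b ->
  vle (expmx ((t - s) *: B) *m v s) (v t).
Proof.
move=> qB cv vd vge s t as_ st tb i.
have [->|neqst] := eqVneq s t; first by rewrite subrr expmx0 mul1mx.
have ltst : s < t by rewrite lt_neqAle neqst.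
pose f u := (expmx ((t - u) *: B) *m v u) i 0.
pose df u := (expmx ((t - u) *: B) *m (dv u - B *m v u)) i 0.
have fd u : u \in `]s, t[%R -> is_derive u (1 : R) f (df u).
  rewrite in_itv /= => /andP[su ut].
  have := is_derive_mulmx (@is_derive_reverse _ (fun s => expmx (s *: B)) t u _
    (is_derive_expmx B (t - u))) (vd u _).
  rewrite (le_lt_trans as_ su) (lt_le_trans ut tb) => /(_ isT) H.
  have := (is_derive_mxP _ _ _).1 H i 0; congr is_derive.
  by rewrite /df mulmxBr mulmxA expmx_comm mulNmx addrC.
have fc : continuous f.
  rewrite (_ : f = fun u => \sum_k expmx ((t - u) *: B) i k * v u k 0); last first.
    by apply/funext => u; rewrite /f mxE.
  move=> u; apply: cvg_sum_fin => k; apply: cvgM; last first.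
    exact: continuous_coord.
  have := @is_derive_reverse _ (fun s => expmx (s *: B)) t u _
    (is_derive_expmx B (t - u)).
  move=> /is_derive_mxP/(_ i k)[/derivable1_diffP/differentiable_continuous + _].
  by [].
have [c cst fE] := MVT ltst fd (continuous_subspaceT fc).
have -> : v t i 0 = f t by rewrite /f subrr expmx0 mul1mx.
rewrite -subr_ge0 fE; apply: mulr_ge0; last by rewrite subr_ge0.
move: cst; rewrite in_itv /= => /andP[sc ct].
rewrite /df mxE; apply: sumr_ge0 => k _; apply: mulr_ge0.
  by apply: expmx_quasipositive_ge0; rewrite // subr_ge0 ltW.
rewrite !mxE subr_ge0.
by have := vge c _ k; rewrite mxE; apply; rewrite (le_lt_trans as_ sc) (lt_le_trans ct).
Qed.

End MatrixExponential.

(** * The exponential ordering and its part metric *)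

Section Ordering.
Context {R : realType} {m : nat} {r : {posnum R}} (B : 'M[R]_m).
Local Notation V := 'cV[R]_m.
Local Notation X := (CX m r).
Implicit Types (phi psi chi : X) (c : R).

Lemma vle_add (x y z w : V) : vle x y -> vle z w -> vle (x + z) (y + w).
Proof. by move=> xy zw i; rewrite !mxE lerD. Qed.

Lemma vle_trans (x y z : V) : vle x y -> vle y z -> vle x z.
Proof. by move=> xy yz i; exact: le_trans (xy i) (yz i). Qed.

Lemma vleZ (x y : V) c : 0 <= c -> vle x y -> vle (c *: x) (c *: y).
Proof. by move=> c0 xy i; rewrite !mxE ler_wpM2l. Qed.

Lemma vle_subr (x y : V) : vle x y <-> vle 0 (y - x).
Proof. by split=> xy i; have := xy i; rewrite !mxE subr_ge0. Qed.

Lemma cvg_coord (T : Type) (U : set_system T) (FU : Filter U) (f : T -> V)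
    (x : V) i : f @ U --> x -> (fun a => f a i 0) @ U --> x i 0.
Proof.
move=> fx; apply/cvgrPdist_le => e e0.
move/cvgrPdist_le : fx => /(_ e e0); apply: filterS => a.
by apply: le_trans; apply: le_trans (coord_le_norm _ i); rewrite !mxE.
Qed.

Lemma vle_lim (T : Type) (U : set_system T) (FU : ProperFilter U)
    (f g : T -> V) (x y : V) : f @ U --> x -> g @ U --> y ->
  (\forall a \near U, vle (f a) (g a)) -> vle x y.
Proof.
move=> fx gy fg i; rewrite -subr_ge0.
have lim : (fun a => g a i 0 - f a i 0) @ U --> y i 0 - x i 0.
  by apply: cvgB; exact: cvg_coord.
apply: (@cvgr_to_ge T U FU R (fun a => g a i 0 - f a i 0) _ 0 lim).
apply: filterS fg => a /(_ i).
by rewrite -subr_ge0.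
Qed.

Lemma mulmx_cvg (T : Type) (U : set_system T) (FU : Filter U) (p : nat)
    (A : 'M[R]_(p, m)) (f : T -> V) (x : V) :
  f @ U --> x -> (fun a => A *m f a) @ U --> A *m x.
Proof.
move=> fx; apply: cvg_mx => i j; rewrite mxE ord1.
rewrite (_ : (fun a => _) = fun a => \sum_k A i k * f a k 0); last first.
  by apply/funext => a; rewrite mxE.
apply: cvg_sum_fin => k; apply: cvgM; first exact: cvg_cst.
exact: cvg_coord.
Qed.

Lemma KB0 : KB B (0 : X).
Proof. by split=> [s i|s t _ i]; rewrite ?mulmx0. Qed.

Lemma KBD phi psi : KB B phi -> KB B psi -> KB B (phi + psi).
Proof.
move=> [p0 pB] [q0 qB]; split=> [s|s t st].
  by have := vle_add (p0 s) (q0 s); rewrite addr0.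
by have := vle_add (pB s t st) (qB s t st); rewrite -mulmxDr.
Qed.

Lemma KBZ c phi : 0 <= c -> KB B phi -> KB B (c *: phi).
Proof.
move=> c0 [p0 pB]; split=> [s|s t st].
  by have := vleZ c0 (p0 s); rewrite scaler0.
by have := vleZ c0 (pB s t st); rewrite scalemxAr.
Qed.

(** Every condition defining the cone involves at most two points of the delay interval, so
    pointwise convergence is enough. *)
Lemma KB_lim (T : Type) (U : set_system T) (FU : ProperFilter U) (f : T -> X)
    (phi : X) : (forall s, (fun a => f a s) @ U --> phi s) ->
  (\forall a \near U, KB B (f a)) -> KB B phi.
Proof.
move=> fphi fK; split=> [s|s t st].
  apply: (@vle_lim _ U _ (cst 0) (f ^~ s) 0 (phi s) (cvg_cst _) (fphi s)).
  by apply: filterS fK => a [].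
apply: (@vle_lim _ U _ _ (f ^~ t) _ _ (mulmx_cvg _ (fphi s)) (fphi t)).
by apply: filterS fK => a [_]; apply.
Qed.

Lemma leB_refl phi : leB B phi phi.
Proof. by rewrite /leB subrr; exact: KB0. Qed.

Lemma leB_trans psi phi chi : leB B phi psi -> leB B psi chi -> leB B phi chi.
Proof.
move=> pq qs; rewrite /leB -(subrK psi chi) -addrA; exact: KBD.
Qed.

Lemma leB_antisym phi psi : leB B phi psi -> leB B psi phi -> phi = psi.
Proof.
move=> [pq _] [qp _]; apply: CX_ext => s; apply/matrixP => i j.
rewrite ord1; have := pq s i; have := qp s i.
rewrite -[(phi - psi) s]/(phi s - psi s) -[(psi - phi) s]/(psi s - phi s).
by rewrite !mxE !subr_ge0 => h1 h2; apply/eqP; rewrite eq_le h1 h2.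
Qed.

Lemma leBZ c phi psi : 0 <= c -> leB B phi psi ->
  leB B (c *: phi) (c *: psi).
Proof. by move=> c0 pq; rewrite /leB -scalerBr; exact: KBZ. Qed.

Lemma leB0 phi : leB B 0 phi <-> KB B phi.
Proof. by rewrite /leB subr0. Qed.

Lemma KB_le phi psi : KB B phi -> leB B phi psi -> KB B psi.
Proof. by move=> /leB0 p pq; apply/leB0; exact: leB_trans pq. Qed.

Lemma leB_scale c c' phi : KB B phi -> c <= c' -> leB B (c *: phi) (c' *: phi).
Proof. by move=> p cc; rewrite /leB -scalerBl; apply: KBZ; rewrite ?subr_ge0. Qed.

Lemma leB_norm phi psi : KB B phi -> leB B phi psi -> `|phi| <= `|psi|.
Proof.
move=> [p0 _] [pq _]; apply: CXnorm_le => s; apply: cV_norm_le => [//|i].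
have := p0 s i; rewrite mxE => p0i.
have := pq s i; rewrite !mxE subr_ge0 => pqi.
rewrite ger0_norm//; apply: le_trans pqi _; apply: le_trans (ler_norm _) _.
exact: le_trans (coord_le_norm _ _) (CXnorm_ge _ _).
Qed.

(* The balls of the part metric of the cone [K_B], with [c] standing for the
   exponential of the radius. *)
Definition part_near c phi psi : Prop :=
  leB B (c^-1 *: phi) psi /\ leB B psi (c *: phi).

Lemma part_near_refl c phi : KB B phi -> 1 <= c -> part_near c phi phi.
Proof.
move=> p c1; have ci : c^-1 <= 1 by rewrite invf_le1// (lt_le_trans _ c1).
by split; [have := leB_scale p ci|have := leB_scale p c1]; rewrite scale1r.
Qed.

Lemma part_near_sym c phi psi : 0 < c ->
  part_near c phi psi -> part_near c psi phi.
Proof.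
move=> c0 [H1 H2]; have ci : 0 <= c^-1 by rewrite invr_ge0 ltW.
split.
  by have := leBZ ci H2; rewrite (scalerK (lt0r_neq0 c0)).
by have := leBZ (ltW c0) H1; rewrite (scalerKV (lt0r_neq0 c0)).
Qed.

Lemma part_near_trans c c' psi phi chi : 0 < c -> 0 < c' ->
  part_near c phi psi -> part_near c' psi chi -> part_near (c * c') phi chi.
Proof.
move=> c0 c0' [H1 H2] [H3 H4]; split.
  apply: leB_trans H3; rewrite invfM mulrC -scalerA; apply: leBZ H1.
  by rewrite invr_ge0 ltW.
by apply: leB_trans H4 _; rewrite mulrC -scalerA; apply: leBZ H2; exact: ltW.
Qed.

Lemma part_near_le c c' phi psi : KB B phi -> 0 < c -> c <= c' ->
  part_near c phi psi -> part_near c' phi psi.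
Proof.
move=> p c0 cc' [H1 H2]; split.
  apply: leB_trans H1; apply: leB_scale => //.
  by rewrite lef_pV2 ?posrE// (lt_le_trans c0).
by apply: leB_trans H2 _; exact: leB_scale.
Qed.

Lemma part_near_KB c phi psi : 0 < c -> KB B phi -> part_near c phi psi ->
  KB B psi.
Proof.
by move=> c0 p [H _]; apply: KB_le H; apply: KBZ; rewrite // invr_ge0 ltW.
Qed.

Lemma CX_pointwise_cvg (T : Type) (U : set_system T) (FU : Filter U)
    (f : T -> X) (phi : X) s : f @ U --> phi -> (fun a => f a s) @ U --> phi s.
Proof.
move=> fphi; apply/cvgrPdist_le => e e0.
move/cvgrPdist_le : fphi => /(_ e e0); apply: filterS => a.
by apply: le_trans; exact: (CXnorm_ge (phi - f a) s).
Qed.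

Lemma part_near_lim (T : Type) (U : set_system T) (FU : ProperFilter U)
    (c_ : T -> R) c (f g : T -> X) phi psi : 0 < c -> c_ @ U --> c ->
  (forall s, (fun a => f a s) @ U --> phi s) ->
  (forall s, (fun a => g a s) @ U --> psi s) ->
  (\forall a \near U, part_near (c_ a) (f a) (g a)) -> part_near c phi psi.
Proof.
move=> c0 cc fphi gpsi H; split.
  apply: (@KB_lim _ U _ (fun a => g a - (c_ a)^-1 *: f a)); last first.
    by apply: filterS H => a [].
  move=> s; apply: cvgB; first exact: gpsi.
  by apply: cvgZ; [apply: cvgV; rewrite // gt_eqF|exact: fphi].
apply: (@KB_lim _ U _ (fun a => c_ a *: f a - g a)); last first.
  by apply: filterS H => a [].
by move=> s; apply: cvgB; [apply: cvgZ => //; exact: fphi|exact: gpsi].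
Qed.

(** Approximation arguments lose an arbitrarily small factor; closedness of the cone recovers the
    sharp constant. *)
Lemma part_near_closed c phi psi : 0 < c ->
  (forall c', c < c' -> part_near c' phi psi) -> part_near c phi psi.
Proof.
move=> c0 H; apply: (@part_near_lim _ (at_right c) _ id c (cst phi) (cst psi)).
- exact: c0.
- exact: cvg_at_right_filter (@cvg_id _ _).
- by move=> s; exact: cvg_cst.
- by move=> s; exact: cvg_cst.
- by near=> c'; apply: H.
Unshelve. all: by end_near. Qed.

End Ordering.

(** * Interior points of the cone and the Lipschitz norm *)

Section LipschitzFunctions.
Context {R : realType} {m : nat} {r : {posnum R}}.
Local Notation X := (CX m r).
Local Notation I := (delay_itv r).

Lemma XL_norm_le (phi : XL m r) (a b : R) : 0 <= b ->
  (forall s : I, `|phi s| <= a) ->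
  (forall s t : I, `|phi t - phi s| <= b * `|val t - val s|) ->
  `|phi| <= a + b.
Proof.
move=> b0 pa pb; apply: lerD; first exact: CXnorm_le.
apply: lip_const_le => s t.
have [->|st] := eqVneq (val t) (val s).
  by rewrite subrr normr0 invr0 mulr0.
by rewrite ler_pdivrMr ?normr_gt0 ?subr_eq0.
Qed.

Lemma XL_lipschitz (phi : XL m r) s t :
  `|phi t - phi s| <= lip_const phi * `|val t - val s|.
Proof.
have [st|st] := eqVneq (val t) (val s).
  by rewrite (val_inj st) !subrr !normr0 mulr0.
by rewrite -ler_pdivrMr ?normr_gt0 ?subr_eq0//; exact: lip_const_ge.
Qed.

Lemma XL_norm_ge_CX (phi : XL m r) : `|val phi| <= `|phi|.
Proof. by rewrite [leRHS]/Num.Def.normr /= /XLnorm lerDl lip_const_ge0. Qed.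

Lemma XL_pointwise_cvg (T : Type) (U : set_system T) (FU : Filter U)
    (f : T -> XL m r) (phi : XL m r) (s : I) :
  f @ U --> phi -> (fun a => f a s) @ U --> phi s.
Proof.
move=> fphi; apply: (@CX_pointwise_cvg _ _ _ _ _ _ (fun a => val (f a))).
apply/cvgrPdist_le => e e0.
move/cvgrPdist_le : fphi => /(_ e e0); apply: filterS => a.
by apply: le_trans; exact: XL_norm_ge_CX (phi - f a).
Qed.

(** An interior point of a cone is an order unit. The factor [2 / d] gives the scaled perturbation
    the norm [d / 2], strictly inside a ball of radius [d] around [psi0] contained in the cone. *)
Lemma gtB0_absorbing (B : 'M[R]_m) (psi0 : XL m r) : gtB0 B psi0 ->
  exists2 k : R, 0 < k &
    forall chi : XL m r, leB B chi ((k * `|chi|) *: val psi0).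
Proof.
move=> /nbhs_ballP[d /= d0 dK]; exists (2 / d); first by rewrite divr_gt0.
move=> chi; have [->|chi0] := eqVneq chi 0.
  by rewrite normr0 mulr0 scale0r; exact: leB_refl.
have n0 : 0 < `|chi| by rewrite normr_gt0.
have k0 : 0 < 2 / d * `|chi| by rewrite mulr_gt0// divr_gt0.
have : KBL B (psi0 - (2 / d * `|chi|)^-1 *: chi).
  apply: dK; rewrite -ball_normE /= opprB addrC subrK normrZ.
  rewrite gtr0_norm ?invr_gt0// invfM mulfVK ?gt_eqF// invf_div.
  by rewrite ltr_pdivrMr// mulr_natr mulr2n ltrDl.
move=> /(KBZ (ltW k0)); rewrite /leB.
rewrite (_ : _ *: _ = (2 / d * `|chi|) *: val psi0 - chi)//.
rewrite scalerBr; congr (_ - _).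
by rewrite -[LHS]/((2 / d * `|chi|) *: ((2 / d * `|chi|)^-1 *: val chi))
  scalerA mulfV ?gt_eqF// scale1r.
Qed.

Lemma gtB0_KB (B : 'M[R]_m) (psi0 : XL m r) : gtB0 B psi0 -> KB B psi0.
Proof. exact: nbhs_singleton. Qed.

(** A point of the ball of radius [c * d] around [phi] is the sum of [phi - c *: psi] and of [c]
    times a point of the ball of radius [d] around [psi], and both terms lie in the cone. *)
Lemma gtB0_add (B : 'M[R]_m) (psi phi : XL m r) (c : R) : 0 < c ->
  gtB0 B psi -> leB B (c *: val psi) phi -> gtB0 B phi.
Proof.
move=> c0 /nbhs_ballP[d /= d0 dK] psiphi; apply/nbhs_ballP.
exists (c * d) => /=; first by rewrite mulr_gt0.
move=> chi; rewrite -ball_normE /= => chid.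
have : KBL B (psi + c^-1 *: (chi - phi)).
  apply: dK; rewrite -ball_normE /= opprD addrA subrr sub0r normrN normrZ.
  by rewrite gtr0_norm ?invr_gt0// ltr_pdivrMl// distrC.
move=> /(KBZ (ltW c0)) H.
have := KBD psiphi H; congr KB.
rewrite scalerDr -[X in _ + X]/(c *: val psi + c *: (c^-1 *: (val chi - val phi))).
by rewrite scalerA mulfV ?gt_eqF// scale1r addrA subrK addrC subrK.
Qed.

End LipschitzFunctions.

(** * Segments of vector functions *)

Section Segments.
Context {R : realType} {m : nat} {r : {posnum R}}.
Local Notation V := 'cV[R]_m.
Local Notation X := (CX m r).
Local Notation I := (delay_itv r).
Implicit Types (y : R -> V) (t : R).
Local Notation segment := (@segment R m r).

Lemma continuous_delay_val : continuous (val : I -> R).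
Proof. exact: initial_continuous. Qed.

Lemma segment_continuous_pred y t : continuous y ->
  (fun s : I => y (t + val s)) \in @continuous_pred R m r.
Proof.
move=> cy; apply/asboolP => s; apply: continuous_comp; last exact: cy.
by apply: continuousD; [exact: cst_continuous|exact: continuous_delay_val].
Qed.

Lemma segmentE y t (s : I) : continuous y -> segment y t s = y (t + val s).
Proof.
move=> cy; rewrite /segment /Defs.segment.
by have := insubdK (0 : X) (segment_continuous_pred t cy) => /(congr1 (@^~ s)).
Qed.

Lemma segment_ext y y' t :
  (forall s, - r%:num <= s <= 0 -> y (t + s) = y' (t + s)) ->
  segment y t = segment y' t.
Proof.
move=> yy'; rewrite /segment /Defs.segment; congr insubd; apply/funext => s.
exact/yy'/delay_itv_bounds.
Qed.

Lemma segment_norm_ge y t : continuous y -> `|y t| <= `|segment y t|.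
Proof.
move=> cy; have := CXnorm_ge (segment y t) (delay_itv0 r).
by rewrite segmentE// addr0.
Qed.

(** The default [0] is excluded through [segmentLE], which asks for a Lipschitz bound on the window
    [[t - r, t]]. *)
Definition segmentL y t : XL m r := insubd (0 : XL m r) (segment y t).

Lemma segmentLE y t (M : R) : continuous y ->
  (forall s u, t - r%:num <= s <= t -> t - r%:num <= u <= t ->
    `|y u - y s| <= M * `|u - s|) ->
  val (segmentL y t) = segment y t.
Proof.
move=> cy yM; rewrite /segmentL insubdK//; apply/asboolP; exists M => s u.
rewrite !segmentE// (_ : val u - val s = t + val u - (t + val s)); last by ring.
by apply: yM; [have := delay_itv_bounds s|have := delay_itv_bounds u]; lra.
Qed.

(** Compactness of the delay interval turns local uniformity at each point of the window into
    sup-norm convergence, the end of the window still being allowed to move. *)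
Lemma joint_cvg_segment (T : Type) (U : set_system T) (FU : Filter U)
    (y_ : T -> R -> V) y t : continuous y ->
  (\forall a \near U, continuous (y_ a)) ->
  (forall s, t - r%:num <= s <= t -> joint_cvg U y_ s (y s)) ->
  joint_cvg U (fun a => segment (y_ a)) t (segment y t).
Proof.
move=> cy cy_ yy e e0.
suff H : \forall p \near filter_prod U (nbhs t), [set: I] `<=`
    (fun s => `|y_ p.1 (p.2 + val s) - y (t + val s)| <= e / 2).
  have cy_' : \forall p \near filter_prod U (nbhs t), continuous (y_ p.1).
    by exists ([set a | continuous (y_ a)], setT) => //=;
      [split => //; exact: filterT|move=> [a s] []].
  apply: filterS2 H cy_' => -[a s] /= H ca.
  have : `|segment (y_ a) s - segment y t| <= e / 2.
    apply: CXnorm_le => u.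
    rewrite -[X in `|X|]/(segment (y_ a) s u - segment y t u) !segmentE//.
    exact: H.
  by move/le_lt_trans; apply; rewrite ltr_pdivrMr// mulr_natr mulr2n ltrDl.
have := @delay_itv_compact R r.
move=> /compact_near_coveringP/(_ _ (filter_prod U (nbhs t))
  (fun p s => `|y_ p.1 (p.2 + val s) - y (t + val s)| <= e / 2)).
apply => s _ /=.
have e4 : 0 < e / 4 by rewrite divr_gt0.
have [|[A B] /= [UA tB] AB] := yy (t + val s) _ _ e4.
  by have := delay_itv_bounds s; lra.
have /cvgrPdist_lt/(_ _ e4) yc : y u @[u --> t + val s] --> y (t + val s).
  exact: cy.
have [d /= d0 dB] := (nbhs_ballP _ _).1 (filterI tB yc).
have d2 : 0 < d / 2 by rewrite divr_gt0.
(* Half of [d] is left to the delay variable and half to the time, so that their sum stays within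
   [d] of [t + val s]. *)
pose S1 := [set s' : I | `|val s' - val s| < d / 2].
pose S2 := [set p : T * R | A p.1 /\ `|p.2 - t| < d / 2].
exists (S1, S2) => /=.
  split.
    have /cvgrPdist_lt/(_ _ d2) := @continuous_delay_val s.
    by apply: filterS => s'; rewrite /S1 /= distrC.
  exists (A, [set u | `|u - t| < d / 2]) => //=; split => //.
  apply/nbhs_ballP; exists (d / 2) => //= u.
  by rewrite -ball_normE /= distrC.
move=> [s' [a u]] /= [] S1s [/= Aa ut].
have b1 : ball (t + val s) d (u + val s').
  rewrite -ball_normE /= distrC.
  rewrite (_ : _ - _ = (u - t) + (sval s' - sval s)); last by ring.
  by rewrite (le_lt_trans (ler_normD _ _))// [ltRHS]splitr ltrD.
have b2 : ball (t + val s) d (t + val s').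
  rewrite -ball_normE /= distrC.
  rewrite (_ : _ - _ = sval s' - sval s); last by ring.
  by apply: lt_trans S1s _; rewrite ltr_pdivrMr// mulr_natr mulr2n ltrDl.
have H1 : `|y_ a (u + val s') - y (t + val s)| < e / 4.
  by apply: (AB (a, _)); split => //=; have [] := dB _ b1.
have H2 : `|y (t + val s) - y (t + val s')| < e / 4.
  by have [] := dB _ b2.
rewrite -(subrK (y (t + val s)) (y_ a _)) -addrA.
apply: le_trans (ler_normD _ _) _; lra.
Qed.

(** By the mean value inequality the Lipschitz seminorm of a difference is at most the supremum of
    the difference of the derivatives, and compactness makes the derivatives converge uniformly on
    the window. The bound [M] places the segments in the Lipschitz space. *)
Lemma segmentL_cvg (T : Type) (U : set_system T) (FU : ProperFilter U)
    (y_ dy_ : T -> R -> V) (y dy : R -> V) t (M : R) :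
  continuous y -> (\forall a \near U, continuous (y_ a)) ->
  (forall s, t - r%:num <= s <= t -> joint_cvg U y_ s (y s)) ->
  (forall s, t - r%:num <= s <= t -> joint_cvg U dy_ s (dy s)) ->
  (forall s, t - r%:num < s < t -> is_derive s (1 : R) y (dy s)) ->
  (\forall a \near U, forall s, t - r%:num < s < t ->
    is_derive s (1 : R) (y_ a) (dy_ a s)) ->
  (forall s, t - r%:num < s < t -> `|dy s| <= M) ->
  (\forall a \near U, forall s, t - r%:num < s < t -> `|dy_ a s| <= M) ->
  (forall s, t - r%:num <= s <= t -> dy u @[u --> s] --> dy s) ->
  (fun a => segmentL (y_ a) t) @ U --> segmentL y t.
Proof.
move=> cy cy_ yy dydy yd yd_ dM dM_ dc; apply/cvgrPdist_le => e e0.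
have M0 : 0 <= M.
  apply: le_trans (dM (t - r%:num / 2) _) => //.
  by have : 0 < r%:num := [gt0 of r%:num]; lra.
have e2 : 0 < e / 2 by rewrite divr_gt0.
have e4 : 0 < e / 4 by rewrite divr_gt0.
have Hseg : \forall a \near U, `|segment (y_ a) t - segment y t| < e / 2.
  have [[A C] /= [UA tC] AC] := joint_cvg_segment _ cy cy_ yy e2.
  apply: filterS UA => a Aa; apply: (AC (a, t)).
  by split => //=; exact: nbhs_singleton.
have Hd : \forall a \near U, `[t - r%:num, t]%classic `<=`
    (fun s => `|dy_ a s - dy s| <= e / 2).
  have := @segment_compact R (t - r%:num) t.
  move=> /compact_near_coveringP/(_ _ U
    (fun a s => `|dy_ a s - dy s| <= e / 2)); apply => s.
  rewrite /= in_itv /= => st.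
  have [[A C] /= [UA tC] AC] := dydy s st _ e4.
  have /cvgrPdist_lt/(_ _ e4) dcs := dc s st.
  exists (C `&` [set u | `|dy s - dy u| < e / 4], A) => /=.
    by split => //; exact: filterI.
  move=> [u a] /= [[Cu du] Aa].
  have := AC (a, u) (conj Aa Cu) => /= H1.
  rewrite -(subrK (dy s) (dy_ a _)) -addrA.
  apply: le_trans (ler_normD _ _) _; lra.
near=> a.
have ca : continuous (y_ a) by near: a.
have ya : forall s, t - r%:num < s < t -> is_derive s (1 : R) (y_ a) (dy_ a s).
  by near: a.
have Ma : forall s, t - r%:num < s < t -> `|dy_ a s| <= M by near: a.
have Hsega : `|segment (y_ a) t - segment y t| < e / 2 by near: a.
have Hda : `[t - r%:num, t]%classic `<=` (fun s => `|dy_ a s - dy s| <= e / 2).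
  by near: a.
have E1 : val (segmentL y t) = segment y t.
  by apply: (@segmentLE _ _ M) => //; exact: cV_lipschitz yd dM.
have E2 : val (segmentL (y_ a) t) = segment (y_ a) t.
  by apply: (@segmentLE _ _ M) => //; exact: cV_lipschitz ya Ma.
rewrite distrC [leRHS]splitr; apply: XL_norm_le => [|s|s u].
- exact: ltW.
- have := CXnorm_ge (segment (y_ a) t - segment y t) s.
  move=> H; apply: le_trans (ltW Hsega); apply: le_trans H.
  by rewrite -E1 -E2.
- have E w : (segmentL (y_ a) t - segmentL y t) w =
      y_ a (t + val w) - y (t + val w).
    rewrite -(segmentE t w ca) -(segmentE t w cy) -E1 -E2.
    by [].
  rewrite !E (_ : val u - val s = t + val u - (t + val s)); last by ring.
  apply: (@cV_lipschitz _ _ (fun s => y_ a s - y s) (fun s => dy_ a s - dy s)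
    (t - r%:num) t).
  + by move=> w; apply: continuousB; [exact: ca|exact: cy].
  + exact: ltW.
  + by move=> w wt; apply: is_deriveB; [exact: ya|exact: yd].
  + by move=> w wt; apply: Hda; rewrite /= in_itv /=; move: wt; lra.
  + by have := delay_itv_bounds s; lra.
  + by have := delay_itv_bounds u; lra.
Unshelve. all: by end_near.
Qed.

End Segments.

#[local] Opaque Defs.segment.

Record sublinear_system {R : realType} {m : nat} {r : {posnum R}}
    {Omega : metricType R} (sigma : R -> Omega -> Omega) (B : 'M[R]_m)
    (F : Omega -> CX m r -> 'cV[R]_m) : Prop := SublinearSystem {
  system_compact : compact [set: Omega] ;
  system_flow : continuous_flow sigma ;
  system_minimal : minimal_flow sigma ;
  system_quasipositive : quasipositive B ;
  system_continuous : continuous (fun p : Omega * CX m r => F p.1 p.2) ;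
  system_C1 : C1_second F ;
  system_bounded : forall X1 : set (CX m r), bounded_set X1 ->
    bounded_set [set F w phi | w in [set: Omega] & phi in X1] ;
  system_monotone : forall w phi psi, leB B phi psi ->
    vle (B *m (psi (delay_itv0 r) - phi (delay_itv0 r))) (F w psi - F w phi) ;
  system_sublinear : forall w psi (lambda : R), leB B 0 psi ->
    0 <= lambda <= 1 -> vle (lambda *: F w psi) (F w (lambda *: psi)) }.

(** * The delay equation *)

Section RealFunctions.
Context {R : realType}.

Lemma convex_lt (s a b d : R) : 0 < s < 1 -> a < d -> b < d ->
  (1 - s) * a + s * b < d.
Proof. by move=> /andP[s0 s1] ad bd; nra. Qed.

Lemma le_half_eq0 (d : R) : 0 <= d -> d <= d / 2 -> d = 0.
Proof. by move=> d0 dd; lra. Qed.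

Lemma sqrt_gt1 (eta : R) : 1 < eta -> 1 < Num.sqrt eta.
Proof.
by move=> e1; rewrite -[X in X < _]sqrtr1 ltr_sqrt// (lt_trans _ e1).
Qed.

Lemma continuous_maxr0 : continuous (fun t : R => Num.max t 0).
Proof.
rewrite (_ : (fun t => _) = fun t => (t + `|t|) / 2); last first.
  by apply/funext => t; rewrite maxr_absE subr0 addr0.
move=> t; apply: cvgM; last exact: cvg_cst.
by apply: cvgD; [exact: cvg_id|apply: cvg_norm; exact: cvg_id].
Qed.

Lemma continuous_minr0 : continuous (fun t : R => Num.min t 0).
Proof.
rewrite (_ : (fun t => _) = fun t => (t - `|t|) / 2); last first.
  by apply/funext => t; rewrite minr_absE subr0 addr0.
move=> t; apply: cvgM; last exact: cvg_cst.
by apply: cvgB; [exact: cvg_id|apply: cvg_norm; exact: cvg_id].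
Qed.

(** Integrating from [-1] makes [0] an interior point, so the derivative there is two-sided. *)
Lemma exists_antiderivative (f : R -> R) : continuous f ->
  exists2 A : R -> R, A 0 = 0 & forall t : R, -1 < t -> is_derive t (1 : R) A (f t).
Proof.
move=> cf; pose A t := (\int[lebesgue_measure]_(s in `[(- 1 : R), t]) f s)%R.
exists (fun t => A t - A 0); first by rewrite subrr.
move=> t t1.
have [||dA A'] := @continuous_FTC1_closed R f (- 1) t (t + 1) _ _ t1 (cf t).
- by rewrite ltrDl.
- apply: continuous_compact_integrable; first exact: segment_compact.
  exact: continuous_subspaceT.
have /is_derive_expansion dAt : is_derive t (1 : R) A (f t).
  split; first exact: dA.
  by rewrite -derive1E; exact: A'.
apply/is_derive_expansion => e /dAt; apply: filterS => h.
by rewrite opprB addrA subrK.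
Qed.

End RealFunctions.

Section Equation.
Context {R : realType} {m : nat} {r : {posnum R}} {Omega : metricType R}.
Context {sigma : R -> Omega -> Omega} {B : 'M[R]_m}.
Context {F : Omega -> CX m r -> 'cV[R]_m}.
Hypothesis H : sublinear_system sigma B F.
Local Notation V := 'cV[R]_m.
Local Notation X := (CX m r).
Local Notation segment := (@segment R m r).

(** Continuity on the whole line avoids subspace topologies; values before [a - r] do not enter the
    equation. With [a] variable, an entire solution is one that solves from every [a]. *)
Definition solves (a : R) (w : Omega) (y : R -> V) : Prop :=
  continuous y /\
  forall t, a < t -> is_derive t (1 : R) y (F (sigma t w) (segment y t)).

Lemma joint_cvgP (T : Type) (W : normedModType R) (U : set_system T)
    (FU : Filter U) (f : T -> R -> W) (t : R) (l : W) :
  joint_cvg U f t l <->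
  (fun p => f p.1 p.2) @ filter_prod U (nbhs t) --> l.
Proof.
split=> [fl|/cvgrPdist_lt fl e e0].
  by apply/cvgrPdist_lt => e /fl; apply: filterS => p; rewrite distrC.
by apply: filterS (fl e e0) => p; rewrite distrC.
Qed.

Lemma sigma_cvg (T : Type) (U : set_system T) (FU : Filter U)
    (t_ : T -> R) (w_ : T -> Omega) t w : t_ @ U --> t -> w_ @ U --> w ->
  (fun a => sigma (t_ a) (w_ a)) @ U --> sigma t w.
Proof.
move=> tt ww; have [cs _ _] := system_flow H.
exact: (cvg_comp2 tt ww (cs (t, w))).
Qed.

Lemma F_cvg (T : Type) (U : set_system T) (FU : Filter U) (w_ : T -> Omega)
    (f : T -> X) (w : Omega) (phi : X) : w_ @ U --> w -> f @ U --> phi ->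
  (fun a => F (w_ a) (f a)) @ U --> F w phi.
Proof.
move=> ww ff.
have cF : continuous (fun p : Omega * X => F p.1 p.2) := system_continuous H.
exact: (cvg_comp2 ww ff (cF (w, phi))).
Qed.

Lemma F_joint_cvg (T : Type) (U : set_system T) (FU : Filter U)
    (w_ : T -> Omega) w (y_ : T -> R -> V) y t :
  w_ @ U --> w ->
  joint_cvg U (fun a => segment (y_ a)) t (segment y t) ->
  joint_cvg U (fun a s => F (sigma s (w_ a)) (segment (y_ a) s)) t
    (F (sigma t w) (segment y t)).
Proof.
move=> ww /joint_cvgP yy; apply/joint_cvgP.
have ss : (fun p : T * R => sigma p.2 (w_ p.1)) @ filter_prod U (nbhs t) -->
    sigma t w.
  apply: sigma_cvg; first exact: cvg_snd.
  by apply: cvg_comp ww; exact: cvg_fst.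
exact: F_cvg ss yy.
Qed.

Lemma continuous_segment y : continuous y -> continuous (segment y).
Proof.
move=> cy t.
(* A constant family over a one-point index reduces the claim to joint convergence, where only the
   time moves. *)
have FT : ProperFilter (globally [set: unit]) by exact: globally_properfilter.
have cst_joint s : joint_cvg (globally [set: unit]) (fun=> y) s (y s).
  apply/joint_cvgP; apply: (cvg_comp _ _ (@cvg_snd _ _ _ _ _)); exact: cy.
have := @joint_cvg_segment R m r unit (globally [set: unit]) _
  (fun=> y) y t cy.
move=> /(_ _ _ (fun s _ => cst_joint s)) H'.
have /joint_cvg_cvg : joint_cvg (globally [set: unit]) (fun=> segment y) t
    (segment y t) by apply: H'; near=> a.
by apply; near=> s; exact: cvg_cst.
Unshelve. all: by end_near. Qed.

Lemma continuous_F_segment w y : continuous y ->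
  continuous (fun t => F (sigma t w) (segment y t)).
Proof.
move=> cy t.
have ss : sigma s w @[s --> t] --> sigma t w.
  by apply: sigma_cvg; [exact: cvg_id|exact: cvg_cst].
have yy : segment y s @[s --> t] --> segment y t by exact: continuous_segment.
exact: F_cvg ss yy.
Qed.

Lemma is_derive_along (w : Omega) (phi h : X) (t : R) :
  is_derive t (1 : R) (fun s : R => F w (phi + s *: h))
    ('d (F w) (phi + t *: h) h).
Proof.
have [dF _] := system_C1 H.
have E : (fun k : R => k^-1 *: (((fun s : R => F w (phi + s *: h)) \o shift t)
      (k *: (1 : R)) - F w (phi + t *: h))) =
    (fun k => k^-1 *: ((F w \o shift (phi + t *: h)) (k *: h)
      - F w (phi + t *: h))).
  apply/funext => k; congr (_ *: (_ - _)) => /=.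
  by rewrite scaler1 scalerDl addrCA.
split; first by rewrite /derivable E; exact: diff_derivable.
by rewrite /derive E -deriveE.
Qed.

(** Near [(w, phi)] the derivative differs from ['d (F w) phi] by at most [1] in operator norm, so a
    bound of the latter plus [1] is a Lipschitz constant. Convexity of balls allows the mean value
    inequality along straight lines. *)
Lemma locally_lipschitz (w : Omega) (phi : X) : exists L d : R,
  [/\ 0 < L, 0 < d & \forall w' \near w, forall psi chi : X,
    `|psi - phi| < d -> `|chi - phi| < d ->
    `|F w' psi - F w' chi| <= L * `|psi - chi|].
Proof.
have [dF cF] := system_C1 H.
have bF : bounded_near ('d (F w) phi) (nbhs (0 : X)).
  apply: continuous_linear_bounded.
  exact: (@diff_continuous _ _ _ (nbhs_filter_on phi) (F w) (dF w phi)).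
have [K [Kr KH]] := (linear_boundedP _).1 bF.
pose L := Num.max K 0 + 1.
have L0 : 0 < L by rewrite ltr_wpDl// le_max lexx orbT.
have LK h : `|'d (F w) phi h| <= L * `|h|.
  by apply: KH; rewrite ltr_pwDr// le_max lexx.
have [[A C] /= [wA phiC] AC] := cF w phi 1 ltr01.
have [d /= d0 dC] := (nbhs_ballP _ _).1 phiC.
exists (L + 1), d; split => //; first by rewrite addr_gt0.
apply: filterS wA => w' Aw' psi chi psid chid.
have := @cV_mvt_le _ _ (fun s : R => F w' (chi + s *: (psi - chi)))
  (fun s => 'd (F w') (chi + s *: (psi - chi)) (psi - chi)) 0 0 1
  ((L + 1) * `|psi - chi|) ler01.
rewrite scale1r scale0r addr0 scaler0 !subr0 mulr1 [chi + _]addrC subrK; apply.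
- move=> s; have [/derivable1_diffP/differentiable_continuous + _] :=
    is_derive_along w' chi (psi - chi) s.
  by [].
- by move=> s _; exact: is_derive_along.
- move=> s /andP[s0 s1]; rewrite subr0.
  have Cs : C (chi + s *: (psi - chi)).
    apply: dC; rewrite -ball_normE /= distrC.
    have lin (a b : X) : a + s *: (b - a) = (1 - s) *: a + s *: b.
      by rewrite scalerBr scalerBl scale1r addrA addrAC.
    have -> : chi + s *: (psi - chi) - phi =
        (chi - phi) + s *: ((psi - phi) - (chi - phi)).
      by rewrite addrAC opprB addrA subrK.
    rewrite lin.
    apply: le_lt_trans (ler_normD _ _) _; rewrite !normrZ.
    rewrite (gtr0_norm s0) gtr0_norm ?subr_gt0//.
    have s01 : 0 < s < 1 by rewrite s0.
    exact: convex_lt s01 chid psid.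
  have := AC (w', _) (conj Aw' Cs) (psi - chi); rewrite /= mul1r => H1.
  rewrite -(subrK ('d (F w) phi (psi - chi)) ('d (F w') _ _)).
  rewrite mulrDl mul1r addrC; apply: le_trans (ler_normD _ _) _.
  by rewrite lerD.
- by rewrite mulr_ge0// addr_ge0// ltW.
Qed.

(** Just beyond the supremum [T] of the times of agreement, the difference is at most half of its
    own maximum. The delay is harmless, since the windows reach back only into the region of
    agreement. *)
Lemma solves_unique (w : Omega) (y z : R -> V) : solves 0 w y -> solves 0 w z ->
  segment y 0 = segment z 0 -> forall t, - r%:num <= t -> y t = z t.
Proof.
move=> [cy dy] [cz dz] yz0.
have yzr t : - r%:num <= t <= 0 -> y t = z t.
  move=> rt.
  have It : t \in (`[- r%:num, 0]%classic : set R).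
    by rewrite inE /= in_itv.
  have := congr1 (fun f : X => f (exist _ t It)) yz0.
  by rewrite !segmentE//= !add0r.
suff yz t : 0 <= t -> y t = z t.
  by move=> t rt; have [/yz//|t0] := leP 0 t; apply: yzr; rewrite rt ltW.
move=> t0; apply/eqP/negPn/negP => /eqP neq.
pose S := [set s | 0 <= s <= t /\ forall u, 0 <= u <= s -> y u = z u].
have S0 : S 0.
  by split; [rewrite lexx|move=> u u0; apply: yzr; have : 0 < r%:num := [gt0 of r%:num]; lra].
have hS : has_sup S by split; [exists 0|exists t => s [/andP[]]].
pose T := sup S.
have T0 : 0 <= T by apply: sup_upper_bound.
have Tt : T <= t by apply: ge_sup => [|s [/andP[]]//]; exists 0.
have yzT u : - r%:num <= u -> u <= T -> y u = z u.
  move=> ru; rewrite le_eqVlt => /orP[/eqP ->|uT].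
    have [T0'|T0'] := leP T 0; first by apply: yzr; have : 0 < r%:num := [gt0 of r%:num]; lra.
    have lim : y s - z s @[s --> T^'-] --> y T - z T.
      by apply: cvgB; apply: cvg_at_left_filter; [exact: cy|exact: cz].
    suff lim0 : y s - z s @[s --> T^'-] --> (0 : V).
      apply/eqP; rewrite -subr_eq0; apply/eqP.
      exact: cvg_unique lim lim0.
    apply: cvg_near_cst; near=> s.
    have s0 : 0 < s by near: s; exact: nbhs_left_gt.
    have sT : s < T by near: s; exact: nbhs_left_lt.
    have [v [v0t vS] sv] := sup_gt hS.1 sT.
    by rewrite vS ?subrr// (ltW s0) (ltW sv).
  have [u0|u0] := leP u 0; first by apply: yzr; rewrite ru.
  have [v [v0t vS] sv] := sup_gt hS.1 uT.
  by rewrite vS// (ltW u0) (ltW sv).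
have segT : segment y T = segment z T.
  by apply: segment_ext => s rs; apply: yzT; lra.
have [L [d [L0 d0 lipL]]] := locally_lipschitz (sigma T w) (segment y T).
have ss : sigma s w @[s --> T] --> sigma T w.
  by apply: sigma_cvg; [exact: cvg_id|exact: cvg_cst].
have sy := continuous_segment cy (x := T).
have sz := continuous_segment cz (x := T).
have nl : \forall s \near T, forall psi chi : X,
    `|psi - segment y T| < d -> `|chi - segment y T| < d ->
    `|F (sigma s w) psi - F (sigma s w) chi| <= L * `|psi - chi|.
  exact: (ss _ lipL).
have ny : \forall s \near T, `|segment y T - segment y s| < d.
  exact: cvgr_dist_lt sy _ d0.
have nz : \forall s \near T, `|segment y T - segment z s| < d.
  have nz : \forall s \near T, `|segment z T - segment z s| < d.
    exact: cvgr_dist_lt sz _ d0.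
  exact: (eq_ind_r (fun phi => \forall s \near T, `|phi - segment z s| < d)
    nz segT).
have [h0 /= h00 hH] := (nbhs_ballP _ _).1 (filterI nl (filterI ny nz)).
(* [h] keeps both segments in the region of the local Lipschitz estimate and makes the integrated
   estimate a contraction by [1 / 2]. *)
have [h h0' [hh hL]] : exists2 h, 0 < h & h < h0 /\ L * h <= 1 / 2.
  exists (Num.min (h0 / 2) (2 * L)^-1).
    by rewrite lt_min divr_gt0// invr_gt0 mulr_gt0.
  split.
    by rewrite gt_min ltr_pdivrMr// mulr_natr mulr2n ltrDl h00.
  apply: (@le_trans _ _ (L * (2 * L)^-1)).
    by rewrite ler_pM2l// ge_min lexx orbT.
  by rewrite invfM mulrCA mulfV ?gt_eqF// mulr1 mul1r.
have cyz : continuous (fun s => `|y s - z s|).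
  move=> s; apply: cvg_norm; apply: cvgB; [exact: cy|exact: cz].
have TTh : T <= T + h by rewrite lerDl ltW.
have [c cT cmax] := @EVT_max R (fun s => `|y s - z s|) T (T + h) TTh
  (continuous_subspaceT cyz).
move: cT; rewrite in_itv /= => /andP[Tc cTh].
set D := `|y c - z c| in cmax.
have Dbound s : - r%:num <= s -> s <= T + h -> `|y s - z s| <= D.
  move=> rs sTh; have [sT|Ts] := leP s T.
    by rewrite yzT// subrr normr0; exact: normr_ge0.
  by apply: cmax; rewrite in_itv /= sTh ltW.
have Dhalf : D <= D / 2.
  have := @cV_mvt_le _ _ (fun s => y s - z s) (fun s =>
    F (sigma s w) (segment y s) - F (sigma s w) (segment z s)) 0 T c (L * D) Tc.
  rewrite scaler0 subr0 (yzT T) ?subrr ?subr0//; last first.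
    by have : 0 < r%:num := [gt0 of r%:num]; lra.
  move=> H1; apply: (@le_trans _ _ (L * D * (c - T))).
    apply: H1.
    - by move=> s; apply: continuousB; [exact: cy|exact: cz].
    - by move=> s /andP[sT _]; apply: is_deriveB; [apply: dy|apply: dz];
        exact: le_lt_trans sT.
    - move=> s /andP[sT sc]; rewrite subr0.
      have [|lip1 [sy1 sz1]] := hH s.
        by rewrite -ball_normE /= distrC ger0_norm ?subr_ge0 ?(ltW sT)//; lra.
      have lip2 : `|F (sigma s w) (segment y s) - F (sigma s w) (segment z s)|
          <= L * `|segment y s - segment z s|.
        apply: lip1; first by rewrite distrC; exact: sy1.
        by rewrite distrC; exact: sz1.
      apply: le_trans lip2 _.
      rewrite ler_pM2l//; apply: CXnorm_le => u.
      rewrite -[X in `|X|]/(segment y s u - segment z s u) !segmentE//.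
      have /andP[u1 u2] := delay_itv_bounds u.
      apply: Dbound.
        by apply: le_trans u1 _; rewrite lerDr (le_trans T0)// ltW.
      by apply: le_trans (lerD (ltW sc) u2) _; rewrite addr0.
    - by apply: mulr_ge0; [exact: ltW|exact: normr_ge0].
  have cTh' : c - T <= h by rewrite lerBlDl.
  have D0 : 0 <= D by exact: normr_ge0.
  rewrite mulrAC [leRHS]mulrC -[2^-1]mul1r; apply: (ler_wpM2r D0).
  exact: le_trans (ler_wpM2l (ltW L0) cTh') hL.
have D0 : D = 0.
    have D0' : 0 <= D by exact: normr_ge0.
  exact: le_half_eq0 D0' Dhalf.
have yzh u : 0 <= u <= T + h -> y u = z u.
  move=> /andP[u0 uh]; apply/eqP; rewrite -subr_eq0 -normr_le0 -D0.
  by apply: Dbound => //; have : 0 < r%:num := [gt0 of r%:num]; lra.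
have [tTh|tTh] := leP t (T + h); first by apply: neq; apply: yzh; rewrite t0.
have : S (T + h).
  by split => //; rewrite (ltW tTh) andbT addr_ge0// ltW.
by move=> /(sup_upper_bound hS); rewrite -/T leNgt ltrDl h0'.
Unshelve. all: by end_near. Qed.

End Equation.

(** * Comparison principle and the forced linear equation *)

Section Comparison.
Context {R : realType} {m : nat} {r : {posnum R}} {Omega : metricType R}.
Context {sigma : R -> Omega -> Omega} {B : 'M[R]_m}.
Context {F : Omega -> CX m r -> 'cV[R]_m}.
Hypothesis H : sublinear_system sigma B F.
Local Notation V := 'cV[R]_m.
Local Notation X := (CX m r).
Local Notation I := (delay_itv r).
Local Notation segment := (@segment R m r).

Lemma segmentB (y z : R -> V) t : continuous y -> continuous z ->
  segment (fun s => y s - z s) t = segment y t - segment z t.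
Proof.
move=> cy cz; apply: CX_ext => s.
rewrite -[RHS]/(segment y t s - segment z t s) !segmentE//.
by move=> u; apply: continuousB; [exact: cy|exact: cz].
Qed.

Lemma segmentZ (c : R) (y : R -> V) t : continuous y ->
  segment (fun s => c *: y s) t = c *: segment y t.
Proof.
move=> cy; apply: CX_ext => s.
rewrite -[RHS]/(c *: segment y t s) !segmentE//.
by move=> u; apply: cvgZ; [exact: cvg_cst|exact: cy].
Qed.

Lemma vle_mulmx (A : 'M[R]_m) (x y : V) : (forall i j, 0 <= A i j) ->
  vle x y -> vle (A *m x) (A *m y).
Proof.
move=> A0 xy i; rewrite !mxE; apply: ler_sum => k _.
by apply: ler_wpM2l; [exact: A0|exact: xy].
Qed.

Lemma KB_segment (z : R -> V) t : continuous z ->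
  (forall s, t - r%:num <= s <= t -> vle 0 (z s)) ->
  (forall s u, t - r%:num <= s -> s <= u -> u <= t ->
    vle (expmx ((u - s) *: B) *m z s) (z u)) -> KB B (segment z t).
Proof.
move=> cz z0 zB; split=> [s|s u su].
  rewrite segmentE//; apply: z0.
  by have /andP[s1 s2] := delay_itv_bounds s; rewrite lerD2l s1 gerDl.
rewrite !segmentE//.
have -> : val u - val s = t + val u - (t + val s) by ring.
have /andP[s1 s2] := delay_itv_bounds s.
have /andP[u1 u2] := delay_itv_bounds u.
by apply: zB; rewrite ?lerD2l// gerDl.
Qed.

(** Pairs of times after [0] are compared by the differential inequality, pairs before [0] by the
    initial segment, and pairs straddling [0] by composing the two through the group law;
    nonnegative entries of the exponential make the composition order-preserving. *)
Lemma KB_forward (z dz : R -> V) : continuous z ->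
  (forall t : R, 0 < t -> is_derive t (1 : R) z (dz t)) ->
  (forall t, 0 < t -> vle (B *m z t) (dz t)) ->
  KB B (segment z 0) -> forall t, 0 <= t -> KB B (segment z t).
Proof.
move=> cz zd zB [z0 z0B] t t0.
have inI s : - r%:num <= s <= 0 -> s \in (`[- r%:num, 0]%classic : set R).
  by move=> sr; rewrite inE /= in_itv.
have E s (rs : - r%:num <= s <= 0) :
    segment z 0 (exist _ s (inI s rs)) = z s by rewrite segmentE// add0r.
have neg s : - r%:num <= s <= 0 -> vle 0 (z s).
  by move=> rs; rewrite -(E s rs); exact: z0.
have negB s u : - r%:num <= s -> s <= u -> u <= 0 ->
    vle (expmx ((u - s) *: B) *m z s) (z u).
  move=> rs su u0.
  have rs' : - r%:num <= s <= 0 by rewrite rs (le_trans su).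
  have ru' : - r%:num <= u <= 0 by rewrite u0 (le_trans rs).
  by have := z0B (exist _ s (inI s rs')) (exist _ u (inI u ru')) su; rewrite !E.
have r0 : 0 < r%:num := [gt0 of r%:num].
have posB s u : 0 <= s -> s <= u -> vle (expmx ((u - s) *: B) *m z s) (z u).
  move=> s0 su; apply: (@exponential_comparison _ _ B z dz 0 u) => //.
  - exact: system_quasipositive H.
  - by move=> v /andP[v0 _]; exact: zd.
  - by move=> v /andP[v0 _]; exact: zB.
have Epos s : 0 <= s -> forall i j, 0 <= expmx (s *: B) i j.
  by move=> s0; apply: expmx_quasipositive_ge0 => //; exact: system_quasipositive H.
have z00 : vle 0 (z 0) by apply: neg; rewrite lexx oppr_le0 ltW.
have pos s : - r%:num <= s -> vle 0 (z s).
  move=> rs; have [s0|s0] := leP s 0; first by apply: neg; rewrite rs.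
  apply: vle_trans (posB 0 s (lexx _) (ltW s0)).
  by rewrite -(mulmx0 _ (expmx ((s - 0) *: B))); apply: vle_mulmx z00;
    apply: Epos; rewrite subr0 ltW.
apply: KB_segment => //.
  by move=> s /andP[rs _]; apply: pos; apply: le_trans rs; rewrite lerBrDr addNr.
move=> s u rs su ut.
have rs' : - r%:num <= s by apply: le_trans rs; rewrite lerBrDr addNr.
have [u0|u0] := leP u 0; first exact: negB.
have [s0|s0] := leP 0 s; first exact: posB.
apply: vle_trans (posB 0 u (lexx _) (ltW u0)).
rewrite (_ : u - s = (u - 0) + (0 - s)); last by rewrite subr0 add0r.
rewrite expmxD -mulmxA; apply: vle_mulmx.
  by apply: Epos; rewrite subr0 ltW.
by apply: negB => //; exact: ltW.
Qed.

Lemma linear_comparison (u v gu gv : R -> V) : continuous u -> continuous v ->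
  (forall t : R, 0 < t -> is_derive t (1 : R) u (B *m u t + gu t)) ->
  (forall t : R, 0 < t -> is_derive t (1 : R) v (B *m v t + gv t)) ->
  (forall t, 0 < t -> vle (gu t) (gv t)) ->
  leB B (segment u 0) (segment v 0) ->
  forall t, 0 <= t -> leB B (segment u t) (segment v t).
Proof.
move=> cu cv ud vd uv uv0 t t0.
have vu0 : KB B (segment (fun s => v s - u s) 0) by rewrite (segmentB 0 cv cu).
suff : KB B (segment (fun s => v s - u s) t) by rewrite (segmentB t cv cu).
apply: (@KB_forward _ (fun t => B *m v t + gv t - (B *m u t + gu t))) => //.
- by move=> s; apply: continuousB; [exact: cv|exact: cu].
- by move=> s s0; apply: is_deriveB; [exact: vd|exact: ud].
- move=> s s0 i; have := uv s s0 i.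
  by rewrite mulmxBr !mxE => gg; rewrite opprD addrACA lerDl subr_ge0.
Qed.

Definition delay_proj (t : R) : I :=
  insubd (delay_itv0 r) (Num.max (- r%:num) (Num.min t 0)).

Lemma delay_projE t : val (delay_proj t) = Num.max (- r%:num) (Num.min t 0).
Proof.
rewrite insubdK// inE /= in_itv /= le_max lexx /= ge_max oppr_le0 ltW//=.
by rewrite ge_min lexx orbT.
Qed.

Lemma continuous_delay_proj : continuous delay_proj.
Proof.
apply: continuous_comp_initial.
rewrite (_ : _ \o _ = fun t => Num.max (Num.min t 0 + r%:num) 0 - r%:num).
  have c1 : continuous (fun t : R => Num.min t 0 + r%:num).
    by move=> t; apply: cvgD; [exact: continuous_minr0|exact: cvg_cst].
  have c2 : continuous (fun t : R => Num.max (Num.min t 0 + r%:num) 0).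
    move=> t; apply: (@continuous_comp R R R
      (fun t : R => Num.min t 0 + r%:num) (fun t : R => Num.max t 0) t).
      exact: c1.
    exact: continuous_maxr0.
  by move=> t; apply: cvgB; [exact: c2|exact: cvg_cst].
apply/funext => t /=; rewrite -[LHS]/(val (delay_proj t)) delay_projE.
by rewrite addr_maxl addrK add0r maxC.
Qed.

Definition delay_ext (phi : X) (t : R) : V := phi (delay_proj t).

Lemma continuous_delay_ext phi : continuous (delay_ext phi).
Proof.
move=> t; apply: continuous_comp; first exact: continuous_delay_proj.
exact: CX_continuous.
Qed.

Lemma delay_ext_ge0 phi t : 0 <= t -> delay_ext phi t = phi (delay_itv0 r).
Proof.
move=> t0; congr (CXfun phi _); apply: val_inj; rewrite delay_projE /=.
by rewrite (min_idPr t0) (max_idPr _)// oppr_le0.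
Qed.

Lemma delay_ext_val phi (s : I) : delay_ext phi (val s) = phi s.
Proof.
congr (CXfun phi _); apply: val_inj; rewrite delay_projE.
have /andP[s1 s2] := delay_itv_bounds s.
by rewrite (min_idPl s2) (max_idPr s1).
Qed.

Lemma segment_delay_ext phi (y : R -> V) : continuous y ->
  (forall t, t <= 0 -> y t = delay_ext phi t) -> segment y 0 = phi.
Proof.
move=> cy yphi; apply: CX_ext => s; rewrite segmentE// add0r yphi.
  exact: delay_ext_val.
by have /andP[] := delay_itv_bounds s.
Qed.

Lemma continuous_expmx_entry (A : 'M[R]_m) i j :
  continuous (fun t : R => expmx (t *: A) i j).
Proof.
move=> t.
by have /is_derive_mxP/(_ i j)[/derivable1_diffP/differentiable_continuous +] :=
  is_derive_expmx A t.
Qed.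

(** Variation of constants: [A] integrates [exp(-tB) g(t)], and [q] multiplies the result, started
    at [phi(0)], by [exp(tB)]. *)
Lemma linear_equation (phi : X) (g : R -> V) : continuous g ->
  exists y : R -> V, [/\ continuous y,
    forall t, t <= 0 -> y t = delay_ext phi t &
    forall t : R, 0 < t -> is_derive t (1 : R) y (B *m y t + g t)].
Proof.
move=> cg.
pose h (t : R) : V := expmx (- t *: B) *m g t.
have ch i : continuous (fun t : R => h t i 0).
  rewrite (_ : (fun t => _) = fun t : R => \sum_k expmx (- t *: B) i k * g t k 0).
    move=> t; apply: cvg_sum_fin => k; apply: cvgM; last exact: continuous_coord.
    have cN : continuous (fun t : R => - t) by move=> s; exact: continuousN.
    exact: continuous_comp (cN t) (@continuous_expmx_entry B i k (- t)).
  by apply/funext => t; rewrite mxE.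
have /choice[A AP] : forall i, exists A : R -> R, A 0 = 0 /\
    forall t : R, -1 < t -> is_derive t (1 : R) A (h t i 0).
  by move=> i; have [A A0 dA] := exists_antiderivative (ch i); exists A.
pose q (t : R) : V :=
  expmx (t *: B) *m (phi (delay_itv0 r) + \col_i A i t).
have q0 : q 0 = phi (delay_itv0 r).
  rewrite /q expmx0 mul1mx; apply/matrixP => i j.
  by rewrite !mxE (AP i).1 addr0 ord1.
have dq (t : R) : -1 < t -> is_derive t (1 : R) q (B *m q t + g t).
  move=> t1.
  have dA : is_derive t (1 : R)
      (fun t : R => phi (delay_itv0 r) + \col_i A i t : V) (h t).
    apply/is_derive_expansion => e e0.
    have /is_derive_expansion/(_ e e0) : is_derive t (1 : R)
        (fun t : R => \col_i A i t : V) (h t).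
      apply/is_derive_mxP => i j; rewrite ord1.
      rewrite (_ : (fun t => _) = A i); last by apply/funext => s; rewrite mxE.
      exact: (AP i).2.
    apply: filterS => k.
    by rewrite opprD addrACA subrr add0r.
  have := is_derive_mulmx (is_derive_expmx B t) dA.
  by rewrite /h !mulmxA expmx_mulN mul1mx.
(* This gluing is continuous without cases: for [t <= 0] the bracket vanishes, and for [t >= 0] the
   extended history is the constant [q 0]. *)
pose y t := delay_ext phi t + (q (Num.max t 0) - q 0).
have y_pos t : 0 <= t -> y t = q t.
  move=> t0; rewrite /y (max_idPl t0) delay_ext_ge0// q0.
  by rewrite addrC subrK.
exists y; split.
- move=> t; apply: continuousD; first exact: continuous_delay_ext.
  apply: continuousB; last exact: cst_continuous.
  apply: (@continuous_comp R R V (fun t : R => Num.max t 0) q t).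
    exact: continuous_maxr0.
  have /dq[/derivable1_diffP/differentiable_continuous + _] :
    -1 < Num.max t 0 by rewrite lt_max ltrN10 orbT.
  by [].
- by move=> t t0; rewrite /y (max_idPr t0) subrr addr0.
- move=> t t0; rewrite y_pos ?ltW//.
  apply: (@near_eq_is_derive _ _ _ q); last by apply: dq; apply: lt_trans t0.
  near=> s; rewrite y_pos// ltW//; near: s.
  exact: lt_nbhsr.
Unshelve. all: by end_near. Qed.

End Comparison.

(** * Existence of solutions by monotone iteration *)

Section MonotoneIteration.
Context {R : realType} {m : nat} {r : {posnum R}} {Omega : metricType R}.
Context {sigma : R -> Omega -> Omega} {B : 'M[R]_m}.
Context {F : Omega -> CX m r -> 'cV[R]_m}.
Hypothesis H : sublinear_system sigma B F.
Local Notation V := 'cV[R]_m.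
Local Notation X := (CX m r).
Local Notation segment := (@segment R m r).
Local Notation solves := (@solves R m r Omega sigma F).
Implicit Types (phi psi : X) (c : R).

Lemma F_norm_bound (K : R) : exists2 M : R, 0 <= M &
  forall w phi, `|phi| <= K -> `|F w phi| <= M.
Proof.
have bX : bounded_set [set phi : X | `|phi| <= K].
  exists K; split; first exact: num_real.
  by move=> L KL phi /= pK; apply: le_trans pK (ltW KL).
have [M0 [_ M0P]] := system_bounded H bX.
exists (`|M0| + 1) => [|w phi pK]; first by rewrite addr_ge0.
apply: (M0P (`|M0| + 1)); first by rewrite (le_lt_trans (ler_norm _))// ltrDl.
by exists w => //; exists phi.
Qed.

Lemma mulmx_norm_le (A : 'M[R]_m) (x : V) : `|A *m x| <= m%:R * `|A| * `|x|.
Proof.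
apply: cV_norm_le => [|i]; first by rewrite !mulr_ge0.
rewrite mxE; apply: le_trans (ler_norm_sum _ _ _) _.
apply: (@le_trans _ _ (\sum_(l < m) `|A| * `|x|)).
  apply: ler_sum => l _; rewrite normrM; apply: ler_pM => //.
    rewrite [leRHS]/Num.Def.normr/= mx_normrE.
    exact: (le_bigmax _ (fun i : 'I_m * 'I_m => `|A i.1 i.2|) (i, l)).
  exact: coord_le_norm.
by rewrite sumr_const card_ord -[_ *+ m]mulr_natl mulrA.
Qed.

(** The monotonicity hypothesis says that this remainder is increasing from the exponential ordering
    to the componentwise one. The equation becomes linear with matrix [B] plus a monotone forcing,
    to which the comparison principle applies. *)
Definition reduced_field w phi : V := F w phi - B *m phi (delay_itv0 r).
Local Notation G := reduced_field.

Lemma reduced_field_mono w phi psi : leB B phi psi -> vle (G w phi) (G w psi).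
Proof.
move=> pq i; have := system_monotone H w pq i.
by rewrite mulmxBr /reduced_field !mxE => h; lra.
Qed.

(** Monotonicity reduces to [phi = 0], where sublinearity with [lambda = 0] gives [F w 0 >= 0]. *)
Lemma reduced_field_ge0 w phi : KB B phi -> vle 0 (G w phi).
Proof.
move=> p; apply: vle_trans (reduced_field_mono w ((leB0 _ _).2 p)).
have := system_sublinear H w (leB_refl B (0 : X)) (lambda := 0).
rewrite lexx ler01 => /(_ isT); rewrite !scale0r => F0.
by rewrite /G; have -> : B *m (0 : X) (delay_itv0 r) = 0; [exact: mulmx0|rewrite subr0].
Qed.

Lemma reduced_field_scale_inv w phi c : 1 <= c -> KB B phi ->
  vle (c^-1 *: G w phi) (G w (c^-1 *: phi)).
Proof.
move=> c1 p; have c0 : 0 < c by apply: lt_le_trans c1.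
have := system_sublinear H w ((leB0 _ _).2 p) (lambda := c^-1).
rewrite invr_ge0 (ltW c0) invf_le1// c1 => /(_ isT) h.
rewrite /G scalerBr (_ : B *m (c^-1 *: phi) _ = c^-1 *: (B *m phi (delay_itv0 r))).
  by move=> i; have := h i; rewrite !mxE lerD2r.
by rewrite -[(c^-1 *: phi) _]/(c^-1 *: phi (delay_itv0 r)) scalemxAr.
Qed.

Lemma reduced_field_scale w phi c : 1 <= c -> KB B phi ->
  vle (G w (c *: phi)) (c *: G w phi).
Proof.
move=> c1 p; have c0 : 0 < c by apply: lt_le_trans c1.
have := vleZ (ltW c0) (reduced_field_scale_inv w c1 (KBZ (ltW c0) p)).
by rewrite (scalerKV (lt0r_neq0 c0)) (scalerK (lt0r_neq0 c0)).
Qed.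

Lemma reduced_field_segment w (y : R -> V) t : continuous y ->
  G w (segment y t) = F w (segment y t) - B *m y t.
Proof. by move=> cy; rewrite /G segmentE// addr0. Qed.

Lemma continuous_reduced_field w (y : R -> V) : continuous y ->
  continuous (fun t => G (sigma t w) (segment y t)).
Proof.
move=> cy; rewrite (_ : (fun t => _) =
  fun t => F (sigma t w) (segment y t) - B *m y t); last first.
  by apply/funext => t; rewrite reduced_field_segment.
move=> t; apply: cvgB; first exact: (continuous_F_segment H cy).
by apply: mulmx_cvg; exact: cy.
Qed.

Lemma reduced_field_norm w phi (K M : R) : `|phi| <= K -> `|F w phi| <= M ->
  `|G w phi| <= M + m%:R * `|B| * K.
Proof.
move=> pK FM; apply: le_trans (ler_normB _ _) _; apply: lerD => //.
apply: le_trans (mulmx_norm_le _ _) _; apply: ler_wpM2l.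
  by rewrite mulr_ge0.
by apply: le_trans pK; exact: CXnorm_ge.
Qed.

Lemma leB_segment_vle (y z : R -> V) t : continuous y -> continuous z ->
  leB B (segment y t) (segment z t) -> vle (y t) (z t).
Proof.
move=> cy cz [h _]; have := h (delay_itv0 r).
rewrite -[X in vle _ X]/(segment z t (delay_itv0 r) - segment y t (delay_itv0 r)).
by rewrite !segmentE// addr0; exact: (vle_subr _ _).2.
Qed.

(* The solution from [phi] is the limit of the increasing iteration
   [y_(n+1)' = B y_(n+1) + G(y_n)], with [G(phi) = F(phi) - B phi(0)], started
   from the solution of [y_0' = B y_0 + c^-1 G(p)]; by sublinearity [c^-1 p] is
   a subsolution and [c p] a supersolution, so that all the iterates stay
   between them. *)
Lemma sandwich_solution w (p : R -> V) c K phi : solves 0 w p ->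
  (forall t, 0 <= t -> KB B (segment p t)) ->
  (forall t, 0 <= t -> `|segment p t| <= K) ->
  1 <= c -> part_near B c (segment p 0) phi ->
  exists q, [/\ solves 0 w q, segment q 0 = phi &
    forall t, 0 <= t -> part_near B c (segment p t) (segment q t)].
Proof.
move=> [cp dp] pK pb c1 [phi_ge phi_le].
have c0 : 0 < c by apply: lt_le_trans c1.
have ci0 : 0 <= c^-1 by rewrite invr_ge0 ltW.
have ci1 : c^-1 <= 1 by rewrite invf_le1.
pose spec (g y : R -> V) := [/\ continuous y,
  forall t, t <= 0 -> y t = delay_ext phi t &
  forall t : R, 0 < t -> is_derive t (1 : R) y (B *m y t + g t)].
have /choice[next nextP] : forall y : R -> V, exists y' : R -> V,
    continuous y -> spec (fun t => G (sigma t w) (segment y t)) y'.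
  move=> y; have [cy|ncy] := pselect (continuous y); last by exists y.
  have [y' y'P] := @linear_equation R m r B phi _ (continuous_reduced_field (w := w) cy).
  by exists y'.
pose g0 t := c^-1 *: G (sigma t w) (segment p t).
have cg0 : continuous g0.
  by move=> t; apply: cvgZ; [exact: cvg_cst|exact: continuous_reduced_field].
have [y0 y0P] := @linear_equation R m r B phi _ cg0.
pose y_ n := iter n next y0.
pose g_ n t := if n is n'.+1 then G (sigma t w) (segment (y_ n') t) else g0 t.
have yP n : spec (g_ n) (y_ n).
  by elim: n => [|n [cn _ _]]; [exact: y0P|exact: nextP].
have cy n : continuous (y_ n) by have [] := yP n.
have yext n t : t <= 0 -> y_ n t = delay_ext phi t by have [_ h _] := yP n; apply: h.
have yd n (t : R) : 0 < t -> is_derive t (1 : R) (y_ n) (B *m y_ n t + g_ n t).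
  by have [_ _ h] := yP n; apply: h.
have yseg0 n : segment (y_ n) 0 = phi.
  by apply: segment_delay_ext (cy n) _ => t t0; exact: yext.
have cZp d : continuous (fun t => d *: p t).
  by move=> t; apply: cvgZ; [exact: cvg_cst|exact: cp].
have dZp d (t : R) : 0 < t -> is_derive t (1 : R) (fun s => d *: p s)
    (B *m (d *: p t) + d *: G (sigma t w) (segment p t)).
  move=> t0; rewrite reduced_field_segment// scalerBr -scalemxAr addrC subrK.
  by have := @is_deriveZ _ _ _ p d t 1 _ (dp t t0).
have sZp d t : segment (fun s => d *: p s) t = d *: segment p t.
  exact: segmentZ.
have low n t : 0 <= t -> leB B (c^-1 *: segment p t) (segment (y_ n) t) /\
   leB B (segment (y_ n) t) (segment (y_ n.+1) t) /\
   leB B (segment (y_ n) t) (c *: segment p t).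
  move: t; elim: n => [|n IH] t t0.
    have lo s : 0 <= s -> leB B (c^-1 *: segment p s) (segment (y_ 0) s).
      move=> s0; rewrite -sZp; apply: (linear_comparison H (cZp _) (cy 0%N)
        (dZp c^-1) (yd 0%N)) s0; first by move=> u _ i.
      by rewrite sZp yseg0.
    split; first exact: lo.
    split.
      apply: (linear_comparison H (cy 0%N) (cy 1%N) (yd 0%N) (yd 1%N)) t0.
        move=> s s0; have s0' := ltW s0.
        apply: vle_trans (reduced_field_scale_inv _ c1 (pK s s0')) _.
        by apply: reduced_field_mono; exact: lo.
      by rewrite !yseg0; exact: leB_refl.
    rewrite -sZp; apply: (linear_comparison H (cy 0%N) (cZp c) (yd 0%N)
      (dZp c)) t0.
      move=> s s0 i; have := reduced_field_ge0 (sigma s w) (pK s (ltW s0)) i.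
      rewrite /g_ /g0 !mxE => G0; apply: ler_wpM2r => //.
      exact: le_trans ci1 c1.
    by rewrite sZp yseg0.
  have [lo [up _]] := IH t t0.
  split; first exact: leB_trans lo up.
  split.
    apply: (linear_comparison H (cy n.+1) (cy n.+2) (yd n.+1) (yd n.+2)) t0.
      move=> s s0; apply: reduced_field_mono.
      by have [_ []] := IH s (ltW s0).
    by rewrite !yseg0; exact: leB_refl.
  rewrite -sZp; apply: (linear_comparison H (cy n.+1) (cZp c) (yd n.+1)
    (dZp c)) t0.
    move=> s s0; apply: vle_trans (reduced_field_scale _ c1 (pK s (ltW s0))).
    apply: reduced_field_mono.
    by have [_ []] := IH s (ltW s0).
  by rewrite sZp yseg0.
have K0 : 0 <= K by apply: le_trans (pb 0 (lexx _)).
pose K' := c * K.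
have KK' : K <= K' by rewrite /K' ler_peMl.
have ynorm n t : 0 <= t -> `|segment (y_ n) t| <= K'.
  move=> t0; have [lo [_ up]] := low n t t0.
  have yK : KB B (segment (y_ n) t) by apply: KB_le lo; apply: KBZ => //; exact: pK.
  apply: le_trans (leB_norm yK up) _; rewrite normrZ gtr0_norm//.
  by rewrite ler_pM2l//; exact: pb.
have [Mf Mf0 MfP] := F_norm_bound K'.
pose M := m%:R * `|B| * K' + (Mf + m%:R * `|B| * K').
have K'0 : 0 <= K' by apply: le_trans KK'.
have mBK : 0 <= m%:R * `|B| * K'.
  by apply: mulr_ge0 K'0; apply: mulr_ge0.
have M0 : 0 <= M by apply: addr_ge0 => //; exact: addr_ge0.
have gnorm n t : 0 <= t -> `|g_ n t| <= Mf + m%:R * `|B| * K'.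
  move=> t0; case: n => [|n] /=; last first.
    by apply: reduced_field_norm; [exact: ynorm|apply: MfP; exact: ynorm].
  rewrite /g0 normrZ ger0_norm//; apply: (@le_trans _ _ (1 *
    `|G (sigma t w) (segment p t)|)).
    by apply: ler_wpM2r.
  have pK' := le_trans (pb t t0) KK'.
  by rewrite mul1r; exact: (reduced_field_norm pK' (MfP _ _ pK')).
have dnorm n t : 0 <= t -> `|B *m y_ n t + g_ n t| <= M.
  move=> t0; apply: le_trans (ler_normD _ _) _; apply: lerD; last exact: gnorm.
  apply: le_trans (mulmx_norm_le _ _) _; apply: ler_wpM2l; first exact: mulr_ge0.
  exact: le_trans (segment_norm_ge _ _) (ynorm n t t0).
have lip n s t : 0 <= s -> 0 <= t -> `|y_ n t - y_ n s| <= M * `|t - s|.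
  move=> s0 t0; apply: (@cV_lipschitz _ _ _ (fun t => B *m y_ n t + g_ n t)
    0 (Num.max s t) M (cy n) M0).
  - by move=> u /andP[u0 _]; exact: yd.
  - by move=> u /andP[u0 _]; apply: dnorm; exact: ltW.
  - by rewrite s0 le_max lexx.
  - by rewrite t0 le_max lexx orbT.
pose q t : V := \col_i limn (fun n => y_ n t i 0).
have yq t : (fun n => y_ n t) @ \oo --> q t.
  apply: cvg_mx => i j; rewrite mxE ord1.
  have [t0|/ltW t0] := leP t 0.
    rewrite (_ : (fun n => _) = cst (delay_ext phi t i 0)).
      exact: is_cvg_cst.
    by apply/funext => n; rewrite yext.
  apply: nondecreasing_is_cvgn.
    apply/nondecreasing_seqP => n; have [_ [up _]] := low n t t0.
    exact: (leB_segment_vle (cy n) (cy n.+1) up i).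
  exists K' => _ [n _ <-]; apply: le_trans (ler_norm _) _.
  apply: le_trans (coord_le_norm _ _) _.
  exact: le_trans (segment_norm_ge _ _) (ynorm n t t0).
(* Left of [0] all iterates are the same function, right of [0] they share the Lipschitz constant
   [M]; the splitting treats both sides of [0] at once. *)
have ysplit n t : y_ n t = delay_ext phi t + (y_ n (Num.max t 0) - y_ n 0).
  have [t0|/ltW t0] := leP t 0; first by rewrite subrr addr0 yext.
  by rewrite (yext n 0)// !delay_ext_ge0// addrC subrK.
have jy t : joint_cvg \oo y_ t (q t).
  move=> e e0; have e3 : 0 < e / 3 by rewrite divr_gt0.
  have H1 : \forall s \near t, `|delay_ext phi t - delay_ext phi s| < e / 3.
    exact: cvgr_dist_lt (@continuous_delay_ext R m r phi t) _ e3.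
  have e3M : 0 < e / 3 / (M + 1) by rewrite divr_gt0// ltr_wpDl.
  have H2 : \forall s \near t, `|Num.max t 0 - Num.max s 0| < e / 3 / (M + 1).
    exact: cvgr_dist_lt (@continuous_maxr0 R t) _ e3M.
  have H3 : \forall n \near \oo, `|q t - y_ n t| < e / 3.
    exact: cvgr_dist_lt (yq t) _ e3.
  exists ([set n | `|q t - y_ n t| < e / 3],
    [set s | `|delay_ext phi t - delay_ext phi s| < e / 3] `&`
    [set s | `|Num.max t 0 - Num.max s 0| < e / 3 / (M + 1)]) => /=.
    by split => //; exact: filterI.
  move=> [n s] /= [yn [es ms]].
  have l1 : `|y_ n s - y_ n t| <= `|delay_ext phi t - delay_ext phi s| +
      M * `|Num.max t 0 - Num.max s 0|.
    rewrite (ysplit n s) (ysplit n t) opprD addrACA [X in _ + X](_ : _ =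
      y_ n (Num.max s 0) - y_ n (Num.max t 0)); last first.
      by rewrite opprB addrA subrK.
    apply: le_trans (ler_normD _ _) _; apply: lerD; first by rewrite distrC.
    by rewrite [`|Num.max t 0 - _|]distrC; apply: lip; rewrite le_max lexx orbT.
  have l2 : M * `|Num.max t 0 - Num.max s 0| <= e / 3.
    apply: (@le_trans _ _ (M * (e / 3 / (M + 1)))).
      by apply: ler_wpM2l => //; exact: ltW.
    rewrite mulrCA ler_piMr ?(ltW e3)// ler_pdivrMr ?ltr_wpDl// mul1r.
    by rewrite lerDl.
  rewrite -(subrK (y_ n t) (y_ n s)) -addrA.
  apply: le_lt_trans (ler_normD _ _) _.
  rewrite [`|y_ n t - q t|]distrC.
  by move: l1 l2 yn es; lra.
have cq : continuous q.
  move=> t; apply: (@joint_cvg_cvg R nat _ \oo _ y_ q t _ (jy t)).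
  by near=> s; exact: yq.
have jseg t : joint_cvg \oo (fun n => segment (y_ n)) t (segment q t).
  apply: joint_cvg_segment => //; first by near=> n; exact: cy.
(* The derivative of the iterate [n.+1] involves the segment of the iterate [n], so the limits of
   the sequence and of its shift are both needed. *)
have jshift (W : normedModType R) (f : nat -> R -> W) t l :
    joint_cvg \oo f t l -> joint_cvg \oo (fun n => f n.+1) t l.
  move=> fl e /fl[[A C] /= [[N _ NA] tC] AC].
  exists ([set n | (N <= n)%N], C) => /=; first by split=> //; exists N.
  by move=> [n s] /= [Nn Cs]; apply: (AC (n.+1, s)); split=> //=; apply: NA; exact: leqW.
have jB (f : nat -> R -> V) t l : joint_cvg \oo f t l ->
    joint_cvg \oo (fun n s => B *m f n s) t (B *m l).
  by move=> /joint_cvgP fl; apply/joint_cvgP; exact: mulmx_cvg.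
have jdy t : joint_cvg \oo (fun n s => B *m y_ n.+1 s + g_ n.+1 s) t
    (F (sigma t w) (segment q t)).
  rewrite (_ : (fun n s => _) = (fun n s => B *m y_ n.+1 s +
    (F (sigma s w) (segment (y_ n) s) - B *m y_ n s))); last first.
    by apply/funext => n; apply/funext => s; rewrite /g_ reduced_field_segment.
  apply/joint_cvgP.
  rewrite -[X in _ --> X](subrK (B *m q t)) [X in _ --> X]addrC.
  have /joint_cvgP c1' := jB _ _ _ (jshift _ _ _ _ (jy t)).
  have /joint_cvgP c2' := jB _ _ _ (jy t).
  have /joint_cvgP c3' : joint_cvg \oo (fun n s =>
      F (sigma s w) (segment (y_ n) s)) t (F (sigma t w) (segment q t)).
    by apply: (F_joint_cvg H _ (w_ := cst w)) (jseg t); exact: cvg_cst.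
  exact: (cvgD c1' (cvgB c3' c2')).
exists q; split.
- split => // t t0.
  apply: (@is_derive_limit R m nat \oo _ (fun n => y_ n.+1)
    (fun n s => B *m y_ n.+1 s + g_ n.+1 s)).
  + by near=> n; exact: cy.
  + near=> s; exact: (joint_cvg_pointwise _ (jshift _ _ _ _ (jy s))).
  + exists (setT, [set s | 0 < s]) => /=.
      by split; [exact: filterT|exact: lt_nbhsr].
    by move=> [n s] [_ s0]; exact: (yd n.+1 s s0).
  + exact: jdy.
- apply: segment_delay_ext => // t t0; apply/matrixP => i j; rewrite mxE ord1.
  apply: cvg_lim => //; rewrite (_ : (fun n => _) = cst (delay_ext phi t i 0)).
    exact: cvg_cst.
  by apply/funext => n; rewrite yext.
- move=> t t0; apply: (@part_near_lim _ _ _ _ _ \oo _ (cst c) c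
    (cst (segment p t)) (fun n => segment (y_ n) t)) => //.
  + exact: cvg_cst.
  + by move=> s; exact: cvg_cst.
  + move=> s; rewrite segmentE// (_ : (fun n => _) = fun n => y_ n (t + val s)).
      exact: yq.
    by apply/funext => n; rewrite segmentE.
  + by near=> n; have [lo [_ up]] := low n t t0; split.
Unshelve. all: by end_near. Qed.

End MonotoneIteration.

(** * Orbits bounded in the part metric *)

Section Orbits.
Context {R : realType} {m : nat} {r : {posnum R}} {Omega : metricType R}.
Context {sigma : R -> Omega -> Omega} {B : 'M[R]_m}.
Context {F : Omega -> CX m r -> 'cV[R]_m}.
Hypothesis H : sublinear_system sigma B F.
Context {psi0 : XL m r}.
Hypothesis psi0_KB : KB B psi0.
Local Notation V := 'cV[R]_m.
Local Notation X := (CX m r).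
Local Notation segment := (@segment R m r).
Local Notation segmentL := (@segmentL R m r).
Local Notation solves := (@solves R m r Omega sigma F).

(* Solutions on [a - r, +oo[ whose segments from time [a] on stay within a
   bounded part distance of [psi0]. *)
Definition bounded_orbit (a c : R) (w : Omega) (y : R -> V) : Prop :=
  solves a w y /\ forall t, a <= t -> part_near B c psi0 (segment y t).

Definition entire_orbit (c : R) (w : Omega) (y : R -> V) : Prop :=
  forall a, bounded_orbit a c w y.

Lemma segment_shift (y : R -> V) (b t : R) :
  segment (fun s => y (b + s)) t = segment y (b + t).
Proof. by congr insubd; apply/funext => s; rewrite addrA. Qed.

Lemma segmentL_shift (y : R -> V) (b t : R) :
  segmentL (fun s => y (b + s)) t = segmentL y (b + t).
Proof. exact: (congr1 (insubd (0 : XL m r)) (segment_shift y b t)). Qed.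

Lemma continuous_shift (y : R -> V) (b : R) :
  continuous y -> continuous (fun s => y (b + s)).
Proof.
move=> cy s; apply: (@continuous_comp R R V (fun s : R => b + s) y s).
  by apply: continuousD; [exact: cst_continuous|move=> ?; exact: cvg_id].
exact: cy.
Qed.

Lemma flowD s t w : sigma (s + t) w = sigma t (sigma s w).
Proof. by have [_ _] := system_flow H; apply. Qed.

Lemma flow0 w : sigma 0 w = w.
Proof. by have [_ h _] := system_flow H; apply: h. Qed.

Lemma solves_shift a b w y : solves a w y ->
  solves (a - b) (sigma b w) (fun s => y (b + s)).
Proof.
move=> [cy dy]; split; first exact: continuous_shift.
move=> t t0; rewrite -flowD segment_shift; apply: is_derive_shift_fun.
by apply: dy; rewrite addrC -ltrBlDr.
Qed.

Lemma orbit_shift a b c w y : bounded_orbit a c w y ->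
  bounded_orbit (a - b) c (sigma b w) (fun s => y (b + s)).
Proof.
move=> [sy oy]; split; first exact: solves_shift.
by move=> t t0; rewrite segment_shift; apply: oy; rewrite addrC -lerBlDr.
Qed.

Lemma entire_orbit_shift b c w y : entire_orbit c w y ->
  entire_orbit c (sigma b w) (fun s => y (b + s)).
Proof. by move=> ey a; rewrite -(addrK b a); exact: orbit_shift. Qed.

Lemma orbit_le a a' c c' w y : a <= a' -> 0 < c -> c <= c' ->
  bounded_orbit a c w y -> bounded_orbit a' c' w y.
Proof.
move=> aa c0 cc [[cy dy] oy]; split.
  by split => // t a't; apply: dy; exact: le_lt_trans a't.
by move=> t a't; apply: (part_near_le _ c0 cc) => //; apply: oy; exact: le_trans a't.
Qed.

Lemma entire_orbit_le c c' w y : 0 < c -> c <= c' ->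
  entire_orbit c w y -> entire_orbit c' w y.
Proof. by move=> c0 cc ey a; apply: (orbit_le (lexx a) c0 cc). Qed.

Lemma orbit_KB a c w y t : 0 < c -> bounded_orbit a c w y -> a <= t ->
  KB B (segment y t).
Proof. by move=> c0 [_ oy] at_; apply: (part_near_KB c0 psi0_KB); exact: oy. Qed.

Lemma orbit_norm a c w y t : 0 < c -> bounded_orbit a c w y -> a <= t ->
  `|segment y t| <= c * `|val psi0|.
Proof.
move=> c0 oy at_; have [_ op] := oy; have [_ up] := op t at_.
apply: le_trans (leB_norm (orbit_KB c0 oy at_) up) _.
by rewrite normrZ gtr0_norm.
Qed.

(** [M] depends on the part radius [c] only, neither on the base point nor on the starting time:
    this is the equicontinuity of all orbits in a part ball. *)
Lemma orbit_velocity c : 0 < c -> exists2 M : R, 0 <= M &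
  forall a w y t, bounded_orbit a c w y -> a <= t ->
    `|F (sigma t w) (segment y t)| <= M.
Proof.
move=> c0; have [M M0 MP] := F_norm_bound H (c * `|val psi0|).
by exists M => // a w y t oy at_; apply: MP; exact: orbit_norm oy at_.
Qed.

Lemma solves_lipschitz a w y M : 0 <= M -> solves a w y ->
  (forall t, a <= t -> `|F (sigma t w) (segment y t)| <= M) ->
  forall s t, a <= s -> a <= t -> `|y t - y s| <= M * `|t - s|.
Proof.
move=> M0 [cy dy] FM s t as_ at_.
apply: (@cV_lipschitz _ _ y (fun t => F (sigma t w) (segment y t))
  a (Num.max s t) M cy M0).
- by move=> u /andP[u0 _]; exact: dy.
- by move=> u /andP[u0 _]; apply: FM; exact: ltW.
- by rewrite as_ le_max lexx.
- by rewrite at_ le_max lexx orbT.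
Qed.

Lemma segmentL_orbit a c w y t : 0 < c -> bounded_orbit a c w y -> a + r%:num <= t ->
  val (segmentL y t) = segment y t.
Proof.
move=> c0 oy at_; have [M M0 MP] := orbit_velocity c0.
have [sy _] := oy.
apply: (@segmentLE _ _ _ y t M); first by case: sy.
move=> s u /andP[st _] /andP[ut _].
have rt : a <= t - r%:num by rewrite lerBrDr.
apply: (solves_lipschitz M0 sy) (le_trans rt st) (le_trans rt ut).
by move=> v; exact: MP oy.
Qed.

(** Along an ultrafilter the limit exists as soon as the values are eventually bounded. Being a
    total function of the family, it defines maps on orbits that can be iterated. *)
Definition ulim (T : Type) (U : set_system T) (y_ : T -> R -> V) (t : R) : V :=
  \col_i lim ((fun a => y_ a t i 0) @ U).

(** Bounded values converge pointwise along an ultrafilter; the common Lipschitz constant makes the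
    convergence joint, and continuity of [F] transfers it to the derivatives, whence the Lipschitz
    norm. The limit is entire because the starting times escape to [-oo] along [U]. *)
Lemma orbit_ulim (T : Type) (U : set_system T) (w_ : T -> Omega) w
    (y_ : T -> R -> V) c : UltraFilter U -> 0 < c -> w_ @ U --> w ->
  (forall a, \forall i \near U, bounded_orbit a c (w_ i) (y_ i)) ->
  [/\ entire_orbit c w (ulim U y_),
      forall t, joint_cvg U y_ t (ulim U y_ t) &
      forall t, (fun i => segmentL (y_ i) t) @ U --> segmentL (ulim U y_) t].
Proof.
move=> UU c0 ww oy; set y := ulim U y_.
have [M M0 MP] := orbit_velocity c0.
have yy t : (fun i => y_ i t) @ U --> y t.
  apply: cvg_mx => i j; rewrite mxE ord1.
  apply: (@ultra_bounded_cvg _ _ _ (c * `|val psi0|)).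
  apply: filterS (oy t) => a oa.
  apply: le_trans (coord_le_norm _ _) _.
  apply: le_trans (segment_norm_ge _ _) (orbit_norm c0 oa (lexx t)).
  by case: oa => -[].
have jy t : joint_cvg U y_ t (y t).
  move=> e e0; have e2 : 0 < e / 2 by rewrite divr_gt0.
  have H3 : \forall i \near U, `|y t - y_ i t| < e / 2.
    exact: cvgr_dist_lt (yy t) _ e2.
  have d0 : 0 < e / 2 / (M + 1) by rewrite divr_gt0// ltr_wpDl.
  (* A radius at most [1] keeps [s] after the time [t - 1] from which the orbits are known to be
     bounded; [M + 1] avoids a division by zero. *)
  pose d := Num.min 1 (e / 2 / (M + 1)).
  exists ([set i | `|y t - y_ i t| < e / 2] `&`
      [set i | bounded_orbit (t - 1) c (w_ i) (y_ i)], ball t d) => /=.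
    split; first by apply: filterI => //; exact: oy.
    by apply: nbhsx_ballx; rewrite lt_min ltr01.
  move=> [i s] /= [[yi oi]]; rewrite -ball_normE /= lt_min => /andP[ts1 tsd].
  have l1 : `|y_ i s - y_ i t| <= M * `|t - s|.
    rewrite [`|t - s|]distrC.
    apply: (solves_lipschitz M0 oi.1) => [u u1| |].
    - exact: MP oi u1.
    - by rewrite gerBl.
    - by rewrite lerBlDr -lerBlDl (le_trans (ler_norm _) (ltW ts1)).
  have l2 : M * `|t - s| <= e / 2.
    apply: (@le_trans _ _ (M * (e / 2 / (M + 1)))).
      by apply: ler_wpM2l => //; exact: ltW.
    rewrite mulrCA ler_piMr ?(ltW e2)// ler_pdivrMr ?ltr_wpDl// mul1r.
    by rewrite lerDl.
  rewrite -(subrK (y_ i t) (y_ i s)) -addrA.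
  apply: le_lt_trans (ler_normD _ _) _.
  rewrite [`|y_ i t - y t|]distrC [ltRHS]splitr.
  exact: ler_ltD (le_trans l1 l2) yi.
have cy : continuous y.
  move=> t; apply: (@joint_cvg_cvg R T _ U _ y_ y t _ (jy t)).
  by apply: filterE => s; exact: yy.
have cy_ : \forall i \near U, continuous (y_ i).
  by apply: filterS (oy 0) => i [[]].
have jseg t : joint_cvg U (fun i => segment (y_ i)) t (segment y t).
  by apply: joint_cvg_segment => // s _; exact: jy.
have jF t : joint_cvg U (fun i s => F (sigma s (w_ i)) (segment (y_ i) s)) t
    (F (sigma t w) (segment y t)).
  exact: (@F_joint_cvg R m r Omega sigma B F H T U _ w_ w y_ y t ww (jseg t)).
have dy t : is_derive t (1 : R) y (F (sigma t w) (segment y t)).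
  apply: (@is_derive_limit R m T U _ y_
    (fun i s => F (sigma s (w_ i)) (segment (y_ i) s))) => //.
  - by apply: filterE => s; exact: yy.
  - exists ([set i | bounded_orbit (t - 1) c (w_ i) (y_ i)], [set s | t - 1 < s]) => /=.
      by split; [exact: oy|apply: lt_nbhsr; rewrite gtrBl].
    by move=> [i s] /= [[[_ di] _] ts]; exact: di.
have py t : part_near B c psi0 (segment y t).
  apply: (@part_near_lim _ _ _ _ _ U _ (cst c) c (cst (val psi0))
    (fun i => segment (y_ i) t)) => //.
  - exact: cvg_cst.
  - by move=> s; exact: cvg_cst.
  - move=> s; rewrite segmentE//.
    apply: cvg_trans (yy (t + val s)); apply: near_eq_cvg.
    by apply: filterS cy_ => i ci; rewrite segmentE.
  - by apply: filterS (oy t) => i [_]; apply.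
have ey : entire_orbit c w y by move=> a; split; [split|].
split=> // t.
apply: (@segmentL_cvg R m r T U _ y_
  (fun i s => F (sigma s (w_ i)) (segment (y_ i) s)) y
  (fun s => F (sigma s w) (segment y s)) t M) => //.
- apply: filterS (oy (t - r%:num)) => i [[_ di] _] s /andP[ts _].
  exact: di.
- by move=> s _; apply: (MP s) => //; exact: ey.
- apply: filterS (oy (t - r%:num)) => i oi s /andP[ts _].
  by apply: MP oi _; exact: ltW.
- by move=> s _; exact: (continuous_F_segment H cy).
Qed.

(** The sandwich construction restarted at time [s] from the segment of [q] stays within [c] of [p],
    and uniqueness identifies its outcome with [q]. Thus the part metric does not expand
    forwards. *)
Lemma orbit_comparison a C c w p q s t : 0 < C -> 1 <= c ->
  bounded_orbit a C w p -> bounded_orbit a C w q -> a <= s -> s <= t ->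
  part_near B c (segment p s) (segment q s) ->
  part_near B c (segment p t) (segment q t).
Proof.
move=> C0 c1 op oq as_ st pq.
have as0 : a - s <= 0 by rewrite subr_le0.
have ops := orbit_le as0 C0 (lexx C) (orbit_shift s op).
have oqs := orbit_le as0 C0 (lexx C) (orbit_shift s oq).
have pq0 : part_near B c (segment (fun u => p (s + u)) 0)
    (segment (fun u => q (s + u)) 0) by rewrite !segment_shift addr0.
have [q' [sq' q'0 q'P]] := sandwich_solution H ops.1
  (fun t => orbit_KB C0 ops) (fun t => orbit_norm C0 ops) c1 pq0.
have ts0 : 0 <= t - s by rewrite subr_ge0.
have := q'P _ ts0.
have -> : segment q' (t - s) = segment (fun u => q (s + u)) (t - s).
  apply: segment_ext => u /andP[ru _].
  apply: (solves_unique H sq' oqs.1 q'0).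
  by apply: le_trans ru _; rewrite lerDr.
by rewrite !segment_shift [s + (t - s)]addrC subrK.
Qed.

Lemma orbit_exists C c w z (phi : X) : 0 < C -> 1 <= c -> bounded_orbit 0 C w z ->
  part_near B c (segment z 0) phi ->
  exists2 y, bounded_orbit 0 (C * c) w y & segment y 0 = phi.
Proof.
move=> C0 c1 oz zphi.
have [q [sq q0 qP]] := sandwich_solution H oz.1
  (fun t => orbit_KB C0 oz) (fun t => orbit_norm C0 oz) c1 zphi.
exists q; last exact: q0.
split; first exact: sq.
move=> t t0; apply: (part_near_trans C0 _ (oz.2 t t0) (qP t t0)).
exact: lt_le_trans c1.
Qed.

End Orbits.

(** * Link with the solution operator of the statement *)

Section Solutions.
Context {R : realType} {m : nat} {r : {posnum R}} {Omega : metricType R}.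
Context {sigma : R -> Omega -> Omega} {B : 'M[R]_m}.
Context {F : Omega -> CX m r -> 'cV[R]_m}.
Hypothesis H : sublinear_system sigma B F.
Local Notation X := (CX m r).
Local Notation segment := (@segment R m r).
Local Notation segmentL := (@segmentL R m r).
Local Notation solves := (@solves R m r Omega sigma F).

Lemma solves_is_solution w y : solves 0 w y ->
  is_solution sigma F w (segment y 0) y.
Proof.
move=> [cy dy]; split => //.
- exact: continuous_subspaceT.
- by move=> s; rewrite segmentE// add0r.
- apply: (right_derivative_limit cy dy); apply: cvg_at_right_filter.
  exact: (continuous_F_segment H cy).
Qed.

(** [is_solution] constrains [y] only from [-r] on; freezing it at its value at [-r] gives a
    function continuous on the whole line. *)
Lemma is_solution_solves w (phi : X) y : is_solution sigma F w phi y ->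
  exists z, [/\ solves 0 w z, segment z 0 = phi &
    forall t, - r%:num <= t -> z t = y t].
Proof.
move=> [cy y0 _ dy]; pose z t := y (Num.max (- r%:num) t).
have zy t : - r%:num <= t -> z t = y t by move=> rt; rewrite /z (max_idPr rt).
have r0 : 0 < r%:num := [gt0 of r%:num].
have cz : continuous z.
  move=> t.
  have gt : (`[- r%:num, +oo[%classic : set R) (Num.max (- r%:num) t).
    by rewrite /= in_itv /= andbT le_max lexx.
  have /subspace_continuousP/(_ _ gt) cyt := cy.
  have cm : continuous (fun t : R => Num.max (- r%:num) t).
    rewrite (_ : (fun t => _) = fun t => Num.max (t + r%:num) 0 - r%:num).
      move=> s; apply: cvgB; last exact: cvg_cst.
      apply: (@continuous_comp R R R (fun t : R => t + r%:num)
        (fun t : R => Num.max t 0) s); last exact: continuous_maxr0.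
      by apply: cvgD; [exact: cvg_id|exact: cvg_cst].
    by apply/funext => s; rewrite addr_maxl addrK add0r maxC.
  apply: cvg_trans cyt => A /= [D /= D0 DA].
  have : \forall s \near t, ball (Num.max (- r%:num) t) D (Num.max (- r%:num) s).
    by apply: (cm t); exact: nbhsx_ballx.
  apply: filterS => s /DA; apply.
  by rewrite /= in_itv /= andbT le_max lexx.
have segz t : 0 <= t -> segment z t = segment y t.
  move=> t0; apply: segment_ext => s /andP[rs _]; apply: zy.
  by apply: le_trans rs _; rewrite lerDr.
exists z; split; last exact: zy.
- split; first exact: cz.
  move=> t t0; rewrite (segz _ (ltW t0)).
  apply: (@near_eq_is_derive _ _ _ y); last exact: dy.
  near=> s; rewrite zy//; apply: (@le_trans _ _ 0); first by rewrite oppr_le0 ltW.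
  by apply: ltW; near: s; exact: lt_nbhsr.
- apply: CX_ext => s; rewrite segmentE// add0r zy ?y0//.
  by have /andP[] := delay_itv_bounds s.
Unshelve. all: by end_near. Qed.

(** The operator picks a solution by choice; uniqueness makes the pick agree with [y] on every
    window ending after time [0]. *)
Lemma sol_segment_solves w y t : solves 0 w y -> 0 <= t ->
  sol_segment sigma F t w (segment y 0) = segment y t.
Proof.
move=> sy t0.
have : is_solution sigma F w (segment y 0) (solution sigma F w (segment y 0)).
  by apply: xgetPex; exists y; exact: solves_is_solution.
move=> /is_solution_solves[z [sz z0 zE]].
apply: segment_ext => s /andP[rs _].
have rts : - r%:num <= t + s by apply: le_trans rs _; rewrite lerDr.
by rewrite -zE//; exact: (solves_unique H sz sy z0).
Qed.

Lemma sol_segmentL_solves w y (phi : XL m r) t : solves 0 w y ->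
  segment y 0 = phi -> 0 <= t -> sol_segmentL sigma F t w phi = segmentL y t.
Proof.
by move=> sy y0 t0; rewrite /sol_segmentL -y0 sol_segment_solves.
Qed.

End Solutions.

(** * Return times provided by minimality *)

Section Recurrence.
Context {R : realType} {m : nat} {r : {posnum R}} {Omega : metricType R}.
Context {sigma : R -> Omega -> Omega} {B : 'M[R]_m}.
Context {F : Omega -> CX m r -> 'cV[R]_m}.
Hypothesis H : sublinear_system sigma B F.

(** The cluster set of the orbit of [w] along [G] is closed, nonempty by compactness, and
    flow-invariant because [G] is stable under translations; minimality makes it the whole space.
    The same argument serves both ends of the time line. *)
Lemma minimal_ultrafilter (G : set_system R) (w w' : Omega) : ProperFilter G ->
  (forall s A, G A -> G [set t | A (t + s)]) ->
  exists U : set_system R, [/\ UltraFilter U, G `<=` U &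
    (fun t => sigma t w) @ U --> w'].
Proof.
move=> PG Gs; pose S := cluster ((fun t => sigma t w) @ G).
have Sinv s v : S v -> S (sigma s v).
  move=> Sv A D GA /= vD.
  have sv : (fun u => sigma s u) @ v --> sigma s v.
    by apply: (sigma_cvg H); [exact: cvg_cst|exact: cvg_id].
  have GA' : ((fun t => sigma t w) @ G) [set u | A (sigma s u)].
    suff : G [set t | A (sigma s (sigma t w))] by [].
    have : G [set t | A (sigma (t + s) w)] by exact: Gs GA.
    by apply: filterS => t; rewrite /= (flowD H).
  by have [u [Au Du]] := Sv _ _ GA' (sv _ vD); exists (sigma s u).
have ST : S = setT.
  apply: (system_minimal H).
  - move=> v Sv A D GA vD; have [u [Su Du]] := Sv _ (nbhs_interior vD).
    exact: Su GA Du.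
  - have PGw : ProperFilter ((fun t => sigma t w) @ G) by exact: fmap_proper_filter.
    have cO : compact [set: Omega] := system_compact H.
    have [|v [_ Sv]] := cO _ PGw; first exact: filterT.
    by exists v.
  - move=> t; apply/seteqP; split=> [_ [v Sv <-]|v Sv]; first exact: Sinv.
    exists (sigma (- t) v); first exact: Sinv.
    by rewrite -(flowD H) addNr (flow0 H).
have Sw' : S w' by rewrite ST.
(* The filter generated by [G] and by the times that bring [w] close to [w']; it is proper because
   [w'] is a cluster point. *)
pose G' : set_system R := [set P | exists A D, [/\ G A, nbhs w' D &
  forall t, A t -> D (sigma t w) -> P t]].
have PG' : ProperFilter G'.
  split.
    move=> [A [D [GA wD AD]]].
    have GA' : ((fun t => sigma t w) @ G) [set u | exists2 t, A t & sigma t w = u].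
      suff : G [set s | exists2 t, A t & sigma t w = sigma s w] by [].
      by apply: filterS GA => t At; exists t.
    have [u [[t At <-] Du]] := Sw' _ _ GA' wD.
    exact: AD At Du.
  split.
  - by exists setT, setT; split=> //; exact: filterT.
  - move=> P Q [A [D [GA wD AD]]] [A' [D' [GA' wD' AD']]].
    exists (A `&` A'), (D `&` D'); split; [exact: filterI|exact: filterI|].
    by move=> t [At A't] [Dt D't]; split; [exact: AD|exact: AD'].
  - move=> P Q PQ [A [D [GA wD AD]]]; exists A, D; split => // t At Dt.
    by apply: PQ; exact: AD.
have [U [UU G'U]] := ultraFilterLemma PG'.
exists U; split => //.
- by move=> A GA; apply: G'U; exists A, setT; split => //; exact: filterT.
- move=> D wD; apply: G'U; exists setT, D; split => //; exact: filterT.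
Qed.

Lemma forward_ultrafilter (w w' : Omega) : exists U : set_system R,
  [/\ UltraFilter U, forall a, \forall t \near U, a <= t &
    (fun t => sigma t w) @ U --> w'].
Proof.
have [|U [UU GU Uw]] := @minimal_ultrafilter +oo w w' _.
  by move=> s A [M [_ MA]]; exists (M - s); split;
    [exact: num_real|move=> t; rewrite ltrBlDr => ?; exact: MA].
exists U; split=> [//|a|//]; apply: GU.
exact: (nbhs_pinfty_ge (num_real a)).
Qed.

Lemma backward_ultrafilter (w w' : Omega) : exists U : set_system R,
  [/\ UltraFilter U, forall a, \forall t \near U, t <= a &
    (fun t => sigma t w) @ U --> w'].
Proof.
have [|U [UU GU Uw]] := @minimal_ultrafilter -oo w w' _.
  by move=> s A [M [_ MA]]; exists (M - s); split;
    [exact: num_real|move=> t; rewrite ltrBrDr => ?; exact: MA].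
exists U; split=> [//|a|//]; apply: GU.
exact: (nbhs_ninfty_le (num_real a)).
Qed.

End Recurrence.

(** * Recurrence of entire orbits *)

Section EntireOrbits.
Context {R : realType} {m : nat} {r : {posnum R}} {Omega : metricType R}.
Context {sigma : R -> Omega -> Omega} {B : 'M[R]_m}.
Context {F : Omega -> CX m r -> 'cV[R]_m}.
Hypothesis H : sublinear_system sigma B F.
Context {psi0 : XL m r}.
Hypothesis psi0_gt : gtB0 B psi0.
Local Notation V := 'cV[R]_m.
Local Notation X := (CX m r).
Local Notation segment := (@segment R m r).
Local Notation segmentL := (@segmentL R m r).
Local Notation entire_orbit := (@entire_orbit R m r Omega sigma B F psi0).
Local Notation near0 c p q := (part_near B c (segment p 0) (segment q 0)).
Let psi0_KB : KB B psi0 := gtB0_KB psi0_gt.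

(** Small Lipschitz balls lie inside part balls: a perturbation of norm at most [d / (k * c)] is
    below [d *: phi], because [psi0] is an order unit and is itself below [c *: phi]. *)
Lemma XL_part_near (phi : XL m r) c eta : 0 < c ->
  leB B (c^-1 *: val psi0) phi -> 1 < eta ->
  exists2 e, 0 < e &
    forall chi : XL m r, `|chi - phi| <= e -> part_near B eta phi chi.
Proof.
move=> c0 phi_ge eta1; have eta0 : 0 < eta by apply: lt_trans eta1.
have [k k0 kP] := gtB0_absorbing psi0_gt.
(* [d] serves both sides: [1 - d] equals [eta^-1], and [1 + d] is at most [eta]. *)
pose d := 1 - eta^-1.
have d0 : 0 < d by rewrite subr_gt0 invf_lt1.
have de : d <= eta - 1.
  rewrite /d -subr_ge0.
  have -> : eta - 1 - (1 - eta^-1) = (eta - 1) ^+ 2 / eta.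
    by field; rewrite gt_eqF.
  by rewrite divr_ge0 ?sqr_ge0// ltW.
have phiK : KB B phi.
  by apply: KB_le phi_ge; apply: KBZ => //; rewrite invr_ge0 ltW.
have psi_le : leB B psi0 (c *: val phi).
  by have := leBZ (ltW c0) phi_ge; rewrite (scalerKV (lt0r_neq0 c0)).
exists (d / (k * c)); first by rewrite divr_gt0// mulr_gt0.
have bnd (chi : XL m r) : `|chi| <= d / (k * c) -> leB B chi (d *: val phi).
  move=> chi_le; apply: leB_trans (kP chi) _.
  have kn : k * `|chi| <= d / c.
    rewrite mulrC -ler_pdivlMr//.
    by rewrite (le_trans chi_le)// invfM mulrA mulrAC.
  apply: leB_trans (leB_scale psi0_KB kn) _.
  have dc : 0 <= d / c by rewrite divr_ge0 ?ltW.
  by have := leBZ dc psi_le; rewrite scalerA divfK// gt_eqF.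
move=> chi chi_e.
have h1 : leB B (val chi - val phi) (d *: val phi) := bnd (chi - phi) chi_e.
have h2 : leB B (val phi - val chi) (d *: val phi).
  by apply: (bnd (phi - chi)); rewrite distrC.
split.
  rewrite /leB (_ : val chi - eta^-1 *: val phi =
    d *: val phi - (val phi - val chi)); first exact: h2.
  by rewrite /d scalerBl scale1r opprB [RHS]addrC addrA subrK.
apply: leB_trans (leB_scale phiK (_ : 1 + d <= eta)); last first.
  by rewrite addrC -lerBrDr.
rewrite /leB (_ : (1 + d) *: val phi - val chi =
  d *: val phi - (val chi - val phi)); first exact: h1.
by rewrite scalerDl scale1r opprB addrCA addrA.
Qed.

Lemma entire_segmentL c w y t : 0 < c -> entire_orbit c w y ->
  val (segmentL y t) = segment y t.
Proof.
move=> c0 ey; apply: (segmentL_orbit H psi0_KB c0 (ey (t - r%:num))).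
by rewrite subrK.
Qed.

Lemma entire_part_near C w p q c s t : 0 < C -> entire_orbit C w p ->
  entire_orbit C w q -> part_near B c (segmentL p s) (segmentL q t) ->
  part_near B c (segment p s) (segment q t).
Proof.
move=> C0 ep eq_ h.
exact: (eq_ind _ (fun x => part_near B c x (segment q t))
  (eq_ind _ (fun z => part_near B c (val (segmentL p s)) z) h _
    (entire_segmentL t C0 eq_)) _ (entire_segmentL s C0 ep)).
Qed.

Lemma cvg_part_near (T : Type) (U : set_system T) (FU : Filter U)
    (x_ : T -> XL m r) c w y t eta : 0 < c -> entire_orbit c w y -> 1 < eta ->
  x_ @ U --> segmentL y t ->
  \forall i \near U, part_near B eta (segment y t) (x_ i).
Proof.
move=> c0 ey eta1 xy; rewrite -(entire_segmentL t c0 ey).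
have [|e e0 eP] := @XL_part_near (segmentL y t) c eta c0 _ eta1.
  by rewrite (entire_segmentL t c0 ey); have [_ /(_ t (lexx t))[]] := ey t.
move/cvgrPdist_le : xy => /(_ e e0); apply: filterS => i xi.
by apply: eP; rewrite distrC.
Qed.

Lemma cvg_part_near2 (T : Type) (U : set_system T) (FU : Filter U)
    (x_ y_ : T -> XL m r) C w p q s t c c' : 0 < C -> 1 <= c -> c < c' ->
  entire_orbit C w p -> entire_orbit C w q ->
  x_ @ U --> segmentL p s -> y_ @ U --> segmentL q t ->
  part_near B c (segment p s) (segment q t) ->
  \forall i \near U, part_near B c' (x_ i) (y_ i).
Proof.
move=> C0 c1 cc' ep eq_ xp yq pq; have c0 : 0 < c by apply: lt_le_trans c1.
(* One factor [eta] is spent at each end of the comparison, and the two make up [c' / c]. *)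
pose eta := Num.sqrt (c' / c).
have eta1 : 1 < eta by apply: sqrt_gt1; rewrite ltr_pdivlMr// mul1r.
have eta0 : 0 < eta by apply: lt_trans eta1.
have -> : c' = eta * c * eta.
  rewrite mulrAC -expr2 sqr_sqrtr ?divfK ?gt_eqF//.
  by rewrite divr_ge0// ltW// (lt_trans c0).
have px := cvg_part_near FU C0 ep eta1 xp.
have qy := cvg_part_near FU C0 eq_ eta1 yq.
apply: filterS2 px qy => i px qy.
apply: (part_near_trans _ eta0 _ qy); first by rewrite mulr_gt0.
by apply: (part_near_trans eta0 c0 (part_near_sym eta0 px) pq).
Qed.

Section Expansion.
Context (C : R) (w : Omega) (h : (R -> V) -> (R -> V)).
Hypothesis C0 : 0 < C.
Hypothesis hE : forall y, entire_orbit C w y -> entire_orbit C w (h y).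
Hypothesis hX : forall p q c, entire_orbit C w p -> entire_orbit C w q ->
  1 <= c -> near0 c (h p) (h q) -> near0 c p q.

Lemma iter_entire p k : entire_orbit C w p -> entire_orbit C w (iter k h p).
Proof. by move=> ep; elim: k => [|k IH]; [exact: ep|exact: hE IH]. Qed.

Lemma iter_expansion p q c k : entire_orbit C w p -> entire_orbit C w q ->
  1 <= c -> near0 c (iter k h p) (iter k h q) -> near0 c p q.
Proof.
move=> ep eq_ c1; elim: k => [|k IH] pq; first exact: pq.
apply: IH; exact: (hX (iter_entire k ep) (iter_entire k eq_) c1 pq).
Qed.

(* As for every expanding self-map of a compact metric space: two iterates
   [h^k p] and [h^l p], [k < l], are close, and [p] and [h^(l-k) p] are at
   least as close. *)
Lemma expansion_recurrent p q eta : entire_orbit C w p -> entire_orbit C w q ->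
  1 < eta -> exists2 k, (0 < k)%N &
    near0 eta p (iter k h p) /\ near0 eta q (iter k h q).
Proof.
move=> ep eq_ eta1; have [U [UU oU]] := nat_ultrafilter.
have s1 := sqrt_gt1 eta1; have s0 : 0 < Num.sqrt eta by apply: lt_trans s1.
have ss : Num.sqrt eta * Num.sqrt eta = eta.
  by rewrite -expr2 sqr_sqrtr// ltW// (lt_trans _ eta1).
have lim y : entire_orbit C w y ->
    exists2 x : X, True & \forall k \near U,
      part_near B (Num.sqrt eta) x (segment (iter k h y) 0).
  move=> ey.
  have [ex _ cx] := orbit_ulim H psi0_KB (w_ := cst w) (w := w)
    (y_ := fun k => iter k h y) UU C0 (cvg_cst w)
    (fun a => @filterE _ U _ _ (fun k => iter_entire k ey a)).
  exists (segment (ulim U (fun k => iter k h y)) 0) => //.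
  have near_x : \forall k \near U, part_near B (Num.sqrt eta)
      (segment (ulim U (fun k => iter k h y)) 0) (segmentL (iter k h y) 0).
    exact: (cvg_part_near _ C0 ex s1 (cx 0)).
  apply: filterS near_x => k.
  by rewrite (entire_segmentL 0 C0 (iter_entire k ey)).
have [x _ xP] := lim p ep; have [z _ zP] := lim q eq_.
(* A common pair of indices is sought for [p] and [q], since their iterates of the same order will
   be compared. *)
have Uxz : \forall k \near U,
    part_near B (Num.sqrt eta) x (segment (iter k h p) 0) /\
    part_near B (Num.sqrt eta) z (segment (iter k h q) 0).
  exact: filterI xP zP.
have [k [kx kz]] := filter_ex Uxz.
have [l [[lx lz] kl]] : exists l, (part_near B (Num.sqrt eta) x
    (segment (iter l h p) 0) /\ part_near B (Num.sqrt eta) z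
    (segment (iter l h q) 0)) /\ (k < l)%N.
  apply: (@filter_ex _ U); apply: filterI Uxz _; apply: oU.
  by exists k.+1.
exists (l - k)%N; first by rewrite subn_gt0.
have E y : iter l h y = iter k h (iter (l - k)%N h y).
  by rewrite -iterD subnKC// ltnW.
have ep' := iter_entire (l - k) ep; have eq' := iter_entire (l - k) eq_.
have := part_near_trans s0 s0 (part_near_sym s0 kx) lx.
have := part_near_trans s0 s0 (part_near_sym s0 kz) lz.
rewrite ss (E p) (E q) => qkl pkl.
split; first exact: (iter_expansion ep ep' (ltW eta1) pkl).
exact: (iter_expansion eq_ eq' (ltW eta1) qkl).
Qed.

(** Returns in the part metric with factors tending to [1] have, along an ultrafilter, a Lipschitz
    limit related to [p] with factor [1]; antisymmetry of the order then forces equality at time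
    [0]. *)
Lemma expansion_recurrent_XL p e : entire_orbit C w p -> 0 < e ->
  exists2 k, (0 < k)%N & `|segmentL (iter k h p) 0 - segmentL p 0| < e.
Proof.
move=> ep e0.
have /choice[k_ kP] : forall n, exists k, (0 < k)%N /\
    near0 (1 + n.+1%:R^-1) p (iter k h p).
  move=> n; have [|k k0 [pk _]] := @expansion_recurrent p p (1 + n.+1%:R^-1) ep ep.
    by rewrite ltrDl invr_gt0.
  by exists k.
have [U [UU oU]] := nat_ultrafilter.
have [ex _ cx] := orbit_ulim H psi0_KB (w_ := cst w) (w := w)
    (y_ := fun n => iter (k_ n) h p) UU C0 (cvg_cst w)
    (fun a => @filterE _ U _ _ (fun n => iter_entire (k_ n) ep a)).
set x := ulim U _ in ex cx.
have c_cvg : (fun n => 1 + n.+1%:R^-1 : R) @ U --> (1 : R).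
  rewrite -[X in _ --> X]addr0; apply: cvgD; first exact: cvg_cst.
  by move=> A /cvg_harmonic ?; exact: oU.
have : near0 1 p x.
  apply: (@part_near_lim _ _ _ _ _ U _ (fun n => 1 + n.+1%:R^-1) 1
    (cst (segment p 0)) (fun n => segment (iter (k_ n) h p) 0) _ _ ltr01 c_cvg).
  - by move=> s; exact: cvg_cst.
  - move=> s; rewrite -(entire_segmentL 0 C0 ex).
    rewrite (_ : (fun n => _) =
      fun n => val (segmentL (iter (k_ n) h p) 0) s).
      exact: XL_pointwise_cvg (cx 0).
    by apply/funext => n; rewrite (entire_segmentL 0 C0 (iter_entire (k_ n) ep)).
  - by apply: filterE => n; exact: (kP n).2.
rewrite /part_near invr1 !scale1r => -[px xp].
have pxE : segmentL p 0 = segmentL x 0.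
  apply: val_inj; apply: etrans (entire_segmentL 0 C0 ep) _.
  exact: etrans (leB_antisym px xp) (esym (entire_segmentL 0 C0 ex)).
have cp : (fun n => segmentL (iter (k_ n) h p) 0) @ U --> segmentL p 0.
  exact: (eq_ind_r (fun z => _ @ U --> z) (cx 0) pxE).
move/cvgrPdist_lt : cp => /(_ e e0)/filter_ex[n ne].
exists (k_ n); first exact: (kP n).1.
by rewrite distrC; exact: ne.
Qed.

End Expansion.

Definition translation_limit (U : set_system R) (y : R -> V) : R -> V :=
  ulim U (fun a s => y (a + s)).

Lemma translation_limitP (U : set_system R) C (w w' : Omega) y : UltraFilter U -> 0 < C ->
  (fun a => sigma a w) @ U --> w' -> entire_orbit C w y ->
  entire_orbit C w' (translation_limit U y) /\
  forall t, (fun a => segmentL y (a + t)) @ U -->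
    segmentL (translation_limit U y) t.
Proof.
move=> UU C0 ww ey.
have [ex _ cx] := orbit_ulim H psi0_KB (y_ := fun a s => y (a + s)) UU C0 ww
  (fun a => @filterE _ U _ _ (fun b => entire_orbit_shift H b ey a)).
split; first exact: ex.
move=> t; have E : (fun a => segmentL (fun s => y (a + s)) t) =
    fun a => segmentL y (a + t).
  by apply/funext => a; exact: segmentL_shift.
by rewrite -E; exact: cx.
Qed.

Lemma entire_comparison C w p q c s t : 0 < C -> 1 <= c ->
  entire_orbit C w p -> entire_orbit C w q -> s <= t ->
  part_near B c (segment p s) (segment q s) ->
  part_near B c (segment p t) (segment q t).
Proof.
move=> C0 c1 ep eq_ st.
exact: (orbit_comparison H psi0_KB C0 c1 (ep s) (eq_ s) (lexx s) st).
Qed.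

Lemma translation_limit_part_near (U : set_system R) C (w w' : Omega) p q c c' :
  UltraFilter U -> 0 < C -> 1 <= c -> c < c' ->
  (fun a => sigma a w) @ U --> w' ->
  entire_orbit C w p -> entire_orbit C w q ->
  near0 c (translation_limit U p) (translation_limit U q) ->
  \forall a \near U, part_near B c' (segment p a) (segment q a).
Proof.
move=> UU C0 c1 cc' ww ep eq_ pq.
have [ep' cp] := translation_limitP UU C0 ww ep.
have [eq' cq] := translation_limitP UU C0 ww eq_.
have near_a : \forall a \near U,
    part_near B c' (segmentL p (a + 0)) (segmentL q (a + 0)).
  exact: (cvg_part_near2 _ C0 c1 cc' ep' eq' (cp 0) (cq 0) pq).
apply: filterS near_a => a.
by rewrite addr0; exact: entire_part_near C0 ep eq_.
Qed.

(* The limit of the translations along an ultrafilter converging to -oo and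
   bringing [w] back to [w] expands the part distance, hence is an isometry by
   recurrence; as the part distance decreases along orbits, it is constant. *)
Lemma part_distance_constant C w p q c t : 0 < C -> 1 <= c ->
  entire_orbit C w p -> entire_orbit C w q -> near0 c p q ->
  part_near B c (segment p t) (segment q t).
Proof.
move=> C0 c1 ep eq_ pq; have c0 : 0 < c by apply: lt_le_trans c1.
have [U [UU Ua Uw]] := backward_ultrafilter H w w.
pose g := translation_limit U.
have gE y : entire_orbit C w y -> entire_orbit C w (g y).
  by move=> ey; have [] := translation_limitP UU C0 Uw ey.
(* The times along [U] tend to [-oo]: closeness of the limits gives closeness at some [a <= s], and
   non-expansion carries it forward to [s]. *)
have gpast y z d d' s : entire_orbit C w y -> entire_orbit C w z -> 1 <= d ->
    d < d' -> near0 d (g y) (g z) ->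
    part_near B d' (segment y s) (segment z s).
  move=> ey ez d1 dd' yz.
  have := translation_limit_part_near UU C0 d1 dd' Uw ey ez yz.
  move=> /(filterI (Ua s))/filter_ex[a [as_ ya]].
  exact: entire_comparison C0 (ltW (le_lt_trans d1 dd')) ey ez as_ ya.
have gX y z d : entire_orbit C w y -> entire_orbit C w z -> 1 <= d ->
    near0 d (g y) (g z) -> near0 d y z.
  move=> ey ez d1 yz; apply: part_near_closed; first exact: lt_le_trans d1.
  by move=> d' dd'; exact: gpast ey ez d1 dd' yz.
(* [g] does not increase the distance either: recurrence puts the [k]-th iterates within
   [eta * c * eta] of each other, and undoing [k.-1] expansions transfers this bound to [g p] and
   [g q]. *)
have gpq : near0 c (g p) (g q).
  apply: (part_near_closed c0) => c' cc'.
  pose eta := Num.sqrt (c' / c).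
  have c'0 : 0 < c' by apply: lt_trans cc'.
  have eta1 : 1 < eta by apply: sqrt_gt1; rewrite ltr_pdivlMr// mul1r.
  have eta0 : 0 < eta by apply: lt_trans eta1.
  have [k k0 [pk qk]] := expansion_recurrent C0 gE gX ep eq_ eta1.
  have : near0 c' (iter k g p) (iter k g q).
    have -> : c' = eta * c * eta.
      by rewrite mulrAC -expr2 sqr_sqrtr ?divfK ?gt_eqF// divr_ge0// ltW.
    apply: (part_near_trans _ eta0 _ qk); first by rewrite mulr_gt0.
    exact: (part_near_trans eta0 c0 (part_near_sym eta0 pk) pq).
  rewrite -(prednK k0) !iterSr; apply: (iter_expansion gE gX).
  - exact: gE.
  - exact: gE.
  - exact: ltW (le_lt_trans c1 cc').
apply: (part_near_closed c0) => c' cc'.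
exact: gpast ep eq_ c1 cc' gpq.
Qed.

Lemma part_distance_constant2 C w p q c s t : 0 < C -> 1 <= c ->
  entire_orbit C w p -> entire_orbit C w q ->
  part_near B c (segment p s) (segment q s) ->
  part_near B c (segment p t) (segment q t).
Proof.
move=> C0 c1 ep eq_ pq.
have pq0 : near0 c (fun u => p (s + u)) (fun u => q (s + u)).
  by rewrite !segment_shift addr0; exact: pq.
have := part_distance_constant (t - s) C0 c1
  (entire_orbit_shift H s ep) (entire_orbit_shift H s eq_) pq0.
rewrite !segment_shift (_ : s + (t - s) = t); last by rewrite addrC subrK.
by [].
Qed.

(** A single time at which the orbits are close suffices, since their part distance is constant;
    this covers ultrafilters in either direction of time. *)
Lemma translation_limit_expansion (U : set_system R) C (w w' : Omega) p q c :
  UltraFilter U -> 0 < C -> 1 <= c -> (fun a => sigma a w) @ U --> w' ->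
  entire_orbit C w p -> entire_orbit C w q ->
  near0 c (translation_limit U p) (translation_limit U q) -> near0 c p q.
Proof.
move=> UU C0 c1 ww ep eq_ pq; have c0 : 0 < c by apply: lt_le_trans c1.
apply: (part_near_closed c0) => c' cc'.
have /filter_ex[a pqa] := translation_limit_part_near UU C0 c1 cc' ww ep eq_ pq.
exact: part_distance_constant2 C0 (ltW (le_lt_trans c1 cc')) ep eq_ pqa.
Qed.

(** The limit [f] of forward translations expands, so some iterate of [p] under [f] of positive
    order returns close to [p]; and every such iterate is approximated by forward translates of
    [p]. *)
Lemma entire_orbit_recurrent C w p T e (D : set Omega) : 0 < C ->
  entire_orbit C w p -> 0 < e -> nbhs w D ->
  exists t, [/\ T <= t, D (sigma t w) & `|segmentL p t - segmentL p 0| < e].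
Proof.
move=> C0 ep e0 wD.
have [U [UU Ua Uw]] := forward_ultrafilter H w w.
pose f := translation_limit U.
have fE y : entire_orbit C w y -> entire_orbit C w (f y).
  by move=> ey; have [] := translation_limitP UU C0 Uw ey.
have fX y z d : entire_orbit C w y -> entire_orbit C w z -> 1 <= d ->
    near0 d (f y) (f z) -> near0 d y z.
  by move=> ey ez d1; exact: (translation_limit_expansion UU C0 d1 Uw ey ez).
have e2 : 0 < e / 2 by rewrite divr_gt0.
have base y s S d (A : set Omega) : entire_orbit C w y -> 0 < d ->
    nbhs (sigma s w) A -> exists a, [/\ S <= a, nbhs (sigma (a + s) w) A &
      `|segmentL y (a + s) - segmentL (f y) s| < d].
  move=> ey d0 sA.
  have [_ cy] := translation_limitP UU C0 Uw ey.
  have h1 : \forall a \near U, `|segmentL (f y) s - segmentL y (a + s)| < d.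
    by move/cvgrPdist_lt : (cy s) => /(_ d d0).
  have sUw : (fun a => sigma s (sigma a w)) @ U --> sigma s w.
    by apply: (sigma_cvg H); [exact: cvg_cst|exact: Uw].
  have h2 : \forall a \near U, A° (sigma s (sigma a w)).
    by apply: sUw; exact: nbhs_interior.
  have /filter_ex[a [Sa [ya Aa]]] : \forall a \near U, S <= a /\
      (`|segmentL (f y) s - segmentL y (a + s)| < d /\ A° (sigma s (sigma a w))).
    exact: filterI (Ua S) (filterI h1 h2).
  exists a; split; first exact: Sa.
    by rewrite (flowD H); exact: Aa.
  by rewrite distrC; exact: ya.
(* The neighbourhood [A] follows the base point at every shifted time [s], so that approximations
   can be chained. *)
pose P y := forall s S d (A : set Omega), 0 < d -> nbhs (sigma s w) A ->
  exists t, [/\ S <= t, A (sigma (t + s) w) &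
    `|segmentL p (t + s) - segmentL y s| < d].
have PS y : entire_orbit C w y -> P y -> P (f y).
  move=> ey Py s S d A d0 sA; have d2 : 0 < d / 2 by rewrite divr_gt0.
  have [a [a0 Aa ya]] := base y s 0 (d / 2) A ey d2 sA.
  have [t [St At pt]] := Py (a + s) S (d / 2) A d2 Aa.
  exists (t + a); split; first by rewrite (le_trans St)// lerDl.
    by rewrite -addrA; exact: At.
  rewrite -addrA.
  rewrite -(subrK (segmentL y (a + s)) (segmentL p _)) -addrA.
  apply: le_lt_trans (ler_normD _ _) _; rewrite [ltRHS]splitr.
  exact: ltrD pt ya.
(* The induction starts at [f p], as [P p] would already be recurrence; this is why the return below
   must have [k > 0]. *)
have Pk k : P (iter k.+1 f p).
  elim: k => [|k IH]; last exact: PS (iter_entire fE k.+1 ep) IH.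
  move=> s S d A d0 sA; have [a [Sa Aa pa]] := base p s S d A ep d0 sA.
  exists a; split; [exact: Sa|exact: nbhs_singleton|exact: pa].
have [k k0 pk] := expansion_recurrent_XL C0 fE fX ep e2.
have wD0 : nbhs (sigma 0 w) D by rewrite (flow0 H).
have [t [Tt Dt pt]] := Pk k.-1 0 T (e / 2) D e2 wD0.
rewrite (prednK k0) addr0 in pt; rewrite addr0 in Dt.
exists t; split; [exact: Tt|exact: Dt|].
rewrite -(subrK (segmentL (iter k f p) 0) (segmentL p t)) -addrA.
apply: le_lt_trans (ler_normD _ _) _; rewrite [ltRHS]splitr.
exact: ltrD pt pk.
Qed.

End EntireOrbits.

(** * The attractor *)

Section Ultralimits.

(** If the preimage of a neighbourhood is not in [G], its complement generates with [G] a proper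
    filter, and an ultrafilter above it contradicts the hypothesis. *)
Lemma ultra_cvg (T : Type) (S : topologicalType) (G : set_system T)
    (f : T -> S) (l : S) : Filter G ->
  (forall U, UltraFilter U -> G `<=` U -> f @ U --> l) -> f @ G --> l.
Proof.
move=> FG ul A lA; apply: contrapT => nGA.
pose G' : set_system T := [set P | G [set x | ~ A (f x) -> P x]].
have PG' : ProperFilter G'.
  split.
    move=> G0; apply: nGA.
    suff : G [set x | A (f x)] by [].
    have {}G0 : G [set x | ~ A (f x) -> False] by exact: G0.
    by apply: filterS G0 => x; exact: contrapT.
  split.
  - suff : G [set x | ~ A (f x) -> setT x] by [].
    by apply: filterE.
  - move=> P Q GP GQ.
    suff : G [set x | ~ A (f x) -> (P `&` Q) x] by [].
    have {}GP : G [set x | ~ A (f x) -> P x] by exact: GP.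
    have {}GQ : G [set x | ~ A (f x) -> Q x] by exact: GQ.
    have GPQ := @filterI _ G FG _ _ GP GQ.
    by apply: (@filterS _ G FG _ _ _ GPQ) => x [p q] nA; split; [exact: p|exact: q].
  - move=> P Q PQ GP.
    suff : G [set x | ~ A (f x) -> Q x] by [].
    have {}GP : G [set x | ~ A (f x) -> P x] by exact: GP.
    by apply: (@filterS _ G FG _ _ _ GP) => x p nA; exact/PQ/p.
have [U [UU G'U]] := ultraFilterLemma PG'.
have GU : G `<=` U.
  move=> P GP; apply: G'U.
  suff : G [set x | ~ A (f x) -> P x] by [].
  by apply: (@filterS _ G FG _ _ _ GP) => x px _; exact: px.
have UA : U [set x | A (f x)] by exact: (ul U UU GU A lA).
have UnA : U [set x | ~ A (f x)].
  apply: G'U; suff : G [set x | ~ A (f x) -> ~ A (f x)] by [].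
  by apply: (@filterE _ G FG) => x nA; exact: nA.
have UF : U set0 by apply: (filterS _ (filterI UA UnA)) => x [? ?].
exact: (@filter_not_empty _ U _ UF).
Qed.

Lemma set_type_cvg (S : topologicalType) (E : set S) (G : set_system E) (p : E) :
  Filter G -> (fun q : E => val q) @ G --> val p -> G --> p.
Proof.
move=> FG Gp A; rewrite nbhsE => -[D oD DA]; apply: filterS DA _.
have [[W oW WD] Dp] := oD; rewrite -WD in Dp *.
suff : ((fun q : E => val q) @ G) W by [].
by apply: Gp; apply: open_nbhs_nbhs; split.
Qed.

Lemma cvg_prod (T : Type) (S1 S2 : topologicalType) (G : set_system T)
    (f : T -> S1) (g : T -> S2) (l1 : S1) (l2 : S2) : Filter G ->
  f @ G --> l1 -> g @ G --> l2 -> (fun a => (f a, g a)) @ G --> (l1, l2).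
Proof. by move=> FG; exact: cvg_pair. Qed.

Lemma cvg_prod1 (T : Type) (S1 S2 : topologicalType) (G : set_system T)
    (f : T -> S1 * S2) (l : S1 * S2) :
  f @ G --> l -> (fun a => (f a).1) @ G --> l.1.
Proof. by move=> fl; apply: (cvg_comp _ _ fl); case: l {fl} => ? ?; exact: cvg_fst. Qed.

Lemma cvg_prod2 (T : Type) (S1 S2 : topologicalType) (G : set_system T)
    (f : T -> S1 * S2) (l : S1 * S2) :
  f @ G --> l -> (fun a => (f a).2) @ G --> l.2.
Proof. by move=> fl; apply: (cvg_comp _ _ fl); case: l {fl} => ? ?; exact: cvg_snd. Qed.

End Ultralimits.

Section Attractor.
Context {R : realType} {m : nat} {r : {posnum R}} {Omega : metricType R}.
Context {sigma : R -> Omega -> Omega} {B : 'M[R]_m}.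
Context {F : Omega -> CX m r -> 'cV[R]_m}.
Hypothesis H : sublinear_system sigma B F.
Context {psi0 : XL m r}.
Hypothesis psi0_gt : gtB0 B psi0.
Local Notation V := 'cV[R]_m.
Local Notation X := (CX m r).
Local Notation segment := (@segment R m r).
Local Notation segmentL := (@segmentL R m r).
Local Notation bounded_orbit := (@bounded_orbit R m r Omega sigma B F psi0).
Local Notation entire_orbit := (@entire_orbit R m r Omega sigma B F psi0).
Local Notation near0 c p q := (part_near B c (segment p 0) (segment q 0)).
Local Notation E := (omega_limits sigma F B).
Let psi0_KB : KB B psi0 := gtB0_KB psi0_gt.
Context {c0 : R}.
Hypothesis c0_ge1 : 1 <= c0.
Hypothesis base_orbits : forall w, exists z, entire_orbit c0 w z.
Let c0_gt0 : 0 < c0 := lt_le_trans ltr01 c0_ge1.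

Lemma gtB0_part_near (phi : XL m r) : gtB0 B phi ->
  exists2 c, 1 <= c & part_near B c psi0 phi.
Proof.
move=> phi_gt; have [k k0 kP] := gtB0_absorbing psi0_gt.
have [l l0 lP] := gtB0_absorbing phi_gt.
pose c := 1 + (k * `|phi| + l * `|psi0|).
have h1 : 0 <= k * `|phi| by apply: mulr_ge0 => //; exact: ltW.
have h2 : 0 <= l * `|psi0| by apply: mulr_ge0 => //; exact: ltW.
have c1 : 1 <= c by rewrite lerDl addr_ge0.
exists c => //; have c_gt0 : 0 < c by apply: lt_le_trans c1.
split.
  have lc : l * `|psi0| <= c by rewrite /c addrA lerDr addr_ge0.
  have h := leB_trans (lP psi0) (leB_scale (gtB0_KB phi_gt) lc).
  have ci : 0 <= c^-1 by rewrite invr_ge0 ltW.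
  by have := leBZ ci h; rewrite (scalerK (lt0r_neq0 c_gt0)).
apply: leB_trans (kP phi) _; apply: leB_scale => //.
by rewrite /c addrCA lerDl addr_ge0.
Qed.

(** At time [0] the base orbit is within [c0] of [psi0], hence within [c0 * c] of [phi]; that
    distance persists forward, and one more factor [c0] returns to [psi0]. *)
Lemma orbit_from w c (phi : X) : 1 <= c -> part_near B c psi0 phi ->
  exists2 y, bounded_orbit 0 (c0 * (c0 * c)) w y & segment y 0 = phi.
Proof.
move=> c1 pphi; have c_gt0 : 0 < c by apply: lt_le_trans c1.
have [z ez] := base_orbits w.
have cc1 : 1 <= c0 * c by rewrite (le_trans c1)// ler_peMl// ltW.
apply: (orbit_exists H psi0_KB c0_gt0 cc1 (ez 0)).
have [_ pz] := ez 0.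
exact: (part_near_trans c0_gt0 c_gt0 (part_near_sym c0_gt0 (pz 0 (lexx 0))) pphi).
Qed.

Lemma entire_sol_segmentL C w y t : 0 < C -> entire_orbit C w y -> 0 <= t ->
  sol_segmentL sigma F t w (segmentL y 0) = segmentL y t.
Proof.
move=> C0 ey t0; have [sy _] := ey 0.
exact: (sol_segmentL_solves H sy (esym (entire_segmentL H psi0_gt 0 C0 ey)) t0).
Qed.

(** Translating a forward orbit by [t_ n] pushes its starting time to [-oo], so the limit along an
    ultrafilter is entire. *)
Lemma omega_limits_entire w phi : E (w, phi) ->
  exists C y, [/\ 1 <= C, entire_orbit C w y & segmentL y 0 = phi].
Proof.
move=> [w1 [phi1 [phi1_gt [t_ [_ _ tinf lim]]]]].
have [c c1 cphi] := gtB0_part_near phi1_gt.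
have [y oy y0] := orbit_from w1 c1 cphi.
set C := c0 * (c0 * c) in oy.
have C1 : 1 <= C by rewrite /C !mulr_ege1.
have C0 : 0 < C by apply: lt_le_trans C1.
have [U [UU oU]] := nat_ultrafilter.
have w_cvg : (fun n => sigma (t_ n) w1) @ U --> w.
  have h : (fun n => (skew_product sigma F (t_ n) (w1, phi1)).1) @ \oo --> w.
    exact: cvg_prod1 lim.
  by move=> A /h; exact: oU.
have phi_cvg : (fun n => sol_segmentL sigma F (t_ n) w1 phi1) @ U --> phi.
  have h : (fun n => (skew_product sigma F (t_ n) (w1, phi1)).2) @ \oo --> phi.
    exact: cvg_prod2 lim.
  by move=> A /h; exact: oU.
have t_large a : \forall n \near U, a <= t_ n.
  by move/cvgryPge : tinf => /(_ a)/oU.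
have on a : \forall n \near U,
    bounded_orbit a C (sigma (t_ n) w1) (fun s => y (t_ n + s)).
  apply: filterS (t_large (- a)) => n tn.
  apply: (orbit_le psi0_KB _ C0 (lexx C) (orbit_shift H (t_ n) oy)).
  by rewrite sub0r lerNl.
have [ex _ cx] := orbit_ulim H psi0_KB UU C0 w_cvg on.
exists C, (ulim U (fun n s => y (t_ n + s))); split; [exact: C1|exact: ex|].
apply: cvg_unique (cx 0) _; first exact: norm_hausdorff.
apply: cvg_trans phi_cvg; apply: near_eq_cvg.
apply: filterS (t_large 0) => n tn.
rewrite (sol_segmentL_solves H oy.1 y0 tn).
by apply: esym; rewrite segmentL_shift addr0.
Qed.

(** By recurrence the point belongs to its own omega-limit set, so it serves as the initial datum
    itself. *)
Lemma entire_omega_limits C w y : 0 < C -> entire_orbit C w y ->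
  E (w, segmentL y 0).
Proof.
move=> C0 ey.
have ball_gt0 n : (0 : R) < n.+1%:R^-1 by rewrite invr_gt0.
have /choice[next nextP] : forall nT : nat * R, exists t, [/\ nT.2 <= t,
    ball w nT.1.+1%:R^-1 (sigma t w) &
    `|segmentL y t - segmentL y 0| < nT.1.+1%:R^-1].
  move=> [n T] /=.
  have [t [Tt Dt yt]] := entire_orbit_recurrent H psi0_gt T C0 ey (ball_gt0 n)
    (nbhsx_ballx w _ (ball_gt0 n)).
  by exists t; split; [exact: Tt|exact: Dt|exact: yt].
(* Asking for a return after [t_ n' + 1] makes the times increase to infinity, while the tolerances
   tend to [0]. *)
pose t_ := fix t_ n := if n is n'.+1 then next (n, t_ n' + 1) else next (0%N, 0).
have tS n : t_ n + 1 <= t_ n.+1 by have [] := nextP (n.+1, t_ n + 1).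
have tn n : n%:R <= t_ n.
  elim: n => [|n IH]; first by have [] := nextP (0%N, 0).
  by apply: le_trans (tS n); rewrite -natr1 lerD2r.
have t0 n : 0 <= t_ n by apply: le_trans (tn n).
have tP n : ball w n.+1%:R^-1 (sigma (t_ n) w) /\
    `|segmentL y (t_ n) - segmentL y 0| < n.+1%:R^-1.
  by case: n => [|n]; [have [_ h1 h2] := nextP (0%N, 0)|
    have [_ h1 h2] := nextP (n.+1, t_ n + 1)]; split; [exact: h1|exact: h2|exact: h1|exact: h2].
have small e : 0 < e -> \forall n \near \oo, (n.+1%:R^-1 : R) < e.
  by move=> e0; exact: near_infty_natSinv_lt (PosNum e0).
exists w, (segmentL y 0); split.
  have [_ py] := ey 0; have [ge _] := py 0 (lexx 0).
  apply: (gtB0_add (c := C^-1) _ psi0_gt); first by rewrite invr_gt0.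
  by rewrite (entire_segmentL H psi0_gt 0 C0 ey).
exists t_; split.
- exact: t0.
- by apply/nondecreasing_seqP => n; apply: le_trans (tS n); rewrite lerDl.
- apply/cvgryPge => A; near=> n; apply: le_trans (tn n).
  near: n; exact: nbhs_infty_ger.
- apply: cvg_prod.
    apply/cvg_ballP => e /small; apply: filterS => n ne.
    by apply: le_ball (tP n).1; exact: ltW.
  apply/cvgrPdist_lt => e /small; apply: filterS => n ne.
  rewrite distrC /= (entire_sol_segmentL C0 ey (t0 n)).
  exact: lt_trans (tP n).2 ne.
Unshelve. all: by end_near. Qed.

(** The radius [C] of an orbit through a point of [E] is not controlled a priori. As its distance to
    the base orbit is constant, the value at time [0] bounds it on the whole line. *)
Lemma omega_limits_uniform w c (phi : XL m r) : 1 <= c -> E (w, phi) ->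
  part_near B c psi0 phi ->
  exists2 y, entire_orbit (c0 * (c0 * c)) w y & segmentL y 0 = phi.
Proof.
move=> c1 /omega_limits_entire[C [y [C1 ey y0]]] pphi.
have c_gt0 : 0 < c by apply: lt_le_trans c1.
have C0 : 0 < C by apply: lt_le_trans C1.
have [z ez] := base_orbits w.
(* Constancy of the distance is stated for two orbits in a common part ball. *)
pose C' := Num.max C c0.
have C'0 : 0 < C' by rewrite lt_max C0.
have CC' : C <= C' by rewrite le_max lexx.
have c0C' : c0 <= C' by rewrite le_max lexx orbT.
have ey' := entire_orbit_le psi0_KB C0 CC' ey.
have ez' := entire_orbit_le psi0_KB c0_gt0 c0C' ez.
have cc1 : 1 <= c0 * c by rewrite mulr_ege1.
have cc0 : 0 < c0 * c by apply: lt_le_trans cc1.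
have pz t : part_near B c0 psi0 (segment z t) by have [_ /(_ t (lexx t))] := ez t.
have zy0 : near0 (c0 * c) z y.
  apply: (part_near_trans c0_gt0 c_gt0 (part_near_sym c0_gt0 (pz 0))).
  by rewrite -(entire_segmentL H psi0_gt 0 C0 ey) y0.
exists y; last exact: y0.
move=> a; split; first by case: (ey a).
move=> t _; apply: (part_near_trans c0_gt0 cc0 (pz t)).
exact: (part_distance_constant H psi0_gt t C'0 cc1 ez' ey' zy0).
Qed.

(** The translation limits [h_ i] carry orbits over [w] to orbits over [w_ i], and their limit [h],
    back over [w], is an expansion. Hence [x] is close to some [iter k h x] with [k > 0], which the
    images of [iter k.-1 h x] under [h_ i] approximate. *)
Lemma entire_orbit_lsc (T : Type) (U : set_system T) (w_ : T -> Omega)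
    (w : Omega) C x e : UltraFilter U -> 0 < C -> w_ @ U --> w ->
  entire_orbit C w x -> 0 < e ->
  \forall i \near U, exists2 y, entire_orbit C (w_ i) y &
    `|segmentL y 0 - segmentL x 0| < e.
Proof.
move=> UU C0 ww ex e0.
have /choice[W WP] : forall i, exists W : set_system R,
    UltraFilter W /\ (fun t => sigma t w) @ W --> w_ i.
  by move=> i; have [W [UW _ Ww]] := forward_ultrafilter H w (w_ i); exists W.
pose h_ i (y : R -> V) : R -> V := translation_limit (W i) y.
pose h y := ulim U (fun i => h_ i y).
have h_E i y : entire_orbit C w y -> entire_orbit C (w_ i) (h_ i y).
  by move=> ey; have [UW Ww] := WP i; have [] := translation_limitP H psi0_gt UW C0 Ww ey.
have hP y : entire_orbit C w y -> entire_orbit C w (h y) /\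
    (fun i => segmentL (h_ i y) 0) @ U --> segmentL (h y) 0.
  move=> ey; have [ehy _ chy] := orbit_ulim H psi0_KB UU C0 ww
    (fun a => @filterE _ U _ _ (fun i => h_E i y ey a)).
  by split; [exact: ehy|exact: chy].
have hE y : entire_orbit C w y -> entire_orbit C w (h y) by move=> /hP[].
have hX p q c : entire_orbit C w p -> entire_orbit C w q -> 1 <= c ->
    near0 c (h p) (h q) -> near0 c p q.
  move=> ep eq_ c1 pq; have c_gt0 : 0 < c by apply: lt_le_trans c1.
  have [ehp chp] := hP p ep; have [ehq chq] := hP q eq_.
  apply: (part_near_closed c_gt0) => c' cc'.
  have : \forall i \near U,
      part_near B c' (segmentL (h_ i p) 0) (segmentL (h_ i q) 0).
    exact: (cvg_part_near2 H psi0_gt _ C0 c1 cc' ehp ehq chp chq pq).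
  move=> /filter_ex[i].
  move=> /(entire_part_near H psi0_gt C0 (h_E i p ep) (h_E i q eq_)) pqi.
  have [UW Ww] := WP i; have c'1 : 1 <= c' := ltW (le_lt_trans c1 cc').
  exact: (translation_limit_expansion H psi0_gt UW C0 c'1 Ww ep eq_ pqi).
have e2 : 0 < e / 2 by rewrite divr_gt0.
have [k k0 xk] := expansion_recurrent_XL H psi0_gt C0 hE hX ex e2.
have ek := iter_entire hE k.-1 ex.
have [_ ck] := hP _ ek.
move/cvgrPdist_lt : ck => /(_ _ e2); apply: filterS => i xi.
exists (h_ i (iter k.-1 h x)); first exact: h_E.
have E1 : iter k h x = h (iter k.-1 h x) by rewrite -iterS (prednK k0).
rewrite -(subrK (segmentL (iter k h x) 0) (segmentL (h_ i _) 0)) -addrA.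
apply: le_lt_trans (ler_normD _ _) _; rewrite [ltRHS]splitr.
by apply: ltrD xk; rewrite distrC E1; exact: xi.
Qed.

Lemma ultra_base (T : Type) (U : set_system T) (w_ : T -> Omega) :
  UltraFilter U -> exists w : Omega, w_ @ U --> w.
Proof.
move=> UU.
have [|w _ ww] := @compact_ultra_cvg T Omega setT w_ U UU (system_compact H).
  by apply: filterE.
by exists w.
Qed.

(** A failure at arbitrarily late times yields an entire limit [x] over a limit of the base points.
    Closeness to [x] is not enough, as the section varies with the base: lower semicontinuity
    provides an orbit over [sigma (t_ n) (w_ n)] itself. *)
Lemma uniform_attraction c e : 1 <= c -> 0 < e -> exists T : R,
  forall t w (phi : XL m r), T <= t -> part_near B c psi0 phi ->
  exists2 x, E (sigma t w, x) & `|sol_segmentL sigma F t w phi - x| < e.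
Proof.
move=> c1 e0; apply: contrapT => nT.
have /choice[f fP] : forall n : nat, exists a : R * Omega * XL m r,
    [/\ n%:R <= a.1.1, part_near B c psi0 a.2 &
    forall x, E (sigma a.1.1 a.1.2, x) ->
      ~ `|sol_segmentL sigma F a.1.1 a.1.2 a.2 - x| < e].
  move=> n; apply: contrapT => nE; apply: nT; exists n%:R => t w phi nt pphi.
  apply: contrapT => nx; apply: nE; exists (t, w, phi); split=> //= x Ex xe.
  by apply: nx; exists x.
pose t_ n := (f n).1.1; pose w_ n := (f n).1.2; pose phi_ n := (f n).2.
have tn n : n%:R <= t_ n by have [] := fP n.
have t0 n : 0 <= t_ n by apply: le_trans (tn n).
have /choice[y yP] : forall n, exists y, bounded_orbit 0 (c0 * (c0 * c)) (w_ n) y /\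
    segment y 0 = phi_ n.
  by move=> n; have [_ pn _] := fP n; have [y] := orbit_from (w_ n) c1 pn; exists y.
set C := c0 * (c0 * c) in yP.
have C1 : 1 <= C by rewrite /C !mulr_ege1.
have C0 : 0 < C by apply: lt_le_trans C1.
have [U [UU oU]] := nat_ultrafilter.
have [w ww] := ultra_base (fun n => sigma (t_ n) (w_ n)) UU.
have on a : \forall n \near U,
    bounded_orbit a C (sigma (t_ n) (w_ n)) (fun s => y n (t_ n + s)).
  have : \forall n \near U, - a <= n%:R.
    by apply: oU; exact: nbhs_infty_ger.
  apply: filterS => n an.
  apply: (orbit_le psi0_KB _ C0 (lexx C) (orbit_shift H (t_ n) (yP n).1)).
  by rewrite sub0r lerNl (le_trans an).
have [ex _ cx] := orbit_ulim H psi0_KB UU C0 ww on.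
have e2 : 0 < e / 2 by rewrite divr_gt0.
have h1 := entire_orbit_lsc UU C0 ww ex e2.
set x := ulim U _ in ex cx h1.
have h2 : \forall n \near U, `|segmentL x 0 - segmentL (fun s => y n (t_ n + s)) 0| < e / 2.
  by move/cvgrPdist_lt : (cx 0) => /(_ _ e2).
have /filter_ex[n [[z ez zx] yx]] : \forall n \near U,
    (exists2 z, entire_orbit C (sigma (t_ n) (w_ n)) z &
      `|segmentL z 0 - segmentL x 0| < e / 2) /\
    `|segmentL x 0 - segmentL (fun s => y n (t_ n + s)) 0| < e / 2.
  exact: filterI h1 h2.
have [_ _ far] := fP n.
apply: (far _ (entire_omega_limits C0 ez)).
have -> : sol_segmentL sigma F (f n).1.1 (f n).1.2 (f n).2 =
    segmentL (fun s => y n (t_ n + s)) 0.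
  rewrite segmentL_shift addr0.
  exact: (sol_segmentL_solves H (yP n).1.1 (yP n).2 (t0 n)).
rewrite -(subrK (segmentL x 0) (segmentL (fun s => _) 0)) -addrA.
apply: le_lt_trans (ler_normD _ _) _; rewrite [ltRHS]splitr.
by apply: ltrD; rewrite distrC; [exact: yx|exact: zx].
Qed.

Lemma omega_limits_gtB0 p : E p -> gtB0 B p.2.
Proof.
case: p => w phi /omega_limits_entire[C [y [C1 ey <-]]] /=.
have C0 : 0 < C by apply: lt_le_trans C1.
have [_ py] := ey 0; have [ge _] := py 0 (lexx 0).
apply: (gtB0_add (c := C^-1) _ psi0_gt); first by rewrite invr_gt0.
by rewrite (entire_segmentL H psi0_gt 0 C0 ey).
Qed.

Lemma omega_limits_invariant t : 0 <= t -> skew_product sigma F t @` E = E.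
Proof.
move=> t0; apply/seteqP; split=> [_ [[w phi] Ep <-]|[w phi] Ep].
  have [C [y [C1 ey <-]]] := omega_limits_entire Ep.
  have C0 : 0 < C by apply: lt_le_trans C1.
  rewrite /skew_product /= (entire_sol_segmentL C0 ey t0).
  have := entire_omega_limits C0 (entire_orbit_shift H t ey).
  by rewrite segmentL_shift addr0.
have [C [y [C1 ey <-]]] := omega_limits_entire Ep.
have C0 : 0 < C by apply: lt_le_trans C1.
have ey' := entire_orbit_shift H (- t) ey.
exists (sigma (- t) w, segmentL (fun s => y (- t + s)) 0).
  exact: entire_omega_limits C0 ey'.
rewrite /skew_product /= (entire_sol_segmentL C0 ey' t0).
by rewrite -(flowD H) addNr (flow0 H) segmentL_shift addNr.
Qed.

(** Compactness of orbits needs one radius for all of them, and [E] has such a radius only locally.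
    The neighbourhood is chosen inside the part ball of factor [2] about [phi]. *)
Lemma omega_limits_nbhs w phi : E (w, phi) -> exists C e, [/\ 1 <= C, 0 < e &
  forall w' phi', E (w', phi') -> `|phi' - phi| <= e ->
  exists2 y, entire_orbit C w' y & segmentL y 0 = phi'].
Proof.
move=> /omega_limits_gtB0/= phi_gt.
have [c c1 [phi_ge phi_le]] := gtB0_part_near phi_gt.
have c_gt0 : 0 < c by apply: lt_le_trans c1.
have [|e e0 eP] := @XL_part_near _ _ _ B _ psi0_gt phi c 2 c_gt0 phi_ge.
  by rewrite ltr1n.
have c2 : 1 <= c * 2 by rewrite mulr_ege1// ler1n.
exists (c0 * (c0 * (c * 2))), e; split=> [|//|w' phi' Ep' pe].
  by rewrite !mulr_ege1// ler1n.
apply: (omega_limits_uniform c2 Ep').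
by apply: (part_near_trans c_gt0 _ _ (eP phi' pe)); [exact: ltr0n|split].
Qed.

(** Over a small closed ball in the second component the orbits share one part ball. An ultrafilter
    there converges together with its orbits, and the limit, lying on an entire orbit, is again in
    [E]. *)
Lemma omega_limits_locally_compact : locally_compact [set: set_type E].
Proof.
move=> p _; pose w := (val p).1; pose phi : XL m r := (val p).2.
have Ep : E (w, phi) by rewrite -surjective_pairing; exact: set_mem (valP p).
have [C [e [C1 e0 CeP]]] := omega_limits_nbhs Ep.
have C0 : 0 < C by apply: lt_le_trans C1.
pose dist (q : set_type E) : R := `|(val q).2 - phi|.
have c2 (q : set_type E) : (fun q : set_type E => (val q).2) @ q --> (val q).2.
  by apply: cvg_prod2; exact: initial_continuous.
have cdist : continuous dist.
  move=> q; apply: (@cvg_comp _ _ _ (fun q : set_type E => (val q).2)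
    (fun x => `|x - phi|) _ _ _ (c2 q)).
  apply: cvg_norm; apply: cvgB; [exact: cvg_id|exact: cvg_cst].
pose K : set (set_type E) := [set q | dist q <= e].
have closedK : closed K.
  have h : {in ~` (dist @^-1` [set x : R | x <= e]), continuous dist}.
    by move=> q _; exact: cdist.
  have h2 : closed [set x : R | x <= e] by exact: closed_le.
  have h3 := preimage_closed h h2.
  exact: h3.
exists K.
  rewrite /within /=.
  have : \forall q \near p, dist q < e.
    move/cvgrPdist_lt : (cdist p) => /(_ e e0); apply: filterS => q.
    have -> : dist p = 0 by rewrite /dist subrr normr0.
    by rewrite sub0r normrN normr_id.
  by apply: filterS => q qe _; exact: ltW.
split; last exact: closedK.
rewrite compact_ultra => G UG GK.
have /choice[Y YP] : forall q : set_type E, exists y, K q ->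
    entire_orbit C (val q).1 y /\ segmentL y 0 = (val q).2.
  move=> q; have [Kq|nKq] := pselect (K q); last by exists (fun=> 0).
  have Eq : E ((val q).1, (val q).2).
    by rewrite -surjective_pairing; exact: set_mem (valP q).
  by have [y ey y0] := CeP _ _ Eq Kq; exists y.
have [w1 ww] := ultra_base (fun q : set_type E => (val q).1) UG.
have oY a : \forall q \near G, bounded_orbit a C (val q).1 (Y q).
  by apply: filterS GK => q /YP[eq_ _]; exact: eq_.
have [ex _ cx] := orbit_ulim H psi0_KB UG C0 ww oY.
set x := ulim G Y in ex cx.
have Ex := entire_omega_limits C0 ex.
pose q : set_type E := exist _ (w1, segmentL x 0) (mem_set Ex).
have Gq : G --> q.
  apply: set_type_cvg.
  rewrite (_ : (fun q : set_type E => val q) = fun q => ((val q).1, (val q).2)).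
    apply: cvg_prod; first exact: ww.
    apply: cvg_trans (cx 0); apply: near_eq_cvg.
    by apply: filterS GK => q' /YP[_ ->].
  by apply/funext => q'; rewrite -surjective_pairing.
exists q; split; last exact: Gq.
apply: closedK => A qA.
have GKA : G (K `&` A) by exact: (filterI GK (Gq A qA)).
exact: filter_ex GKA.
Qed.

(** Along an ultrafilter the moving data converge with their whole orbits. Shifting these by the
    moving time gives another bounded family, whose limit at [0] is again in the Lipschitz norm. *)
Lemma omega_limits_continuous_at (t : R) (w : Omega) (phi : XL m r) : 0 <= t -> E (w, phi) ->
  skew_product sigma F q.1 q.2 @[q --> within
    [set q : R * (Omega * XL m r) | 0 <= q.1 /\ E q.2] (nbhs (t, (w, phi)))] -->
  skew_product sigma F t (w, phi).
Proof.
move=> t0 Ep.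
have [C [e [C1 e0 CeP]]] := omega_limits_nbhs Ep.
have C0 : 0 < C by apply: lt_le_trans C1.
apply: ultra_cvg => U UU GU.
have UD : \forall q \near U, 0 <= q.1 /\ E q.2.
  by apply: GU; apply: withinT.
have Ux : (fun q : R * (Omega * XL m r) => q) @ U --> (t, (w, phi)).
  move=> A xA; apply: GU; rewrite /within /=.
  by apply: filterS xA => q Aq _.
have tt : (fun q : R * (Omega * XL m r) => q.1) @ U --> t.
  exact: cvg_prod1 Ux.
have ww : (fun q : R * (Omega * XL m r) => q.2.1) @ U --> w.
  exact: cvg_prod1 (cvg_prod2 Ux).
have pp : (fun q : R * (Omega * XL m r) => q.2.2) @ U --> phi.
  exact: cvg_prod2 (cvg_prod2 Ux).
pose good (q : R * (Omega * XL m r)) (y : R -> V) :=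
  entire_orbit C q.2.1 y /\ segmentL y 0 = q.2.2.
have /choice[Y YP] : forall q : R * (Omega * XL m r), exists y,
    E q.2 -> `|q.2.2 - phi| <= e -> good q y.
  move=> [t' [w' phi']] /=.
  have [[Eq qe]|nq] := pselect (E (w', phi') /\ `|phi' - phi| <= e).
    by have [y ey y0] := CeP _ _ Eq qe; exists y.
  by exists (fun=> 0) => Eq qe; exfalso; apply: nq.
have UY : \forall q \near U, 0 <= q.1 /\ good q (Y q).
  have ne : \forall q \near U, `|phi - q.2.2| <= e.
    by move/cvgrPdist_le : pp => /(_ e e0).
  apply: filterS2 UD ne => q [q0 Eq] qe; split; first exact: q0.
  by apply: YP => //; rewrite distrC.
have oY a : \forall q \near U, bounded_orbit a C q.2.1 (Y q).
  by apply: filterS UY => q [_ [eq_ _]]; exact: eq_.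
have [ex jx cx] := orbit_ulim H psi0_KB UU C0 ww oY.
set x := ulim U Y in ex jx cx.
have x0 : segmentL x 0 = phi.
  apply: cvg_unique (cx 0) _; first exact: norm_hausdorff.
  apply: cvg_trans pp; apply: near_eq_cvg.
  by apply: filterS UY => q [_ [_ ->]].
have wt : (fun q : R * (Omega * XL m r) => sigma q.1 q.2.1) @ U --> sigma t w.
  exact: (sigma_cvg H).
have oY' a : \forall q \near U, bounded_orbit a C (sigma q.1 q.2.1)
    (fun s => Y q (q.1 + s)).
  by apply: filterS UY => q [_ [eq_ _]]; exact: (entire_orbit_shift H q.1 eq_ a).
have [eu ju cu] := orbit_ulim H psi0_KB UU C0 wt oY'.
set u := ulim U _ in eu ju cu.
(* The two limits agree because convergence to [x] is joint in index and time, which lets the shift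
   [q.1] move. *)
have uE s : u s = x (t + s).
  have cu' := joint_cvg_pointwise _ (ju s).
  apply: cvg_unique (cu' _) _; first exact: norm_hausdorff.
  apply/cvgrPdist_lt => d d0.
  have [[A D] /= [UA tD] AD] := jx (t + s) d d0.
  have ts : (fun q : R * (Omega * XL m r) => q.1 + s) @ U --> t + s.
    by apply: cvgD; [exact: tt|exact: cvg_cst].
  apply: filterS2 UA (ts _ tD) => q Aq Dq.
  by rewrite distrC; apply: (AD (q, q.1 + s)).
have uxE : segmentL u 0 = segmentL x t.
  have -> : u = fun s => x (t + s) by apply/funext; exact: uE.
  by rewrite segmentL_shift addr0.
rewrite /skew_product /= -x0 (entire_sol_segmentL C0 ex t0).
apply: cvg_prod; first exact: wt.
rewrite -uxE; apply: cvg_trans (cu 0); apply: near_eq_cvg.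
apply: filterS UY => q [q0 [eq_ <-]].
rewrite segmentL_shift addr0.
exact: (esym (entire_sol_segmentL C0 eq_ q0)).
Qed.

Lemma omega_limits_continuous :
  {within [set q : R * (Omega * XL m r) | 0 <= q.1 /\ E q.2],
    continuous (fun q => skew_product sigma F q.1 q.2)}.
Proof.
apply/subspace_continuousP => -[t [w phi]] [t0 Ep].
exact: omega_limits_continuous_at.
Qed.

End Attractor.

(** * From the persistent trajectory to entire orbits over every base point *)

Section BaseOrbits.
Context {R : realType} {m : nat} {r : {posnum R}} {Omega : metricType R}.
Context {sigma : R -> Omega -> Omega} {B : 'M[R]_m}.
Context {F : Omega -> CX m r -> 'cV[R]_m}.
Hypothesis H : sublinear_system sigma B F.
Context {psi0 : XL m r}.
Hypothesis psi0_gt : gtB0 B psi0.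
Local Notation V := 'cV[R]_m.
Local Notation segment := (@segment R m r).
Local Notation solves := (@solves R m r Omega sigma F).
Local Notation bounded_orbit := (@bounded_orbit R m r Omega sigma B F psi0).
Local Notation entire_orbit := (@entire_orbit R m r Omega sigma B F psi0).

(** Before [0] the datum gives a Lipschitz constant, after [0] a bound of [F] does; their sum also
    covers pairs straddling [0]. *)
Lemma solution_lipschitz (w : Omega) (phi : XL m r) (z : R -> V) (K : R) :
  solves 0 w z -> segment z 0 = phi ->
  (forall t, 0 <= t -> `|segment z t| <= K) ->
  exists2 M : R, 0 <= M & forall s t : R, - r%:num <= s -> - r%:num <= t ->
    `|z t - z s| <= M * `|t - s|.
Proof.
move=> sz z0 zK; have [M M0 MP] := F_norm_bound H K.
pose L := lip_const phi; have L0 : 0 <= L := lip_const_ge0 phi.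
have zM s t : 0 <= s -> 0 <= t -> `|z t - z s| <= M * `|t - s|.
  apply: (solves_lipschitz M0 sz) => u u0; apply: MP; exact: zK.
have zL s t : - r%:num <= s -> s <= 0 -> - r%:num <= t -> t <= 0 ->
    `|z t - z s| <= L * `|t - s|.
  have zphi u : - r%:num <= u -> u <= 0 -> exists2 u' : delay_itv r,
      val u' = u & z u = phi u'.
    move=> ru u0; have uI : u \in (`[- r%:num, 0]%classic : set R).
      by rewrite inE /= in_itv /= ru u0.
    exists (exist _ u uI) => //; rewrite -z0 segmentE ?add0r//.
    by case: sz.
  move=> rs s0 rt t0.
  have [s' <- ->] := zphi s rs s0; have [t' <- ->] := zphi t rt t0.
  exact: XL_lipschitz.
suff lip_le (s t : R) : s <= t -> - r%:num <= s -> - r%:num <= t ->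
    `|z t - z s| <= (L + M) * `|t - s|.
  exists (L + M) => [|s t rs rt]; first exact: addr_ge0.
  have /orP[st|ts] := le_total s t; first exact: lip_le.
  by rewrite distrC [`|t - s|]distrC; exact: lip_le.
move=> st rs rt; have [t0|/ltW t0] := lerP t 0.
  apply: le_trans (zL s t rs (le_trans st t0) rt t0) _.
  by rewrite ler_wpM2r// lerDl.
have [s0|/ltW s0] := lerP 0 s.
  apply: le_trans (zM s t s0 t0) _.
  by rewrite ler_wpM2r// lerDr.
have r0 : - r%:num <= 0 :> R by rewrite oppr_le0.
rewrite -(subrK (z 0) (z t)) -addrA.
apply: le_trans (ler_normD _ _) _.
have h1 := zM 0 t (lexx 0) t0; have h2 := zL s 0 rs s0 r0 (lexx 0).
apply: le_trans (lerD h1 h2) _; rewrite subr0 sub0r normrN.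
rewrite (ger0_norm t0) (ler0_norm s0) ger0_norm ?subr_ge0//.
rewrite mulrDl addrC; apply: lerD; apply: ler_wpM2l => //.
  by rewrite lerDr.
by rewrite lerDl oppr_ge0.
Qed.

(** A sup-norm bound yields no upper order bound by itself. With the Lipschitz estimate the segments
    have Lipschitz norm at most [K + M], and [psi0] is an order unit for that norm. *)
Lemma persistent_bounded_orbit (w : Omega) (phi : XL m r) (z : R -> V) (K : R) :
  solves 0 w z -> segment z 0 = phi ->
  (forall t, 0 <= t -> `|segment z t| <= K) ->
  (forall t, 0 <= t -> leB B psi0 (segment z t)) ->
  exists2 c, 1 <= c & bounded_orbit 0 c w z.
Proof.
move=> sz z0 zK psiz; have [M M0 zM] := solution_lipschitz sz z0 zK.
have [k k0 kP] := gtB0_absorbing psi0_gt.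
have psi0_KB := gtB0_KB psi0_gt.
have K0 : 0 <= K by apply: le_trans (zK 0 (lexx 0)).
have kKM : 0 <= k * (K + M) by apply: mulr_ge0; [exact: ltW|exact: addr_ge0].
have [cz _] := sz.
have c1 : 1 <= 1 + k * (K + M) by rewrite lerDl.
exists (1 + k * (K + M)); first exact: c1.
split; first exact: sz.
move=> t t0.
have lip s u : t - r%:num <= s <= t -> t - r%:num <= u <= t ->
    `|z u - z s| <= M * `|u - s|.
  have rt : - r%:num <= t - r%:num by rewrite lerDr.
  by move=> /andP[ts _] /andP[tu _]; apply: zM; [exact: le_trans rt ts|exact: le_trans rt tu].
have segE := segmentLE cz lip.
have nrm : `|segmentL z t : XL m r| <= K + M.
  apply: (XL_norm_le M0) => [s|s u].
    apply: le_trans (CXnorm_ge (val (segmentL z t)) s) _.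
    by rewrite segE; exact: zK.
  rewrite -[XLfun _]/(val (segmentL z t)) segE !segmentE//.
  rewrite (_ : val u - val s = t + val u - (t + val s)); last first.
    by rewrite opprD addrACA subrr add0r.
  by apply: lip; [have := delay_itv_bounds s|have := delay_itv_bounds u]; lra.
split.
  apply: leB_trans (psiz t t0); rewrite -[X in leB _ _ X](scale1r (val psi0)).
  by apply: (leB_scale psi0_KB); rewrite invf_le1// (lt_le_trans _ c1).
rewrite -segE; apply: leB_trans (kP _) _; apply: (leB_scale psi0_KB).
apply: (@le_trans _ _ (k * (K + M))); last by rewrite lerDr.
by rewrite ler_wpM2l// ltW.
Qed.

(** Minimality brings the forward orbit of [w] close to any [w'] at arbitrarily late times, so the
    translated orbits start ever earlier. *)
Lemma entire_orbit_over c w z : 1 <= c -> bounded_orbit 0 c w z ->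
  forall w', exists y, entire_orbit c w' y.
Proof.
move=> c1 oz w'; have c0 : 0 < c := lt_le_trans ltr01 c1.
have [U [UU U_large Uw]] := forward_ultrafilter H w w'.
have oy a : \forall t \near U, bounded_orbit a c (sigma t w) (fun s => z (t + s)).
  apply: filterS (U_large (- a)) => t ta.
  apply: (orbit_le (gtB0_KB psi0_gt) _ c0 (lexx c) (orbit_shift H t oz)).
  by rewrite sub0r lerNl.
have [ey _ _] := orbit_ulim H (gtB0_KB psi0_gt) UU c0 Uw oy.
by exists (ulim U (fun t s => z (t + s))).
Qed.

(* The default segment 0 of a non-existent solution cannot dominate an
   interior point of the cone. *)
Lemma persistent_solution (w : Omega) (phi : XL m r) : (0 < m)%N ->
  leB B psi0 (sol_segment sigma F 0 w phi) ->
  exists2 z, solves 0 w z & segment z 0 = phi.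
Proof.
move=> m0 psi_le; have [[y sy]|ny] := pselect (exists y, is_solution sigma F w phi y).
  by have [z [sz z0 _]] := is_solution_solves sy; exists z.
have sol0 : solution sigma F w phi = fun=> 0.
  by rewrite /solution xgetPN// => y sy; apply: ny; exists y.
have cst0 : continuous (fun _ : R => 0 : V) by move=> t; exact: cvg_cst.
have seg0 : sol_segment sigma F 0 w phi = 0.
  by rewrite /sol_segment sol0; apply: CX_ext => s; rewrite segmentE.
rewrite seg0 in psi_le.
have [k k0 kP] := gtB0_absorbing psi0_gt.
(* The constant function one gives the contradiction: below a multiple of [psi0] it would be
   nonpositive, and [m0] provides a coordinate to test. *)
pose chi : XL m r := segmentL (fun=> const_mx 1) 0.
have cst1 : continuous (fun _ : R => const_mx 1 : V) by move=> t; exact: cvg_cst.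
have chiE : val chi = segment (fun=> const_mx 1) 0.
  by apply: (@segmentLE _ _ _ _ _ 0 cst1) => s u _ _; rewrite subrr normr0 mul0r.
have kchi : 0 <= k * `|chi| by apply: mulr_ge0 => //; exact: ltW.
have := leB_trans (kP chi) (leBZ kchi psi_le); rewrite scaler0 => -[].
move=> /(_ (delay_itv0 r) (Ordinal m0)).
rewrite sub0r -[XLfun _]/(val chi) chiE.
rewrite -[CXfun _ _]/(- (segment (fun=> const_mx 1) 0 (delay_itv0 r))).
by rewrite segmentE// !mxE oppr_ge0 ler10.
Qed.

End BaseOrbits.

(** Nonemptiness of [Y1] matters: an empty supremum is [-oo], whose absolute value is infinite. The
    margin [e / 2] keeps the inequality strict after the supremum. *)
Lemma semidist_lt (R : realType) (W : normedModType R) (Y1 Y2 : set W) (e : R) :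
  0 < e -> Y1 !=set0 ->
  (forall y1, Y1 y1 -> exists2 y2, Y2 y2 & `|y1 - y2| < e / 2) ->
  (`|semidist Y1 Y2| < e%:E)%E.
Proof.
move=> e0 [y1 Yy1] close.
have dist_ge0 : (0 <= semidist Y1 Y2)%E.
  apply: le_trans (ereal_sup_ubound _); last by exists y1; first exact: Yy1.
  by apply: le_ereal_inf_tmp => _ [y2 _ <-]; rewrite lee_fin.
rewrite gee0_abs//; apply: (@le_lt_trans _ _ (e / 2)%:E); last first.
  by rewrite lte_fin ltr_pdivrMr// ltr_pMr// ltr1n.
apply: ge_ereal_sup => _ [y Yy <-].
have [y2 Yy2 yy2] := close y Yy.
apply: (@le_trans _ _ `|y - y2|%:E); last by rewrite lee_fin ltW.
by apply: ereal_inf_lbound; exists y2.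
Qed.

Theorem theorem3p5 (R : realType) (m : nat) (r : {posnum R})
  (Omega : metricType R) (sigma : R -> Omega -> Omega)
  (B : 'M[R]_m) (F : Omega -> CX m r -> 'cV[R]_m)
  (w0 : Omega) (phi0 : XL m r)
  (m_gt0 : (0 < m)%N)
  (Omega_compact : compact [set: Omega])
  (sigma_flow : continuous_flow sigma)
  (sigma_minimal : minimal_flow sigma)
  (B_quasipositive : quasipositive B)
  (F_continuous : continuous (fun p : Omega * CX m r => F p.1 p.2))
  (F_C1 : C1_second F)
  (F_bounded : forall X1 : set (CX m r), bounded_set X1 ->
     bounded_set [set F w phi | w in [set: Omega] & phi in X1])
  (F_monotone : forall w phi psi, leB B phi psi ->
     vle (B *m (psi (delay_itv0 r) - phi (delay_itv0 r))) (F w psi - F w phi))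
  (F_sublinear : forall w psi (lambda : R), leB B 0 psi -> 0 <= lambda <= 1 ->
     vle (lambda *: F w psi) (F w (lambda *: psi)))
  (phi0_interior : gtB0 B phi0)
  (phi0_bounded : bounded_set
     [set sol_segment sigma F t w0 phi0 | t in [set t : R | 0 <= t]])
  (phi0_persistent : exists psi0 : XL m r, gtB0 B psi0 /\
     forall t : R, 0 <= t -> leB B psi0 (sol_segment sigma F t w0 phi0)) :
  let E := omega_limits sigma F B in
  [/\ [/\ E `<=` [set p | gtB0 B p.2],
          forall t : R, 0 <= t -> skew_product sigma F t @` E = E &
          locally_compact [set: set_type E]],
      {within [set q : R * (Omega * XL m r) | 0 <= q.1 /\ E q.2],
         continuous (fun q => skew_product sigma F q.1 q.2)} &
      forall j : nat, (1 <= j)%N ->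
        cvg0_uniformly (fun (t : R) (w : Omega) =>
          semidist (sol_segmentL sigma F t w @` order_box B phi0 j)
                   (fiber E (sigma t w))) /\
        cvg0_uniformly (fun (t : R) (w : Omega) =>
          semidist (sol_segmentL sigma F t (sigma (- t) w) @`
                      order_box B phi0 j)
                   (fiber E w))].
Proof.
move=> E.
have H : sublinear_system sigma B F by split.
have [psi0 [psi0_gt psi0_le]] := phi0_persistent.
have [z sz z0] := persistent_solution psi0_gt m_gt0 (psi0_le 0 (lexx 0)).
have zE t : 0 <= t -> sol_segment sigma F t w0 phi0 = segment z t.
  by move=> t0; rewrite -z0; exact: (sol_segment_solves H sz t0).
have [K zK] : exists K : R, forall t, 0 <= t -> `|segment z t : CX m r| <= K.
  have [K [_ KP]] := phi0_bounded.
  exists (K + 1) => t t0; apply: (KP (K + 1)); first by rewrite ltrDl.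
  by exists t; [exact: t0|exact: zE].
have psiz t : 0 <= t -> leB B psi0 (segment z t).
  by move=> t0; rewrite -(zE t t0); exact: psi0_le.
have [c0 c0_ge1 oz] := persistent_bounded_orbit H psi0_gt sz z0 zK psiz.
have base := entire_orbit_over H psi0_gt c0_ge1 oz.
split.
- split.
  + exact: (omega_limits_gtB0 H psi0_gt c0_ge1 base).
  + exact: (omega_limits_invariant H psi0_gt c0_ge1 base).
  + exact: (omega_limits_locally_compact H psi0_gt c0_ge1 base).
- exact: (omega_limits_continuous H psi0_gt c0_ge1 base).
move=> j j1; have [c1 c1_ge1 pphi0] := gtB0_part_near psi0_gt phi0_interior.
have j1R : 1 <= j%:R :> R by rewrite ler1n.
have j0R : 0 < j%:R :> R := lt_le_trans ltr01 j1R.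
have c1_gt0 : 0 < c1 := lt_le_trans ltr01 c1_ge1.
have box_near phi : order_box B phi0 j phi -> part_near B (c1 * j%:R) psi0 phi.
  by move=> box; apply: (part_near_trans c1_gt0 j0R pphi0); exact: box.
have box0 : order_box B phi0 j phi0.
  exact: (part_near_refl (gtB0_KB phi0_interior) j1R).
have attract e : 0 < e -> \forall t \near +oo, forall w,
    (`|semidist (sol_segmentL sigma F t w @` order_box B phi0 j)
         (fiber E (sigma t w))| < e%:E)%E.
  move=> e0; have e2 : 0 < e / 2 by rewrite divr_gt0.
  have [T TP] := uniform_attraction H psi0_gt c0_ge1 base
    (mulr_ege1 c1_ge1 j1R) e2.
  apply: filterS (nbhs_pinfty_ge (num_real T)) => t Tt w.
  apply: semidist_lt => //.
    by exists (sol_segmentL sigma F t w phi0), phi0.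
  by move=> _ [phi /box_near pphi <-]; exact: TP Tt pphi.
split=> e e0; first exact: attract.
(* Pullback attraction is forward attraction at the base point [sigma (- t) w], thanks to uniformity
   in the base. *)
apply: filterS (attract e e0) => t /(_ (sigma (- t) _)) h w.
by have := h w; rewrite -(flowD H) addNr (flow0 H).
Qed.
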